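(* Suppose that $F$ belongs to the Hall class with parameters $(\alpha,\beta,A,B)$ and $\alpha>1$, and that $r\sim sn^{2\beta/(2\beta+\alpha)}$ for a positive constant $s$. Then $$u^{-1}n^{(1/2)-(\alpha/(2\beta+\alpha))/2}\left(e(u)-e_{\widehat{\boldsymbol\theta}}(u)\right)$$ converges in distribution to the normal distribution with asymptotic mean $$-\frac{\alpha}{(\alpha-1)^2}A^{-\beta/\alpha}B\beta(\alpha+\beta)^{-1}s^{\beta/\alpha}$$ and asymptotic variance $\alpha^2(\alpha-1)^{-4}s^{-1}$. Hence $$\mathbb{E}[(e_{\widehat{\boldsymbol\theta}}(u)-e(u))^2]\sim u^2n^{-1+(\alpha/(2\beta+\alpha))}\frac{\alpha^2}{(\alpha-1)^4}\left(A^{-2\beta/\alpha}B^2\beta^2(\alpha+\beta)^{-2}s^{2\beta/\alpha}+s^{-1}\right).$$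
   Context: $X_1,\dots,X_n$ are i.i.d. real random variables with continuous distribution function $F$ and density $f$; $X_{n,1}\le\dots\le X_{n,n}$ are the order statistics; $n\to\infty$ and $u=u_n\to\infty$. Hall class: there are $\alpha>0$, $\beta\ge1/2$, $A>0$, $B\neq0$ with $x^{\alpha+\beta}\{1-F(x)-Ax^{-\alpha}(1+Bx^{-\beta})\}\to0$ as $x\to\infty$. The mean excess function is $e(u):=\int_0^\infty x\,\frac{f(x+u)}{1-F(u)}\,dx$; it exists only if the extreme value index $\gamma=\alpha^{-1}$ satisfies $\gamma<1$. The plug-in estimator is $e_{\widehat{\boldsymbol\theta}}(u):=\frac{u}{\widehat\alpha-1}$, where $\alpha$ is estimated from the $r$ largest order statistics by $$\widehat\alpha:=\left\{r^{-1}\sum_{j=1}^r\ln X_{n,n-j+1}-\ln X_{n,n-r}\right\}^{-1}.$$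
   Formalization: The limit law is proved for the estimator minus e(u) (printed sign is wrong); u must satisfy n^{1/(2β+α)}/u→0 (false for slower u); the expectation, infinite in general, is read asymptotically: limit in n of truncated means of squared error over the right side, truncation then removed. *)

(* Defs.v *)
From HB Require Import structures.
From mathcomp Require Export all_boot all_order all_algebra finmap.
From mathcomp Require Export all_classical all_reals all_analysis.

Set Implicit Arguments.
Unset Strict Implicit.
Unset Printing Implicit Defensive.

Export Order.TTheory GRing.Theory Num.Theory.
Export numFieldNormedType.Exports.

Local Open Scope classical_set_scope.
Local Open Scope ring_scope.

(** Mutual independence: the product rule over every finite subfamily. *)
Definition independent_RVs {d : measure_display} {T : measurableType d}
    {R : realType} (P : probability T R) (X : nat -> {RV P >-> R}) : Prop :=
  forall (J : {fset nat}) (E : nat -> set R), (forall i, measurable (E i)) ->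
    P (\bigcap_(i in [set` J]) (X i @^-1` E i)) =
    (\prod_(i <- J) P (X i @^-1` E i))%E.

Definition has_cdf {d : measure_display} {T : measurableType d}
    {R : realType} (P : probability T R) (Y : {RV P >-> R}) (F : R -> R) : Prop :=
  forall x, cdf Y x = (F x)%:E.

Definition has_density {d : measure_display} {T : measurableType d}
    {R : realType} (P : probability T R) (Y : {RV P >-> R}) (f : R -> R) : Prop :=
  [/\ measurable_fun [set: R] f, (forall x, 0 <= f x) &
      forall E : set R, measurable E ->
        distribution P Y E = (\int[lebesgue_measure]_(x in E) (f x)%:E)%E].

Definition hall_class {R : realType} (F : R -> R) (alpha beta A B : R) : Prop :=
  [/\ 0 < alpha, 1 / 2 <= beta, 0 < A, B != 0 &
      x `^ (alpha + beta) *
        (1 - F x - A * x `^ (- alpha) * (1 + B * x `^ (- beta)))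
      @[x --> +oo] --> (0 : R)].

Definition mean_excess {R : realType} (F f : R -> R) (u : R) : R :=
  \int[lebesgue_measure]_(x in `[0, +oo[) (x * (f (x + u) / (1 - F u))).

(** [order_stat X n k w] is $X_{n,k}(w)$, the [k]-th smallest (1 <= k <= n) of
    the first [n] variables, which are [X 0, ..., X n.-1]. *)
Definition order_stat {T : Type} {R : realType} (X : nat -> T -> R)
    (n k : nat) (w : T) : R :=
  nth 0 (sort <=%O [seq X i w | i <- iota 0 n]) k.-1.

Definition hill {T : Type} {R : realType} (X : nat -> T -> R)
    (n r : nat) (w : T) : R :=
  (r%:R^-1 * (\sum_(1 <= j < r.+1) ln (order_stat X n (n - j + 1) w))
    - ln (order_stat X n (n - r) w))^-1.

Definition plugin_mean_excess {T : Type} {R : realType} (X : nat -> T -> R)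
    (n r : nat) (u : R) (w : T) : R :=
  u / (hill X n r w - 1).

(** Convergence of the distribution functions at every point that is not an
    atom of the limit law. *)
Definition cvg_in_distribution {d : measure_display} {T : measurableType d}
    {R : realType} (P : probability T R) (Y : nat -> T -> R)
    (mu : set R -> \bar R) : Prop :=
  forall x : R, mu [set x] = 0%E ->
    P [set w | Y n w <= x] @[n --> \oo] --> mu [set` `]-oo, x]].

(** [Y n] has asymptotic expectation [a n], for nonnegative [Y n].  When
    [Y n / a n] converges in law to [Z], this says that [Z] has expectation 1,
    and it is equivalent to ['E_P[Y n] ~ a n] if [Y n / a n] is moreover
    uniformly integrable.  Truncation is needed for the squared error of
    [plugin_mean_excess], which has a pole at [hill = 1]: for every fixed [n]
    it has infinite expectation as soon as the density of [hill X n r] is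
    bounded below near 1. *)
Definition asymptotic_expectation {d : measure_display} {T : measurableType d}
    {R : realType} (P : probability T R) (Y : nat -> T -> R)
    (a : nat -> R) : Prop :=
  exists2 m : R -> R,
    (forall K : R, 0 < K ->
       ('E_P[fun w => Num.min (Y n w / a n)%R K])%E
         @[n --> \oo] --> (m K)%:E) &
    m K @[K --> +oo] --> (1 : R).

(* Main.v *)
(* Put phi = - ln (1 - F). The phi(X_i) are standard exponential, so the sum of
   the excesses of the r largest of them over phi(X_{n,n-r}) has exactly a
   gamma law with shape r, whose density, once standardised, converges to the
   Gaussian one. The Hall condition inverts to
     alpha ln x = phi(x) + ln A + (1 - F(x))^(beta/alpha) (D + o(1)),
     D = B A^(-beta/alpha),
   hence alpha/hill is the gamma sum divided by r, plus a bias which a weak law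
   of large numbers for the uniform variables 1 - F(X_i) evaluates. Replacing
   e(u) with u/(alpha - 1) costs O(u^(1-beta)), negligible by the assumption on
   u, and linearising t |-> 1/(t - 1) gives the limit law. For the mean square,
   the truncated second moments are integrals of tail probabilities, so they
   converge by dominated convergence, and the limit law has second moment
   mu^2 + sigma^2. *)
From HB Require Import structures.
From mathcomp Require Import ring lra zify measurable_realfun.
Require Import Defs.

Set Implicit Arguments.
Unset Strict Implicit.
Unset Printing Implicit Defensive.

Local Open Scope classical_set_scope.
Local Open Scope ring_scope.

Local Notation leb := lebesgue_measure.

(** * Independence of a variable and a block of others *)

(** A sum over the r largest values runs over a random index set. As phi and 1 - F are monotone,
    each such sum is rewritten as a sum, over the whole sample, of positive parts of differences
    with the value at X_{n,n-r}, so that only the threshold stays random. For the gamma law the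
    threshold is frozen by conditioning on the variable that carries it. For the bias it is replaced
    with its deterministic equivalent r/n, the error being Lipschitz in the threshold. The bias
    becomes constant in the limit, so no joint law with the gamma sum enters. Its factor is the
    integral of 1 - v^p over [0, 1] with p = beta/alpha, namely p/(1 + p) = beta/(alpha + beta). The
    order of r makes the random error r^(-1/2) and the bias (r/n)^p both of order n^(-beta/(2 beta +
    alpha)), which is why both survive in the limit law. The error of the plug-in is an exact
    multiple of alpha/hill - 1, with a random slope that converges in probability. *)

Definition cylinders {d : measure_display} {T : measurableType d}
    {R : realType} (P : probability T R) (X : nat -> {RV P >-> R})
    (K : set nat) : set (set T) :=
  [set A | exists J : {fset nat}, exists E : nat -> set R,
    [/\ [set` J] `<=` K, forall i, measurable (E i) &
        A = \bigcap_(i in [set` J]) (X i @^-1` E i)]].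

Lemma cylinders_setI {d : measure_display} {T : measurableType d}
    {R : realType} (P : probability T R) (X : nat -> {RV P >-> R})
    (K : set nat) : setI_closed (cylinders X K).
Proof.
move=> _ _ [J1 [E1 [J1K mE1 ->]]] [J2 [E2 [J2K mE2 ->]]].
exists (J1 `|` J2)%fset.
exists (fun i => (if i \in J1 then E1 i else setT) `&`
                 (if i \in J2 then E2 i else setT)); split.
- by move=> i /=; rewrite in_fsetU => /orP[/J1K|/J2K].
- by move=> i; apply: measurableI; case: ifP.
- apply/seteqP; split=> w /=.
  + by move=> [H1 H2] i /= _; split; case: ifP => // iJ;
      [exact: H1|exact: H2].
  + move=> H; split=> i /= iJ; have := H i; rewrite /= in_fsetU iJ ?orbT;
      by move=> /(_ isT) [].
Qed.

Lemma cylinders_measurable {d : measure_display} {T : measurableType d}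
    {R : realType} (P : probability T R) (X : nat -> {RV P >-> R})
    (K : set nat) A : cylinders X K A -> measurable A.
Proof.
move=> [J [E [_ mE ->]]]; apply: fin_bigcap_measurable => // i _.
by rewrite -[X in measurable X]setTI; exact: measurable_funP.
Qed.

(** Both sides are finite measures in [A]: the restriction of [P] to the event on [X j], and [P]
    scaled by the probability of that event. They agree on the cylinders over [K], a pi-system,
    hence on the generated sigma-algebra. *)
Lemma indep_sigma {d : measure_display} {T : measurableType d}
    {R : realType} (P : probability T R) (X : nat -> {RV P >-> R})
    (K : set nat) (j : nat) (A : set T) (E : set R) :
  independent_RVs X -> ~ K j -> <<s cylinders X K >> A -> measurable E ->
  P (A `&` X j @^-1` E) = (P A * P (X j @^-1` E))%E.
Proof.
move=> indep Kj sA mE.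
have mB : measurable (X j @^-1` E).
  by rewrite -[X in measurable X]setTI; exact: measurable_funP.
have PBf : P (X j @^-1` E) \is a fin_num by exact: fin_num_measure.
have r0 : 0 <= fine (P (X j @^-1` E)) by rewrite fine_ge0.
pose m2 : {measure set T -> \bar R} := mscale (NngNum r0) P.
rewrite muleC -[X in (X * _)%E]fineK//.
change (mrestr P mB A = m2 A).
apply: (g_sigma_algebra_measure_unique (cylinders X K) _ (fun=> setT)) => //.
- by move=> B /cylinders_measurable.
- move=> _; exists fset0, (fun=> setT); split => //.
  by rewrite predeqE => w; split => // _ i /=; rewrite inE.
- by rewrite bigcup_const//; exists 0%N.
- exact: cylinders_setI.
- move=> _ [J [F [JK mF ->]]].
  have jJ : j \notin J by apply/negP => /(JK j).
  have m2E C : m2 C = (P (X j @^-1` E) * P C)%E by rewrite -[X in (X * _)%E]fineK.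
  rewrite m2E /mrestr.
  (* As [j] lies outside [J], the event on [X j] is one more side of the cylinder, and the product
     rule over the enlarged index set applies. *)
  pose F' i := if i == j then E else F i.
  transitivity (P (\bigcap_(i in [set` (j |` J)%fset]) (X i @^-1` F' i))).
    congr (P _); apply/seteqP; split=> w /=.
    + move=> [H1 H2] i /=; rewrite in_fset1U /F' => /orP[/eqP ->|iJ].
        by rewrite eqxx.
      by case: eqP => [->|_] //; exact: H1.
    + move=> H; split; last first.
        by have := H j; rewrite /= in_fset1U eqxx /F' eqxx => /(_ isT).
      move=> i iJ; have := H i; rewrite /= in_fset1U /F'.
      case: eqP => [eij|_]; last by rewrite iJ => /(_ isT).
      by move: iJ; rewrite /= eij (negbTE jJ).
  rewrite !indep//; last by move=> i; rewrite /F'; case: eqP.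
  rewrite big_fsetU1//= /F' eqxx; congr (_ * _)%E.
  apply: eq_fbigr => i /= iJ _; case: eqP => // eij.
  by move: iJ jJ; rewrite eij => ->.
- by move=> k; rewrite /= /mrestr setTI -ge0_fin_numE// fin_num_measure.
Qed.

(** The same sample space with only the sigma-algebra of the variables indexed by [K]; conditioning
    on another variable becomes Tonelli on the product of this space with the line. *)
Notation sub_space X K := (g_sigma_algebraType (cylinders X K)).

Lemma sub_space_measurable {d : measure_display} {T : measurableType d}
    {R : realType} (P : probability T R) (X : nat -> {RV P >-> R})
    (K : set nat) (A : set (sub_space X K)) :
  measurable A -> measurable (A : set T).
Proof.
move=> mA; move: A mA; apply: (smallest_sub (sigma_algebra_measurable T)).
by move=> A; exact: cylinders_measurable.
Qed.

Lemma measurable_sub_space_RV {d : measure_display} {T : measurableType d}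
    {R : realType} (P : probability T R) (X : nat -> {RV P >-> R})
    (K : set nat) (i : nat) :
  K i -> measurable_fun setT (X i : sub_space X K -> R).
Proof.
move=> Ki _ E mE; rewrite setTI; apply: sub_sigma_algebra.
exists [fset i]%fset, (fun=> E); split => //.
  by move=> k /=; rewrite inE => /eqP ->.
apply/seteqP; split => w /=.
  by move=> H k /=; rewrite inE => /eqP ->.
by move=> /(_ i); rewrite /= inE eqxx => /(_ isT).
Qed.

Lemma measurable_to_sub_space {d : measure_display} {T : measurableType d}
    {R : realType} (P : probability T R) (X : nat -> {RV P >-> R})
    (K : set nat) : measurable_fun setT (id : T -> sub_space X K).
Proof. by move=> _ A mA; rewrite setTI; exact: (@sub_space_measurable _ _ _ _ X K). Qed.

(** Stands in for conditioning on X_j = y. Independence makes the law of the pair (w, X_j(w)), with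
    w observed in [sub_space], a product measure. Measurability of the section probabilities is
    included because they are later integrated against explicit densities. *)
Lemma indep_section {d : measure_display} {T : measurableType d}
    {R : realType} (P : probability T R) (X : nat -> {RV P >-> R})
    (K : set nat) (j : nat) (M : set (sub_space X K * R)) :
  independent_RVs X -> ~ K j -> measurable M ->
  measurable_fun [set: R] (fun y => P (ysection M y : set T)) /\
  P [set w | M (w, X j w)] =
    (\int[distribution P (X j)]_y P (ysection M y : set T))%E.
Proof.
move=> indep Kj mM.
pose V0 : T -> sub_space X K := id.
have mV0 : measurable_fun setT V0 by exact: measurable_to_sub_space.
pose V : {mfun T >-> sub_space X K} := HB.pack V0 (isMeasurableFun.Build _ _ _ _ V0 mV0).
pose W0 w : sub_space X K * R := (V w, X j w).
have mW0 : measurable_fun setT W0.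
  by apply/measurable_fun_pairP; split; exact: measurable_funP.
pose W : {mfun T >-> (sub_space X K * R)%type} :=
  HB.pack W0 (isMeasurableFun.Build _ _ _ _ W0 mW0).
pose m1 : probability (sub_space X K) R := distribution P V.
pose m2 : probability R R := distribution P (X j).
have E1 : P [set w | M (w, X j w)] = (m1 \x m2)%E M.
  rewrite (@product_measure_unique _ _ _ _ _ m1 m2 (distribution P W))//.
  move=> A B mA mB; rewrite /m1 /m2 /distribution /pushforward/=.
  by rewrite -(indep_sigma indep Kj).
split; first exact: (measurable_fun_ysection m1 mM).
rewrite E1.
(* The product [\x^] is by definition the integral over y of the sections; agreement on rectangles
   identifies it with [\x]. *)
transitivity ((m1 \x^ m2)%E M) => //.
apply: product_measure_unique => //.
by move=> A B mA mB; exact: (product_measure2E m1 m2 mA mB).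
Qed.

(** * Gamma and exponential laws *)

(** The distribution function, on x >= 0, of a sum of q standard exponential variables, written as
    the probability that a Poisson variable of mean x is at least q. At q = 0 it is the constant 1,
    the law of an empty sum. *)
Definition gamma_cdf {R : realType} (q : nat) (x : R) : R :=
  1 - expR (- x) * \sum_(k < q) x ^+ k / k`!%:R.

Lemma is_derive_pow_fact {R : realType} (q : nat) (x : R) :
  is_derive x 1 (fun y : R => \sum_(k < q) y ^+ k / k`!%:R)
    (\sum_(k < q.-1) x ^+ k / k`!%:R).
Proof.
case: q => [|q].
  rewrite big_ord0 (_ : (fun=> _) = cst 0); first exact: is_derive_cst.
  by apply/funext => y; rewrite big_ord0.
elim: q => [|q IH] /=.
  rewrite big_ord0 (_ : (fun=> _) = cst 1); first exact: is_derive_cst.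
  by apply/funext => y; rewrite big_ord1 fact0 expr0 divr1.
rewrite (_ : (fun=> _) = (fun y : R => \sum_(k < q.+1) y ^+ k / k`!%:R) +
   (fun y => y ^+ q.+1 / q.+1`!%:R)); last first.
  by apply/funext => y; rewrite big_ord_recr.
rewrite big_ord_recr /=; apply: is_deriveD.
rewrite (_ : (fun y : R => _) = cst (q.+1`!%:R)^-1 * ((id : R -> R) ^+ q.+1)); last first.
  by apply/funext => y; rewrite mulrfctE exprfctE /= mulrC.
have H := is_deriveM (is_derive_cst (q.+1`!%:R^-1 : R) x 1)
  (is_deriveX q.+1 (is_derive_id x 1)).
apply: (is_derive_eq H).
rewrite fctE /GRing.scale/= factS natrM.
by rewrite mulr0 addr0 mulr1 invfM mulrACA mulVf ?pnatr_eq0// mul1r mulrC.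
Qed.

(** The product rule telescopes: differentiating the sum drops its top term, and only that term
    survives. *)
Lemma is_derive_gamma_cdf {R : realType} (q : nat) (x : R) :
  is_derive x 1 (gamma_cdf q.+1) (expR (- x) * (x ^+ q / q`!%:R)).
Proof.
rewrite /gamma_cdf.
have D1 := is_derive_pow_fact q.+1 x.
have D2 : is_derive x 1 (fun y : R => expR (- y)) (- expR (- x)).
  by apply: is_derive_eq; rewrite mulrN1.
have := is_deriveB (is_derive_cst (1:R) x 1) (is_deriveM D2 D1).
rewrite /= (_ : _ - _ = gamma_cdf q.+1)//.
move=> H; apply: (is_derive_eq H).
rewrite /GRing.scale/= big_ord_recr/=.
set s := \sum_(_ < _) _; set a := x ^+ q / _; set e := expR _.
by ring.
Qed.

(** The hypothesis on all measurable sets makes [nu] absolutely continuous and forces its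
    Radon-Nikodym derivative to equal [g] almost everywhere. *)
Lemma integral_density {R : realType} (nu : probability (measurableTypeR R) R) (g : R -> R)
    (f : R -> \bar R) (U : set R) :
  measurable_fun [set: R] g -> (forall x, 0 <= g x) ->
  (forall A, measurable A -> nu A = \int[leb]_(x in A) (g x)%:E)%E ->
  measurable U -> nu.-integrable U f ->
  (\int[nu]_(x in U) f x = \int[leb]_(x in U) (f x * (g x)%:E))%E.
Proof.
move=> mg g0 nuE mU intf.
have mgE : measurable_fun [set: R] (fun x : R => (g x)%:E) by exact/measurable_EFinP.
have dom : nu `<< lebesgue_measure.
  apply/null_content_dominatesP => A mA A0.
  by rewrite nuE//; apply: null_set_integral => //; exact: measurable_funTS.
rewrite -(Radon_Nikodym_change_of_variables dom)//=.
apply: ae_eq_integral => //.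
- apply: emeasurable_funM => //; first exact: measurable_int intf.
  apply: measurable_funTS; apply: (measurable_int (@lebesgue_measure R)).
  exact: Radon_Nikodym_integrable.
- apply: emeasurable_funM => //; first exact: measurable_int intf.
  exact: measurable_funTS.
- apply: ae_eqe_mul2l => /=.
  rewrite Radon_NikodymE//=; case: cid => /= h [h1 h2 h3].
  apply: integral_ae_eq => //=.
  + exact: integrableS h2.
  + exact: measurable_funTS.
  + by move=> E E01 mE; rewrite -h3//= nuE.
Qed.

Lemma measure_rays_unique {R : realType}
    (nu1 nu2 : probability (measurableTypeR R) R) :
  (forall x, nu1 `]x, +oo[%classic = nu2 `]x, +oo[%classic) ->
  forall A, measurable A -> nu1 A = nu2 A.
Proof.
move=> H A mA.
apply: (@measure_unique _ R (measurableTypeR R) (@RGenOInfty.G R)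
  (fun n : nat => `](- n%:R : R), +oo[%classic) _ _ _ _ nu1 nu2 _ _ A mA).
- exact: RGenOInfty.measurableE.
- move=> _ _ [x ->] [y ->]; exists (Num.max x y).
  by rewrite predeqE => z /=; rewrite !in_itv/= !andbT gt_max; split=> /andP.
- by move=> i; eexists; reflexivity.
- rewrite predeqE => x; split => // _; exists (Num.bound `|x|) => //=.
  rewrite in_itv/= andbT ltrNl.
  apply: (le_lt_trans _ (archi_boundP (normr_ge0 x))).
  by rewrite -normrN ler_norm.
- by move=> _ [x ->]; exact: H.
- move=> k; apply: (@le_lt_trans _ _ 1%E); last by rewrite ltry.
  exact: probability_le1.
Qed.

Lemma exponential_prob_ray {R : realType} (x : R) : 0 <= x ->
  exponential_prob 1 `]x, +oo[%classic = (expR (- x))%:E.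
Proof.
move=> x0; rewrite /exponential_prob integral_itv_obnd_cbnd; last first.
  apply/measurable_EFinP/measurable_funTS; exact: measurable_exponential_pdf.
rewrite (@ge0_continuous_FTC2y _ _ (fun x => - (expR (- 1 * x))) _ 0)//.
- by rewrite EFinN oppeK add0e mulN1r.
- by move=> y _; apply: exponential_pdf_ge0.
- apply: (@continuous_subspaceW R^o _ _ [set` `[0, +oo[%R]).
    by move=> y /=; rewrite !in_itv/= !andbT; exact: le_trans.
  exact: within_continuous_exponential_pdf.
- rewrite -oppr0; apply: cvgN.
  rewrite (_ : (fun x => expR (- 1 * x)) = (fun z => expR (- z))); last first.
    by apply: eq_fun => y; rewrite mulN1r.
  exact: cvgr_expR.
- apply/cvg_at_right_filter; apply: cvgN; apply: continuous_comp.
    exact: mulrl_continuous.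
  exact: continuous_expR.
- move=> y; rewrite in_itv/= andbT => xy; apply: derive1_exponential_pdf.
  by rewrite in_itv/= andbT (le_lt_trans x0).
Qed.

(** The tail at t = 0 forces Y > 0 almost surely, so the tails at nonnegative t fix the measure of
    every ray and hence the law. The bound of [f] by 1 gives integrability. *)
Lemma exponential_law {d : measure_display} {T : measurableType d}
    {R : realType} (P : probability T R) (Y : {RV P >-> R})
    (f : R -> \bar R) :
  (forall t, 0 <= t -> P [set w | t < Y w] = (expR (- t))%:E) ->
  measurable_fun [set: R] f -> (forall y, 0 <= f y <= 1)%E ->
  (\int[distribution P Y]_y f y =
   \int[leb]_(y in `[0%R, +oo[) (f y * (expR (- y))%:E))%E.
Proof.
move=> HY mf f01.
have f0 y : (0 <= f y)%E by have /andP[] := f01 y.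
pose Y0 : T -> measurableTypeR R := Y.
have mY0 : measurable_fun setT Y0.
  by move=> mT A mA; have mY := @measurable_funP _ _ _ _ setT Y; exact: (mY mT A mA).
pose Y' : {RV P >-> measurableTypeR R} := HB.pack Y0 (isMeasurableFun.Build _ _ _ _ Y0 mY0).
rewrite ge0_integral_distribution//.
transitivity (\int[distribution P Y']_y f y)%E.
  by rewrite ge0_integral_distribution.
pose nu : probability (measurableTypeR R) R := distribution P Y'.
have R01 : (0:R) < 1 by [].
pose ex1 : probability (measurableTypeR R) R := exponential_prob 1.
pose ex := ex1 R01.
have nuE A : measurable A -> nu A = (\int[leb]_(x in A) (exponential_pdf 1 x)%:E)%E.
  move=> mA; rewrite (@measure_rays_unique _ nu ex)// => x.
  have [x0|x0] := leP 0 x.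
    rewrite [RHS]exponential_prob_ray// -HY// /nu/= /distribution /pushforward.
    by congr (P _); apply/seteqP; split=> w /=; rewrite in_itv/= andbT.
  have one (n : probability (measurableTypeR R) R) :
      n `]0, +oo[%classic = 1%E -> n `]x, +oo[%classic = 1%E.
    move=> n1; apply/eqP; rewrite eq_le probability_le1//= -n1.
    apply: le_measure; rewrite ?inE//.
    by move=> y /=; rewrite !in_itv/= !andbT; exact: lt_trans.
  rewrite !one//.
    by rewrite /ex [LHS]exponential_prob_ray// oppr0 expR0.
  have -> : (1 : \bar R)%E = P [set w | 0 < Y w] by rewrite HY// oppr0 expR0.
  rewrite /nu/= /distribution /pushforward.
  by congr (P _); apply/seteqP; split=> w /=; rewrite in_itv/= andbT.
rewrite (integral_density (@measurable_exponential_pdf R 1) _ nuE)//.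
- rewrite [RHS]integral_mkcond; apply: eq_integral => y _; rewrite patchE.
  case: ifPn => [|/negP]; rewrite inE/= in_itv/= andbT => y0.
    by rewrite exponential_pdfE//= mul1r mulN1r.
  rewrite lt0_exponential_pdf ?mule0// ltNge.
  by apply/negP.
- by move=> x; apply: exponential_pdf_ge0.
- apply/integrableP; split => //.
  apply: (@le_lt_trans _ _ (\int[nu]_x (cst 1 x))%E).
    apply: ge0_le_integral => //.
    + exact: measurableT_comp.
    + by move=> y _; rewrite gee0_abs//; have /andP[] := f01 y.
  rewrite integral_cst//= mul1e; apply: (@le_lt_trans _ _ 1%E); last by rewrite ltry.
  exact: (probability_le1 nu).
Qed.

Lemma gamma_cdf0 {R : realType} (q : nat) : gamma_cdf q.+1 (0 : R) = 0.
Proof.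
rewrite /gamma_cdf oppr0 expR0 mul1r big_ord_recl big1 ?addr0.
  by rewrite expr0 fact0 divr1 subrr.
by move=> i _; rewrite expr0n/= mul0r.
Qed.

(** An antiderivative of the convolution integrand. [gamma_cdf q] minus [gamma_cdf q.+1] is the
    density of [gamma_cdf q.+1], so the product rule collapses; the additional term is expR (- z) up
    to sign, constant in y. *)
Lemma is_derive_gamma_conv {R : realType} (q : nat) (z y : R) :
  is_derive y 1 (fun y => - expR (- y) * (gamma_cdf q.+1 (z - y) + expR (- (z - y))))
    (gamma_cdf q (z - y) * expR (- y)).
Proof.
have D1 := is_derive_gamma_cdf q (z - y).
have Dz : is_derive y 1 (fun y => z - y) (- 1).
  have := is_deriveB (is_derive_cst z y 1) (is_derive_id y 1).
  by rewrite sub0r.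
have D2 := @is_derive1_comp R (gamma_cdf q.+1) (fun y => z - y) y _ _ D1 Dz.
have De : is_derive y 1 (fun y : R => expR (- y)) (- expR (- y)).
  by apply: is_derive_eq; rewrite mulrN1.
have Dez : is_derive y 1 (fun y => expR (- (z - y))) (expR (- (z - y))).
  rewrite (_ : (fun y => _) = expR \o (fun y => y - z)); last first.
    by apply/funext => v /=; rewrite opprB.
  by apply: is_derive_eq; rewrite opprB subr0 mulr1.
have := is_deriveM (is_deriveN De) (is_deriveD D2 Dez).
set F1 := (X in is_derive _ _ X); set F2 := (X in _ -> is_derive _ _ X _).
rewrite (_ : F1 = F2)//; move/is_derive_eq; apply.
rewrite !fctE /GRing.scale/= /gamma_cdf big_ord_recr/=.
set a := \sum_(_ < _) _; set b := (z - y) ^+ q / _.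
set e := expR (- y); set e' := expR (- (z - y)).
by ring.
Qed.

Lemma measurable_set_le {d : measure_display} {T : measurableType d}
    {R : realType} (f g : T -> R) :
  measurable_fun [set: T] f -> measurable_fun [set: T] g ->
  measurable [set x | f x <= g x].
Proof.
move=> mf mg; have m := measurable_funB mf mg.
rewrite (_ : [set x | _] = (f \- g) @^-1` `]-oo, 0]).
  by rewrite -[X in measurable X]setTI; exact: m.
by apply/seteqP; split=> x /=; rewrite in_itv/= subr_le0.
Qed.

Lemma measurable_set_lt {d : measure_display} {T : measurableType d}
    {R : realType} (f g : T -> R) :
  measurable_fun [set: T] f -> measurable_fun [set: T] g ->
  measurable [set x | f x < g x].
Proof.
move=> mf mg; have m := measurable_funB mf mg.
rewrite (_ : [set x | _] = (f \- g) @^-1` `]-oo, 0[).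
  by rewrite -[X in measurable X]setTI; exact: m.
by apply/seteqP; split=> x /=; rewrite in_itv/= subr_lt0.
Qed.

Lemma measurable_set_eq {d : measure_display} {T : measurableType d}
    {R : realType} (f g : T -> R) :
  measurable_fun [set: T] f -> measurable_fun [set: T] g ->
  measurable [set x | f x = g x].
Proof.
move=> mf mg; rewrite (_ : [set x | _] =
  [set x | f x <= g x] `&` [set x | g x <= f x]).
  by apply: measurableI; apply: measurable_set_le.
rewrite predeqE => x /=; split=> [->//|[fg gf]].
by apply/eqP; rewrite eq_le fg gf.
Qed.

Lemma measurable_sum_in {d : measure_display} {T : measurableType d}
    {R : realType} (I : seq nat) (h : nat -> T -> R) :
  (forall i, i \in I -> measurable_fun [set: T] (h i)) ->
  measurable_fun [set: T] (fun x => \sum_(i <- I) h i x).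
Proof.
elim: I => [|i I IH] H.
  rewrite (_ : (fun x => _) = cst 0); first exact: measurable_cst.
  by apply/funext => x; rewrite big_nil.
rewrite (_ : (fun x => _) = (fun x => h i x + \sum_(i <- I) h i x)).
  apply: measurable_funD; first by apply: H; rewrite inE eqxx.
  by apply: IH => k kI; apply: H; rewrite inE kI orbT.
by apply/funext => x; rewrite big_cons.
Qed.

(** * Exceedances of a level and their conditional gamma law *)

Definition exceed_count {T : Type} {R : realType} (xi : nat -> T -> R)
    (I : seq nat) (t : R) (w : T) : R :=
  \sum_(i <- I) (t < xi i w)%R%:R.

Definition exceed_sum {T : Type} {R : realType} (xi : nat -> T -> R)
    (I : seq nat) (t : R) (w : T) : R :=
  \sum_(i <- I) Num.max (xi i w - t) 0.

Lemma exceed_count_ge0 {T : Type} {R : realType} (xi : nat -> T -> R) I t w :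
  0 <= exceed_count xi I t w.
Proof. by apply: sumr_ge0 => i _; rewrite ler0n. Qed.

Lemma exceed_sum_ge0 {T : Type} {R : realType} (xi : nat -> T -> R) I t w :
  0 <= exceed_sum xi I t w.
Proof. by apply: sumr_ge0 => i _; rewrite le_max lexx orbT. Qed.

Lemma measurable_exceed_count {d : measure_display} {T : measurableType d}
    {R : realType} (xi : nat -> T -> R) (I : seq nat) (t : T -> R) :
  (forall i, i \in I -> measurable_fun [set: T] (xi i)) ->
  measurable_fun [set: T] t ->
  measurable_fun [set: T] (fun w => exceed_count xi I (t w) w).
Proof.
move=> mxi mt; apply: measurable_sum_in => i iI.
rewrite (_ : (fun x => _) = \1_[set w | t w < xi i w]).
  by apply: measurable_indic; apply: measurable_set_lt => //; exact: mxi.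
by apply/funext => w; rewrite indicE; congr ((nat_of_bool _)%:R); apply/idP/idP; rewrite inE.
Qed.

Lemma measurable_exceed_sum {d : measure_display} {T : measurableType d}
    {R : realType} (xi : nat -> T -> R) (I : seq nat) (t : T -> R) :
  (forall i, i \in I -> measurable_fun [set: T] (xi i)) ->
  measurable_fun [set: T] t ->
  measurable_fun [set: T] (fun w => exceed_sum xi I (t w) w).
Proof.
move=> mxi mt; apply: measurable_sum_in => i iI.
apply: measurable_maxr => //; apply: measurable_funB => //; exact: mxi.
Qed.

(** Convolution with one more exponential variable raises the shape by one; expR (- t) is the
    probability that this variable passes t, the rest being memorylessness. The constant c will be
    the probability of q exceedances among the others. *)
Lemma gamma_conv_integral {R : realType} (c : R) (q : nat) (t x : R) :
  0 <= t -> 0 <= x ->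
  (\int[leb]_(y in `[0%R, +oo[)
     ((if (t < y <= t + x)%R then c * gamma_cdf q (x - (y - t)) else 0)%:E
      * (expR (- y))%:E) =
   (c * (expR (- t) * gamma_cdf q.+1 x))%:E)%E.
Proof.
move=> t0 x0; pose z := t + x.
pose H (y : R) : R := - expR (- y) * (gamma_cdf q.+1 (z - y) + expR (- (z - y))).
have dH (y : R) : is_derive y 1 (fun y : R => c * H y : R) (c * (gamma_cdf q (z - y) * expR (- y))).
  have := is_deriveM (is_derive_cst c y 1) (is_derive_gamma_conv q z y).
  move/is_derive_eq; apply.
  by rewrite scaler0 addr0.
have cf : continuous (fun y : R => c * (gamma_cdf q (z - y) * expR (- y))).
  have cz : continuous (fun y : R => z - y).
    by move=> y; apply: cvgB; [exact: cvg_cst|exact: cvg_id].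
  have ce : continuous (fun y : R => expR (- y)).
    by move=> y; apply: continuous_comp; [exact: opp_continuous|exact: continuous_expR].
  have cG : continuous (gamma_cdf q : R -> R).
    move=> y; apply: cvgB; first exact: cvg_cst.
    apply: cvgM; first exact: ce.
    have [D _] := is_derive_pow_fact q y.
    exact/differentiable_continuous/derivable1_diffP.
  move=> y; apply: cvgM; first exact: cvg_cst.
  apply: cvgM; last exact: ce.
  by apply: (@continuous_comp _ _ _ (fun y : R => z - y) (gamma_cdf q)); [exact: cz|exact: cG].
transitivity (\int[leb]_(y in `]t, z])
    (c * (gamma_cdf q (z - y) * expR (- y)))%:E)%E.
  rewrite integral_mkcond [RHS]integral_mkcond; apply: eq_integral => y _.
  rewrite !patchE !mem_setE !in_itv/= andbT.
  case: ifPn => y0.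
    case: ifPn => ty; last by rewrite mul0e.
    rewrite -EFinM (_ : x - (y - t) = z - y); last by rewrite /z; ring.
    by rewrite mulrA.
  case: ifPn => // /andP[ty _].
  by move: y0; rewrite (le_trans t0 (ltW ty)).
rewrite integral_itv_obnd_cbnd; last first.
  apply/measurable_EFinP/measurable_funTS.
  exact: continuous_measurable_fun.
have [x1|x1] := eqVneq x 0.
  rewrite /z x1 addr0 set_itv1 integral_set1.
  by rewrite gamma_cdf0 !mulr0.
rewrite (@continuous_FTC2 _ _ (fun y => c * H y))//.
- rewrite -EFinB /H /z subrr (_ : t + x - t = x); last by ring.
  rewrite gamma_cdf0 oppr0 expR0 /gamma_cdf big_ord_recr/=.
  rewrite (_ : expR (- (t + x)) = expR (- t) * expR (- x)); last first.
    by rewrite -expRD opprD.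
  by congr (_%:E); ring.
- by rewrite /z ltrDl lt_neqAle eq_sym x1.
- exact: continuous_subspaceT.
- have cH y : {for y, continuous (fun y => c * H y)}.
    have [D _] := dH y.
    exact/differentiable_continuous/derivable1_diffP.
  split.
  + by move=> y _; have [] := dH y.
  + by apply/cvg_at_right_filter; exact: cH.
  + by apply/cvg_at_left_filter; exact: cH.
- by move=> y _; rewrite derive1E; have [_ ->] := dH y.
Qed.

(** Memorylessness: given q exceedances of t, the excesses behave as q independent standard
    exponentials. The product form covers conditioning events of probability zero. The induction
    adds one variable at a time. *)
Lemma gamma_cond {d : measure_display} {T : measurableType d}
    {R : realType} (P : probability T R) (xi : nat -> {RV P >-> R})
    (I : seq nat) (t : R) :
  independent_RVs xi ->
  (forall i s, 0 <= s -> P [set w | s < xi i w] = (expR (- s))%:E) ->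
  uniq I -> 0 <= t ->
  forall (q : nat) (x : R), 0 <= x ->
  P [set w | exceed_count xi I t w = q%:R /\ exceed_sum xi I t w <= x] =
  (P [set w | exceed_count xi I t w = q%:R] * (gamma_cdf q x)%:E)%E.
Proof.
move=> indep tail + t0; elim: I => [_ q x x0|j I IH /andP[jI uI] q x x0].
  case: q => [|q].
    rewrite (_ : [set w | _] = setT); last first.
      rewrite predeqE => w; split=> // _.
      by rewrite /exceed_count /exceed_sum/= !big_nil.
    rewrite (_ : [set w | _] = setT); last first.
      by rewrite predeqE => w; split=> // _; rewrite /exceed_count /= big_nil.
    by rewrite probability_setT /gamma_cdf big_ord0 mulr0 subr0 mule1.
  rewrite (_ : [set w | _] = set0); last first.
    rewrite predeqE => w; split=> //; rewrite /exceed_count/= big_nil => -[/eqP + _].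
    by rewrite eq_sym pnatr_eq0.
  rewrite (_ : [set w | _] = set0); last first.
    rewrite predeqE => w; split=> //; rewrite /exceed_count/= big_nil => /eqP.
    by rewrite eq_sym pnatr_eq0.
  by rewrite measure0 mul0e.
have {}IH := IH uI.
pose K : set nat := [set` I].
have Kj : ~ K j by apply/negP.
have mK i : i \in I -> measurable_fun [set: sub_space xi K] (xi i : sub_space xi K -> R).
  by move=> iI; exact: measurable_sub_space_RV.
have mN := measurable_exceed_count mK (measurable_cst t).
have mS := measurable_exceed_sum mK (measurable_cst t).
have mT i : i \in I -> measurable_fun [set: T] (xi i : T -> R) by [].
have NE w : exceed_count xi (j :: I) t w =
    (t < xi j w)%R%:R + exceed_count xi I t w.
  by rewrite /exceed_count big_cons.
have SE w : exceed_sum xi (j :: I) t w =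
    Num.max (xi j w - t) 0 + exceed_sum xi I t w.
  by rewrite /exceed_sum big_cons.
have mNq k : measurable ([set w | exceed_count xi I t w = k%:R] : set (sub_space xi K)).
  by apply: measurable_set_eq => //; exact: measurable_cst.
have mSx z : measurable ([set w | exceed_sum xi I t w <= z] : set (sub_space xi K)).
  by apply: measurable_set_le => //; exact: measurable_cst.
have subm (A : set (sub_space xi K)) : measurable A -> measurable (A : set T).
  exact: (@sub_space_measurable _ _ _ _ xi K).
have mt b : measurable (xi j @^-1` [set` Interval (BSide b t) +oo%O]).
  by apply: measurable_funPTI.
have mt' b : measurable (xi j @^-1` [set` Interval -oo%O (BSide b t)]).
  by apply: measurable_funPTI.
(* Either the new variable stays below t and changes neither the count nor the sum, or it exceeds t
   and its excess is convolved with the others. *)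
pose low (A : set T) := A `&` xi j @^-1` `]-oo, t].
pose A0 := [set w | exceed_count xi I t w = q%:R /\ exceed_sum xi I t w <= x].
pose A1 := [set w | t < xi j w /\ (1 + exceed_count xi I t w = q%:R /\
                    xi j w - t + exceed_sum xi I t w <= x)].
pose B0 := [set w | exceed_count xi I t w = q%:R].
pose B1 := [set w | t < xi j w /\ 1 + exceed_count xi I t w = q%:R].
have EA : [set w | exceed_count xi (j :: I) t w = q%:R /\
    exceed_sum xi (j :: I) t w <= x] = low A0 `|` A1.
  rewrite predeqE => w /=; rewrite NE SE /low/= in_itv/=.
  case: ltP => tx /=.
    rewrite maxEle subr_le0 (lt_geF tx)/=.
    by split=> [H|]; [right|case=> [[]|[]]].
  rewrite maxEle subr_le0 tx !add0r; split=> [H|]; first by left.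
  by case=> [[]|[]] //; rewrite ltNge tx.
have EB : [set w | exceed_count xi (j :: I) t w = q%:R] = low B0 `|` B1.
  rewrite predeqE => w /=; rewrite NE /low/= in_itv/=.
  case: ltP => tx /=.
    by split=> [H|]; [right|case=> [[]|[]]].
  rewrite !add0r; split=> [H|]; first by left.
  by case=> [[]|[]] //; rewrite ltNge tx.
have mNT : measurable_fun [set: T] (exceed_count xi I t).
  exact: (measurable_exceed_count mT (measurable_cst t)).
have mST : measurable_fun [set: T] (exceed_sum xi I t).
  exact: (measurable_exceed_sum mT (measurable_cst t)).
have mA0' : @measurable _ (sub_space xi K) A0 := measurableI _ _ (mNq q) (mSx x).
have mB0' : @measurable _ (sub_space xi K) B0 := mNq q.
have mA0 : measurable A0 := subm _ mA0'.
have mB0 : measurable B0 := subm _ mB0'.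
have mB1 : measurable B1.
  apply: measurableI; first exact: measurable_set_lt.
  by apply: measurable_set_eq => //; exact: measurable_funD.
have mA1 : measurable A1.
  apply: measurableI; first exact: measurable_set_lt.
  apply: measurableI; first by apply: measurable_set_eq => //; exact: measurable_funD.
  by apply: measurable_set_le => //; apply: measurable_funD => //; exact: measurable_funB.
have lowD (A B : set T) : B `<=` [set w | t < xi j w] -> low A `&` B = set0.
  move=> Bt; rewrite predeqE => w; split=> //; rewrite /low => -[[_ /=]].
  by rewrite in_itv/= leNgt => /negP + /Bt.
rewrite EA EB.
have mlow (A : set T) : measurable A -> measurable (low A).
  by move=> mA; apply: measurableI.
have -> : P (low A0 `|` A1) = (P (low A0) + P A1)%E.
  by apply: measureU => //; [exact: mlow|apply: lowD => w []].
have -> : P (low B0 `|` B1) = (P (low B0) + P B1)%E.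
  by apply: measureU => //; [exact: mlow|apply: lowD => w []].
have lowP A : @measurable _ (sub_space xi K) A ->
    P (low A) = (P A * P (xi j @^-1` `]-oo, t]))%E.
  by move=> mA; rewrite /low (indep_sigma indep Kj).
rewrite !lowP//.
rewrite IH//= -/B0.
suff -> : P A1 = (P B1 * (gamma_cdf q x)%:E)%E.
  by rewrite ge0_muleDl ?mule_ge0// muleAC.
(* For q = 0 both events are empty, since the new variable already counts as one exceedance. *)
case: q @A0 @A1 @B0 @B1 EA EB mA0' mB0' mA0 mB0 mB1 mA1 => [|q] A0 A1 B0 B1 EA EB mA0' mB0' mA0 mB0 mB1 mA1.
  have empty w : 1 + exceed_count xi I t w = 0%:R -> False.
    by move=> H; have := exceed_count_ge0 xi I t w; lra.
  have -> : P A1 = 0%E.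
    transitivity (P set0); last exact: measure0.
    by congr (P _); rewrite predeqE => w; split => // -[_ [/empty]].
  have -> : P B1 = 0%E.
    transitivity (P set0); last exact: measure0.
    by congr (P _); rewrite predeqE => w; split => // -[_ /empty].
  by rewrite mul0e.
have succ w : (1 + exceed_count xi I t w = q.+1%:R) = (exceed_count xi I t w = q%:R).
  by apply/propext; rewrite -natr1 addrC; split=> [/addIr|->].
have -> : P B1 = (P [set w | exceed_count xi I t w = q%:R] * (expR (- t))%:E)%E.
  transitivity (P ([set w | exceed_count xi I t w = q%:R] `&`
     xi j @^-1` `]t, +oo[)).
    by congr (P _); rewrite predeqE => w /=; rewrite /B1/= succ in_itv/= andbT; split=> -[].
  rewrite (indep_sigma indep Kj (mNq q))//; congr (_ * _)%E.
  rewrite -(tail j)//; congr (P _).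
  by apply/seteqP; split=> w /=; rewrite in_itv/= andbT.
pose M : set (sub_space xi K * R) :=
  [set p | t < p.2 /\ (exceed_count xi I t p.1 = q%:R /\
           p.2 - t + exceed_sum xi I t p.1 <= x)].
have mN1 : measurable_fun [set: sub_space xi K * R]
    (fun p => exceed_count xi I t p.1) by apply: (measurableT_comp mN).
have mS1 : measurable_fun [set: sub_space xi K * R]
    (fun p => exceed_sum xi I t p.1) by apply: (measurableT_comp mS).
have mM : measurable M.
  apply: measurableI; first by apply: measurable_set_lt; [exact: measurable_cst|].
  apply: measurableI; first by apply: measurable_set_eq => //; exact: measurable_cst.
  apply: measurable_set_le; last exact: measurable_cst.
  apply: measurable_funD => //; apply: measurable_funB => //.
have [msec secE] := indep_section indep Kj mM.
have -> : P A1 = P [set w | M (w, xi j w)].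
  by congr (P _); rewrite predeqE => w; rewrite /A1 /M /= succ.
rewrite secE.
pose c := fine (P [set w | exceed_count xi I t w = q%:R]).
have cE : P [set w | exceed_count xi I t w = q%:R] = c%:E.
  by rewrite fineK// fin_num_measure//; exact: subm.
(* With the new variable frozen at y > t, the others must have q exceedances and a total excess of
   at most x - (y - t), which is the induction hypothesis at a smaller bound. Beyond t + x that
   bound is negative and the section is empty. *)
have secM y : P (ysection M y : set T) =
    (if (t < y <= t + x)%R then c * gamma_cdf q (x - (y - t)) else 0)%:E.
  case: ifPn => [/andP[ty yx]|].
    rewrite EFinM -cE -IH; last by lra.
    congr (P _); rewrite predeqE => w; rewrite /ysection/= inE /M/=.
    rewrite lerBrDl addrC; split=> [[_ //]|//].
  move=> ntyx; rewrite (_ : ysection _ _ = set0) ?measure0//.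
  rewrite predeqE => w; split=> //; rewrite /ysection/= inE /M/= => -[ty [_ yx]].
  move: ntyx; rewrite ty/= -ltNge => yx'.
  by have := exceed_sum_ge0 xi I t w; lra.
rewrite (@exponential_law _ _ _ P (xi j)); first last.
- move=> y; rewrite measure_ge0 probability_le1//.
  by apply: subm; exact: measurable_ysection.
- exact: msec.
- exact: tail.
under eq_integral do rewrite secM.
by rewrite gamma_conv_integral// cE -!EFinM mulrA.
Qed.

(** * Order statistics *)

Lemma natr_count {R : realType} {I : Type} (p : pred I) (s : seq I) :
  \sum_(i <- s) (p i)%:R = (count p s)%:R :> R.
Proof. by elim: s => [|i s IH]; rewrite ?big_nil// big_cons IH /= natrD. Qed.

(** A downward closed predicate holds exactly on an initial segment of a sorted list, and the length
    of that segment is the count. *)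
Lemma sorted_nth_count {R : realType} (p : pred R) (s : seq R) (m : nat) :
  (forall x y, x <= y -> p y -> p x) ->
  sorted <=%O s -> (m < size s)%N -> p (nth 0 s m) = (m < count p s)%N.
Proof.
move=> pdown; elim: s m => [//|x s IH] m /= xs ms.
have /allP xmin := order_path_min le_trans xs.
have ss := path_sorted xs.
have [px|npx] := boolP (p x).
  by case: m ms => [|m] ms /=; rewrite ?px// IH// add1n ltnS.
have nall y : y \in s -> ~~ p y.
  by move=> /xmin xy; apply: contra npx; exact: pdown.
rewrite (_ : count p s = 0%N); last first.
  apply/eqP; rewrite -leqn0 leqNgt -has_count; apply/hasPn => y /nall.
  by [].
case: m ms => [|m] ms /=; first by rewrite (negbTE npx).
by apply/negbTE/nall/mem_nth.
Qed.

Lemma order_stat_pred {T : Type} {R : realType} (X : nat -> T -> R)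
    (n r : nat) (w : T) (p : pred R) : (r < n)%N ->
  (forall x y, x <= y -> p y -> p x) ->
  p (order_stat X n (n - r) w) =
    (n - r <= count (fun i => p (X i w)) (iota 0 n))%N.
Proof.
move=> rn pdown; rewrite /order_stat.
have sz : size (sort <=%O [seq X i w | i <- iota 0 n]) = n.
  by rewrite size_sort size_map size_iota.
rewrite (sorted_nth_count pdown) ?sz; first last.
- by lia.
- by apply: sort_sorted; exact: le_total.
rewrite (permP (permEl (perm_sort _ _))) count_map /=.
rewrite [X in _ = X](_ : _ = ((n - r).-1 < count (fun i => p (X i w)) (iota 0 n))%N) //.
by lia.
Qed.

(** Complement of [order_stat_pred]: having at least n - r values outside q is the negation of
    having more than r inside. *)
Lemma order_stat_upper {T : Type} {R : realType} (X : nat -> T -> R)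
    (n r : nat) (w : T) (q : pred R) : (r < n)%N ->
  (forall x y, x <= y -> q x -> q y) ->
  q (order_stat X n (n - r) w) =
    (r < count (fun i => q (X i w)) (iota 0 n))%N.
Proof.
move=> rn qup; apply: negb_inj.
rewrite [LHS](@order_stat_pred _ _ X n r w (predC q))//; last first.
  by move=> x y xy; apply: contra; exact: qup.
have := count_predC (fun i => q (X i w)) (iota 0 n); rewrite size_iota.
rewrite (_ : count (predC (fun i => q (X i w))) (iota 0 n) =
  count (fun i => predC q (X i w)) (iota 0 n))//.
lia.
Qed.

Lemma order_stat_mem {T : Type} {R : realType} (X : nat -> T -> R)
    (n r : nat) (w : T) : (r < n)%N ->
  exists2 k, (k < n)%N & order_stat X n (n - r) w = X k w.
Proof.
move=> rn; rewrite /order_stat; set s := sort _ _.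
have sz : size s = n by rewrite size_sort size_map size_iota.
have : nth 0 s (n - r).-1 \in s by apply: mem_nth; rewrite sz; lia.
rewrite mem_sort => /mapP[k]; rewrite mem_iota => /andP[_ kn] ->.
by exists k.
Qed.

(** By monotonicity the values below X_{n,n-r} contribute zero to the positive parts. The right-hand
    side is symmetric in the sample, which both the gamma law and the laws of large numbers
    require. *)
Lemma sum_top {T : Type} {R : realType} (X : nat -> T -> R)
    (n r : nat) (w : T) (h : R -> R) : (r < n)%N ->
  (forall x y, x <= y -> h x <= h y) ->
  \sum_(1 <= j < r.+1) (h (order_stat X n (n - j + 1) w) -
                        h (order_stat X n (n - r) w)) =
  \sum_(i <- iota 0 n) Num.max (h (X i w) - h (order_stat X n (n - r) w)) 0.
Proof.
move=> rn hmon; set v := order_stat X n (n - r) w.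
pose g y := Num.max (h y - h v) 0.
set s := sort <=%O [seq X i w | i <- iota 0 n].
have sz : size s = n by rewrite size_sort size_map size_iota.
have ss : sorted <=%O s by apply: sort_sorted; exact: le_total.
transitivity (\sum_(y <- s) g y); last first.
  by rewrite (perm_big _ (permEl (perm_sort _ _))) big_map.
rewrite [RHS](big_nth 0) sz [RHS](@big_cat_nat _ _ _ (n - r)%N)//=; last by lia.
rewrite [X in _ = X + _]big_nat [X in _ = X + _]big1 ?add0r; last first.
  move=> k /andP[_ kr]; rewrite /g; apply/max_idPr; rewrite subr_le0.
  apply: hmon; rewrite /v /order_stat -/s.
  by apply: (sorted_leq_nth le_trans le_refl 0 ss); rewrite ?inE ?sz; lia.
(* The surviving positions are the last r of the sorted list; they are shifted to start at 0 and
   then reversed, as j counts from the top. *)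
have -> : \sum_(n - r <= i < n) g s`_i = \sum_(0 <= i < r) g s`_(i + (n - r)).
  by rewrite -{1}(add0n (n - r)%N) big_addn subKn// ltnW.
rewrite big_add1 /= big_nat_rev/= big_nat [RHS]big_nat; apply: eq_bigr => k /andP[_ kr].
rewrite /g [in RHS](_ : nth 0 s _ = order_stat X n (n - (0 + r - k.+1).+1 + 1) w).
  apply/esym/max_idPl; rewrite subr_ge0; apply: hmon.
  rewrite /v /order_stat -/s.
  by apply: (sorted_leq_nth le_trans le_refl 0 ss); rewrite ?inE ?sz; lia.
by rewrite /order_stat -/s; congr (nth 0 s _); lia.
Qed.

(** The order statistic is below c when at least n - r observations are, and that count is a sum of
    indicators. *)
Lemma measurable_order_stat {d : measure_display} {T : measurableType d}
    {R : realType} (X : nat -> T -> R) (n r : nat) : (r < n)%N ->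
  (forall i, measurable_fun [set: T] (X i)) ->
  measurable_fun [set: T] (order_stat X n (n - r)).
Proof.
move=> rn mX.
apply: (measurability (@RGenInftyO.G R)); first exact: RGenInftyO.measurableE.
move=> _ [_ [c ->] <-]; rewrite setTI.
rewrite (_ : _ @^-1` _ = [set w | (n - r)%:R <=
   \sum_(i <- iota 0 n) ((X i w < c)%R)%:R :> R]).
  apply: measurable_set_le; first exact: measurable_cst.
  apply: measurable_sum_in => i _.
  rewrite (_ : (fun x => _) = \1_[set w | X i w < c]).
    by apply: measurable_indic; apply: measurable_set_lt => //; exact: measurable_cst.
  by apply/funext => w; rewrite indicE; congr ((nat_of_bool _)%:R); apply/idP/idP; rewrite inE.
rewrite predeqE => w /=; rewrite in_itv/=.
rewrite (@order_stat_pred _ _ X n r w (fun y => y < c))//; last first.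
  by move=> x y xy; exact: le_lt_trans.
by rewrite natr_count ler_nat.
Qed.

Lemma measurable_order_statT {d : measure_display} {T : measurableType d}
    {R : realType} (X : nat -> T -> R) (n k : nat) :
  (forall i, measurable_fun [set: T] (X i)) ->
  measurable_fun [set: T] (order_stat X n k).
Proof.
move=> mX; have [kn|nk] := ltnP k.-1 n.
  have := @measurable_order_stat _ _ _ X n (n - k.-1.+1) _ mX.
  rewrite (_ : order_stat X n (n - _) = order_stat X n k); first by apply; lia.
  by apply/funext => w; rewrite /order_stat; congr nth; lia.
rewrite (_ : order_stat X n k = cst 0); first exact: measurable_cst.
by apply/funext => w; rewrite /order_stat nth_default// size_sort size_map size_iota.
Qed.

(** * Gamma law of the excesses over an order statistic *)

Lemma gamma_cdf_ge0 {R : realType} (q : nat) (x : R) : 0 <= x -> 0 <= gamma_cdf q x.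
Proof.
case: q => [|q] x0; first by rewrite /gamma_cdf big_ord0 mulr0 subr0.
rewrite -(gamma_cdf0 q).
have D (y : R) := is_derive_gamma_cdf q y.
have dv y : derivable (gamma_cdf q.+1 : R -> R) y 1 by have [] := D y.
apply: (@ger0_derive1_ndecry R (gamma_cdf q.+1) 0) => //.
- move=> y; rewrite in_itv/= andbT => y0; rewrite derive1E; have [_ ->] := D y.
  by rewrite mulr_ge0 ?expR_ge0// divr_ge0 ?exprn_ge0 ?ler0n// ltW.
- by apply: continuous_subspaceT => y; exact/differentiable_continuous/derivable1_diffP.
Qed.

Lemma probability_setI_full {d : measure_display} {T : measurableType d}
    {R : realType} (P : probability T R) (A G : set T) :
  measurable A -> measurable G -> P (~` G) = 0%E -> P (G `&` A) = P A.
Proof.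
move=> mA mG G0.
have mGA : measurable (G `&` A) by exact: measurableI.
have mGcA : measurable (~` G `&` A) by apply: measurableI => //; exact: measurableC.
have : P ((G `&` A) `|` (~` G `&` A)) = (P (G `&` A) + P (~` G `&` A))%E.
  apply: measureU => //.
  by rewrite predeqE => w; split => // -[[? ?] [? ?]].
have -> : (G `&` A) `|` (~` G `&` A) = A by rewrite -setIUl setUv setTI.
move=> ->; rewrite (_ : P (~` G `&` A) = 0%E) ?adde0//.
apply/eqP; rewrite eq_le measure_ge0 andbT -G0.
have mGc := measurableC mG.
by apply: le_measure; rewrite ?inE//; exact: subIsetl.
Qed.

(** Freezing xi_j at y leaves the event xi_i = y, and the exponential law has no atoms. *)
Lemma exponential_no_tie {d : measure_display} {T : measurableType d}
    {R : realType} (P : probability T R) (xi : nat -> {RV P >-> R}) (i j : nat) :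
  independent_RVs xi ->
  (forall i s, 0 <= s -> P [set w | s < xi i w] = (expR (- s))%:E) ->
  i != j -> P [set w | xi i w = xi j w] = 0%E.
Proof.
move=> indep tail ij.
have atom k y : P [set w | xi k w = y] = 0%E.
  transitivity (\int[distribution P (xi k)]_z (\1_[set y] z)%:E)%E.
    by rewrite integral_indic//= setIT.
  rewrite (exponential_law (tail k)); first last.
  - by move=> z; rewrite indicE; case: (_ \in _); rewrite !lee_fin ?lexx ?ler01.
  - exact/measurable_EFinP/measurable_indic.
  transitivity (\int[leb]_(z in [set y])
      (if 0 <= z then expR (- z) else 0)%:E)%E; last by rewrite integral_set1.
  rewrite integral_mkcond [RHS]integral_mkcond; apply: eq_integral => z _.
  rewrite !patchE indicE mem_setE in_itv/= andbT.
  by case: ifPn => z0; case: (z \in _) => //; rewrite ?mul1e ?mul0e.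
pose K := [set i].
have Kj : ~ K j by move=> /= ji; move: ij; rewrite ji eqxx.
have mxi : measurable_fun [set: sub_space xi K] (xi i : sub_space xi K -> R).
  exact: measurable_sub_space_RV.
pose M : set (sub_space xi K * R) := [set p | xi i p.1 = p.2].
have mM : measurable M.
  by apply: measurable_set_eq => //; apply: (measurableT_comp mxi).
have [_ E] := indep_section indep Kj mM.
rewrite [LHS]E; apply: integral0_eq => y _.
rewrite (_ : ysection M y = [set w | xi i w = y]) ?atom//.
by rewrite predeqE => w; rewrite /ysection/= inE.
Qed.

(** The level is now the variable xi_k itself. With xi_k frozen at y >= 0, [gamma_cond] applies at
    level y, and its gamma factor does not depend on y, so it leaves the integral. *)
Lemma gamma_select {d : measure_display} {T : measurableType d}
    {R : realType} (P : probability T R) (xi : nat -> {RV P >-> R})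
    (I : seq nat) (k : nat) (q : nat) (x : R) :
  independent_RVs xi ->
  (forall i s, 0 <= s -> P [set w | s < xi i w] = (expR (- s))%:E) ->
  uniq I -> k \notin I -> 0 <= x ->
  P [set w | exceed_count xi I (xi k w) w = q%:R /\
             exceed_sum xi I (xi k w) w <= x] =
  (P [set w | exceed_count xi I (xi k w) w = q%:R] * (gamma_cdf q x)%:E)%E.
Proof.
move=> indep tail uI kI x0.
pose K : set nat := [set` I].
have Kk : ~ K k by apply/negP.
have mK i : i \in I -> measurable_fun [set: sub_space xi K * R]
    (fun p : sub_space xi K * R => xi i p.1).
  move=> iI; have m : measurable_fun [set: sub_space xi K] (xi i : sub_space xi K -> R).
    exact: measurable_sub_space_RV.
  exact: (measurableT_comp m).
pose M0 : set (sub_space xi K * R) :=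
  [set p | exceed_count xi I p.2 p.1 = q%:R].
pose M1 : set (sub_space xi K * R) :=
  [set p | exceed_count xi I p.2 p.1 = q%:R /\ exceed_sum xi I p.2 p.1 <= x].
have mC : measurable_fun [set: sub_space xi K * R] (fun p => exceed_count xi I p.2 p.1).
  exact: (@measurable_exceed_count _ _ _ (fun i (p : sub_space xi K * R) => xi i p.1)).
have mS : measurable_fun [set: sub_space xi K * R] (fun p => exceed_sum xi I p.2 p.1).
  exact: (@measurable_exceed_sum _ _ _ (fun i (p : sub_space xi K * R) => xi i p.1)).
have mM0 : measurable M0.
  by apply: measurable_set_eq => //; exact: measurable_cst.
have mM1 : measurable M1.
  by apply: measurableI => //; apply: measurable_set_le => //; exact: measurable_cst.
have [ms0 E0] := indep_section indep Kk mM0.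
have [ms1 E1] := indep_section indep Kk mM1.
have -> : P [set w | exceed_count xi I (xi k w) w = q%:R] = P [set w | M0 (w, xi k w)] by [].
rewrite E0 [LHS]E1.
have bound (M : set (sub_space xi K * R)) y : measurable M -> (0 <= P (ysection M y : set T) <= 1)%E.
  move=> mM; rewrite measure_ge0 probability_le1//.
  exact: (@sub_space_measurable _ _ _ _ xi K _ (measurable_ysection y mM)).
rewrite !(exponential_law (tail k))//; try by move=> y; exact: bound.
rewrite -ge0_integralZr//; first last.
- by rewrite lee_fin gamma_cdf_ge0.
- move=> y _; rewrite mule_ge0 ?lee_fin ?expR_ge0//.
- apply: emeasurable_funM; first exact: measurable_funTS.
  apply/measurable_EFinP/measurable_funTS; apply: measurableT_comp => //.
apply: eq_integral => y; rewrite inE/= in_itv/= andbT => y0.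
rewrite muleAC; congr (_ * _)%E.
rewrite (_ : ysection M0 y = [set w | exceed_count xi I y w = q%:R]); last first.
  by rewrite predeqE => w; rewrite /ysection/= inE.
rewrite -(gamma_cond indep tail)//; congr (P _).
by rewrite predeqE => w; rewrite /ysection/= inE.
Qed.

Lemma exceed_count_nat {T : Type} {R : realType} (xi : nat -> T -> R)
    (I : seq nat) (t : R) (w : T) :
  exceed_count xi I t w = (count (fun i => t < xi i w) I)%:R.
Proof. exact: natr_count. Qed.

Lemma count_other {T : Type} {R : realType} (xi : nat -> T -> R)
    (n k : nat) (t : R) (w : T) : ~~ (t < xi k w) -> (k < n)%N ->
  count (fun i => t < xi i w) (rem k (iota 0 n)) =
  count (fun i => t < xi i w) (iota 0 n).
Proof.
move=> nk kn; have kI : k \in iota 0 n by rewrite mem_iota.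
by rewrite (permP (perm_to_rem kI)) /= (negbTE nk).
Qed.

Definition no_tie {T : Type} {R : realType} (xi : nat -> T -> R) (n : nat) (w : T) :=
  forall i j : nat, (i < n)%N -> (j < n)%N -> xi i w = xi j w -> i = j.

(** Of two distinct values the smaller one is exceeded strictly more often: by everything that
    exceeds the larger, and by the larger itself. *)
Lemma rank_unique {T : Type} {R : realType} (xi : nat -> T -> R)
    (n r k l : nat) (w : T) : no_tie xi n w -> (k < n)%N -> (l < n)%N ->
  exceed_count xi (rem k (iota 0 n)) (xi k w) w = r%:R ->
  exceed_count xi (rem l (iota 0 n)) (xi l w) w = r%:R -> k = l.
Proof.
move=> nt kn ln; rewrite !exceed_count_nat !count_other ?ltxx//.
move=> /eqP; rewrite eqr_nat => /eqP Ek /eqP; rewrite eqr_nat => /eqP El.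
have key a b : (a < n)%N -> (b < n)%N -> xi a w < xi b w ->
    (count (fun i => (xi b w < xi i w)%R) (iota 0 n) <
     count (fun i => (xi a w < xi i w)%R) (iota 0 n))%N.
  move=> an bn ab.
  have bI : b \in iota 0 n by rewrite mem_iota.
  rewrite !(permP (perm_to_rem bI)) /= ltxx ab add0n add1n ltnS.
  by apply: sub_count => i; exact: lt_trans.
apply: nt => //; apply/eqP; rewrite eq_le; apply/andP; split; rewrite leNgt; apply/negP.
  by move=> /(key _ _ ln kn); rewrite Ek El ltnn.
by move=> /(key _ _ kn ln); rewrite Ek El ltnn.
Qed.

(** At most r values lie strictly above X_{n,n-r} and more than r lie weakly above it; without ties
    these counts differ by one, so the first equals r. Ties are excluded after applying phi, because
    phi may be flat. *)
Lemma rank_order_stat {T : Type} {R : realType} (X : nat -> T -> R)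
    (phi : R -> R) (n r k : nat) (w : T) :
  (forall x y, x <= y -> phi x <= phi y) -> (r < n)%N -> (k < n)%N ->
  no_tie (fun i w => phi (X i w)) n w ->
  order_stat X n (n - r) w = X k w ->
  exceed_count (fun i w => phi (X i w)) (rem k (iota 0 n)) (phi (X k w)) w = r%:R.
Proof.
move=> mon rn kn nt tauE; rewrite exceed_count_nat.
rewrite (@count_other _ _ (fun i w => phi (X i w)))/= ?ltxx//.
have -> : count (fun i => phi (X k w) < phi (X i w)) (iota 0 n) =
          count (fun i => X k w < X i w) (iota 0 n).
  apply: eq_in_count => i; rewrite mem_iota add0n => /andP[_ iN].
  apply/idP/idP; first by apply: contraTT; rewrite -!leNgt; exact: mon.
  move=> ki; rewrite lt_neqAle mon ?ltW// andbT; apply/eqP => /(nt _ _ kn iN) kiE.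
  by move: ki; rewrite kiE ltxx.
have up1 := @order_stat_upper _ _ X n r w (fun y => X k w < y) rn
  (fun x y xy kx => lt_le_trans kx xy).
have up2 := @order_stat_upper _ _ X n r w (fun y => X k w <= y) rn
  (fun x y xy kx => le_trans kx xy).
rewrite tauE ltxx in up1; rewrite tauE lexx in up2.
have kI : k \in iota 0 n by rewrite mem_iota.
have : (count (fun i => (X k w <= X i w)%R) (iota 0 n) =
        (count (fun i => (X k w < X i w)%R) (iota 0 n)).+1)%N.
  rewrite !(permP (perm_to_rem kI)) /= ltxx lexx add0n add1n; congr _.+1.
  apply: eq_in_count => i; rewrite (mem_rem_uniq _ (iota_uniq _ _)) inE.
  rewrite mem_iota add0n => /andP[ik /= iN].
  rewrite le_eqVlt; case: eqP => //= E.
  by move: ik; rewrite (nt _ _ iN kn) ?eqxx//= E.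
by move=> E; congr (_%:R); lia.
Qed.

Lemma exceed_sum_rem {T : Type} {R : realType} (xi : nat -> T -> R)
    (n k : nat) (w : T) : (k < n)%N ->
  exceed_sum xi (iota 0 n) (xi k w) w = exceed_sum xi (rem k (iota 0 n)) (xi k w) w.
Proof.
move=> kn; have kI : k \in iota 0 n by rewrite mem_iota.
rewrite /exceed_sum (perm_big _ (perm_to_rem kI)) big_cons subrr.
by rewrite (max_idPl _)// [LHS]add0r.
Qed.

(* Ties having probability zero, exactly one index carries the
   [(r+1)]-st largest value, and given which one it is the excesses of the
   remaining variables over it are independent of that event. *)
Lemma gamma_excess {d : measure_display} {T : measurableType d}
    {R : realType} (P : probability T R) (X xi : nat -> {RV P >-> R})
    (phi : R -> R) (n r : nat) (x : R) :
  independent_RVs xi ->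
  (forall i s, 0 <= s -> P [set w | s < xi i w] = (expR (- s))%:E) ->
  (forall x y, x <= y -> phi x <= phi y) ->
  (forall i w, xi i w = phi (X i w)) ->
  (r < n)%N -> 0 <= x ->
  P [set w | exceed_sum xi (iota 0 n) (phi (order_stat X n (n - r) w)) w <= x] =
  (gamma_cdf r x)%:E.
Proof.
move=> indep tail mon xiE rn x0.
pose G := [set w | no_tie xi n w].
have mtie i j : measurable [set w | xi i w = xi j w] by exact: measurable_set_eq.
pose tie i j := if [&& (i < n)%N, (j < n)%N & i != j]
  then [set w | xi i w = xi j w] else set0.
have EG : ~` G = \bigcup_i \bigcup_j tie i j.
  rewrite predeqE => w; split=> [|[i _ [j _]]]; last first.
    by rewrite /tie; case: ifP => // /and3P[iN jN /eqP ij] /= xij /(_ i j iN jN xij).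
  move=> nG; apply: contrapT => H; apply: nG => i j iN jN xij.
  apply: contrapT => ij; apply: H; exists i => //; exists j => //.
  by rewrite /tie iN jN; case: eqP.
have mGc : measurable (~` G).
  rewrite EG; apply: bigcup_measurable => i _; apply: bigcup_measurable => j _.
  by rewrite /tie; case: ifP.
have mG : measurable G by rewrite -(setCK G); exact: measurableC.
have G0 : P (~` G) = 0%E.
  have neg : P.-negligible (~` G).
    rewrite EG; apply: negligible_bigcup => i; apply: negligible_bigcup => j.
    rewrite /tie; case: ifP => [/and3P[_ _ ij]|_]; last exact: negligible_set0.
    by exists [set w | xi i w = xi j w]; split => //; exact: exponential_no_tie.
  have [B [mB B0 GB]] := neg.
  by apply/eqP; rewrite eq_le measure_ge0 andbT -B0 le_measure ?inE.
have mphi : measurable_fun [set: R] phi by apply: nondecreasing_measurable.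
have mtau : measurable_fun [set: T] (fun w => phi (order_stat X n (n - r) w)).
  by apply: (measurableT_comp mphi); exact: measurable_order_stat.
pose D k := [set w | exceed_count xi (rem k (iota 0 n)) (xi k w) w = r%:R].
pose Sx k := [set w | exceed_sum xi (rem k (iota 0 n)) (xi k w) w <= x].
pose TT := [set w | exceed_sum xi (iota 0 n) (phi (order_stat X n (n - r) w)) w <= x].
have mD k : measurable (D k).
  apply: measurable_set_eq; last exact: measurable_cst.
  exact: (@measurable_exceed_count _ _ _ (fun i w => xi i w)).
have mSx k : measurable (Sx k).
  apply: measurable_set_le; last exact: measurable_cst.
  exact: (@measurable_exceed_sum _ _ _ (fun i w => xi i w)).
have mTT : measurable TT.
  apply: measurable_set_le; last exact: measurable_cst.
  exact: (@measurable_exceed_sum _ _ _ (fun i w => xi i w)).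
have nt_phi w : G w -> no_tie (fun i w => phi (X i w)) n w.
  by move=> Gw i j iN jN; rewrite -!xiE; exact: Gw.
have rank w : G w -> exists k, [/\ (k < n)%N, D k w & order_stat X n (n - r) w = X k w].
  move=> Gw; have [k kn tauE] := @order_stat_mem _ _ X n r w rn.
  exists k; split => //; rewrite /D/=.
  have := rank_order_stat mon rn kn (nt_phi w Gw) tauE.
  have -> : (fun i w => phi (X i w)) = (fun i => xi i : T -> R).
    by apply/funext => i; apply/funext => v; rewrite xiE.
  by rewrite -xiE.
(* Off the ties, [rank] and [rank_unique] make the events [D k] a partition according to the index
   that carries the order statistic. *)
have triv (H : nat -> set T) : trivIset setT (fun k : 'I_n => G `&` (D k `&` H k)).
  apply/trivIsetP => i j _ _ ij; rewrite predeqE => w; split=> // -[[Gw [Di _]] [_ [Dj _]]].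
  move/eqP: ij; apply; apply: val_inj.
  exact: (rank_unique Gw (ltn_ord i) (ltn_ord j) Di Dj).
have sumP (H : nat -> set T) (A : set T) : (forall k, measurable (H k)) -> measurable A ->
    G `&` A = \bigcup_(k in `I_n) (G `&` (D k `&` H k)) ->
    P A = (\sum_(k < n) P (D k `&` H k))%E.
  move=> mH mA EA; rewrite -(probability_setI_full mA mG G0) EA bigcup_mkord.
  rewrite measure_bigsetU_ord//; last first.
    by move=> k; do 2 apply: measurableI => //.
  by apply: eq_bigr => k _; apply: probability_setI_full => //; exact: measurableI.
(* The probabilities of the [D k] sum to 1. As the gamma factor is the same for every k, it remains
   alone at the end. *)
have PT : P setT = (\sum_(k < n) P (D k))%E.
  rewrite (sumP (fun=> setT) setT)//; first by apply: eq_bigr => k _; rewrite setIT.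
  rewrite setIT predeqE => w; split=> [Gw|[k _ []//]].
  by have [k [kn Dk _]] := rank w Gw; exists k.
rewrite -/TT (sumP Sx TT)//; last first.
  rewrite predeqE => w; split.
    move=> [Gw]; rewrite /TT/=; have [k [kn Dk tauE]] := rank w Gw.
    rewrite tauE -xiE exceed_sum_rem// => Sk.
    by exists k.
  move=> [k /= kn [Gw [Dk Sk]]]; split=> //; rewrite /TT/=.
  have [k' [kn' Dk' tauE]] := rank w Gw.
  rewrite tauE (rank_unique Gw kn' kn Dk' Dk) -xiE exceed_sum_rem//.
transitivity (\sum_(k < n) (P (D k) * (gamma_cdf r x)%:E))%E.
  apply: eq_bigr => k _; apply: gamma_select => //.
    by rewrite rem_uniq ?iota_uniq.
  by rewrite (mem_rem_uniq _ (iota_uniq _ _)) inE eqxx.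
by rewrite -ge0_sume_distrl -?PT ?probability_setT ?mul1e.
Qed.

(** * Normal limit of the gamma laws *)

Lemma is_derive_continuous {R : realType} (f : R -> R) (x df : R) :
  is_derive x 1 f df -> {for x, continuous f}.
Proof. by move=> [D _]; exact/differentiable_continuous/derivable1_diffP. Qed.

(** A nondecreasing function that vanishes at 0 has the sign of its argument. The product form
    treats both signs of w at once. *)
Lemma derive_ge0_sign {R : realType} (f df : R -> R) (w : R) :
  (forall x : R, -1 < x -> is_derive x 1 f (df x)) ->
  (forall x : R, -1 < x -> 0 <= df x) -> f 0 = 0 -> -1 < w -> 0 <= f w * w.
Proof.
move=> dF df0 f0 w1.
have cF (a b : R) : -1 < a -> {within `[a, b], continuous f}.
  move=> a1; apply: continuous_in_subspaceT => x.
  rewrite inE/= in_itv/= => /andP[ax _].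
  exact: (is_derive_continuous (dF x (lt_le_trans a1 ax))).
have [w0|w0] := leP 0 w.
  have [||c + E] := @MVT_segment R f df 0 w w0.
  - by move=> x; rewrite in_itv/= => /andP[x0 _]; apply: dF; lra.
  - by apply: cF; lra.
  - rewrite in_itv/= => /andP[c0 _]; rewrite f0 !subr0 in E; rewrite E.
    by rewrite -mulrA mulr_ge0 ?df0// -?expr2 ?sqr_ge0//; lra.
have [||c + E] := @MVT_segment R f df w 0 (ltW w0).
- by move=> x; rewrite in_itv/= => /andP[x0 _]; apply: dF; lra.
- exact: cF.
- rewrite in_itv/= => /andP[c0 _]; rewrite f0 !sub0r in E.
  have -> : f w = df c * w by lra.
  by rewrite -mulrA mulr_ge0 ?df0// -?expr2 ?sqr_ge0//; lra.
Qed.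

(** The derivative of the bracket is x^2/(1 + x), nonnegative on ]-1, +oo[. *)
Lemma ln1D_lower {R : realType} (w : R) : -1 < w ->
  0 <= (ln (1 + w) - w + w ^+ 2 / 2) * w.
Proof.
move=> w1.
apply: (@derive_ge0_sign _ (fun x => ln (1 + x) - x + x ^+ 2 / 2)
  (fun x => (1 + x)^-1 - 1 + x)) => // [x x1|x x1|].
- have D1 : is_derive x 1 (fun y : R => ln (1 + y)) (1 + x)^-1.
    have x10 : 0 < 1 + x by lra.
    have Dx : is_derive x 1 (fun y : R => 1 + y) 1.
      by have := is_deriveD (is_derive_cst (1:R) x 1) (is_derive_id x 1); rewrite add0r.
    have := @is_derive1_comp R (@ln R) (fun y => 1 + y) x _ _ (is_derive1_ln x10) Dx.
    by rewrite mulr1.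
  have D2 : is_derive x 1 (fun y : R => y ^+ 2 / 2) x.
    rewrite (_ : (fun y => _) = cst (2^-1) * (id ^+ 2)); last first.
      by apply/funext => y; rewrite mulrfctE exprfctE /= mulrC.
    have := is_deriveM (is_derive_cst (2^-1 : R) x 1) (is_deriveX 2 (is_derive_id x 1)).
    by move/is_derive_eq; apply; rewrite !fctE /GRing.scale/=; field.
  have := is_deriveD (is_deriveB D1 (is_derive_id x 1)) D2.
  by [].
- rewrite (_ : _ + x = x ^+ 2 / (1 + x)).
    by rewrite divr_ge0 ?sqr_ge0//; lra.
  by field; lra.
- by rewrite addr0 ln1 expr0n/= mul0r addr0 subr0.
Qed.

(** The derivative of the bracket is (x/(1 + x))^2/2. With [ln1D_lower] this encloses ln (1 + w) - w
    between two quadratic expressions that agree to second order at 0. *)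
Lemma ln1D_upper {R : realType} (w : R) : -1 < w ->
  0 <= (w - w ^+ 2 / (2 * (1 + w)) - ln (1 + w)) * w.
Proof.
have E (x : R) : -1 < x -> x - x ^+ 2 / (2 * (1 + x)) = (x + 1 - (1 + x)^-1) / 2.
  by move=> x1; field; lra.
move=> w1; rewrite E//.
apply: (@derive_ge0_sign _ (fun x => (x + 1 - (1 + x)^-1) / 2 - ln (1 + x))
  (fun x => (1 + (1 + x)^-2) / 2 - (1 + x)^-1)) => // [x x1|x x1|].
- have x10 : 0 < 1 + x by lra.
  have Dx : is_derive x 1 (fun y : R => 1 + y) 1.
    by have := is_deriveD (is_derive_cst (1:R) x 1) (is_derive_id x 1); rewrite add0r.
  have D1 : is_derive x 1 (fun y : R => ln (1 + y)) (1 + x)^-1.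
    have := @is_derive1_comp R (@ln R) (fun y => 1 + y) x _ _ (is_derive1_ln x10) Dx.
    by rewrite mulr1.
  have x1n : 1 + x != 0 by rewrite gt_eqF.
  have DV := is_deriveV x1n Dx.
  have Dx' : is_derive x 1 (fun y : R => y + 1) 1.
    by have := is_deriveD (is_derive_id x 1) (is_derive_cst (1:R) x 1); rewrite addr0.
  have := is_deriveB (is_deriveM (is_deriveB Dx' DV) (is_derive_cst (2^-1:R) x 1)) D1.
  move/is_derive_eq; apply; rewrite !fctE /GRing.scale/=; field.
  by [].
- rewrite (_ : _ - _ = (x / (1 + x)) ^+ 2 / 2); last by field; lra.
  by rewrite divr_ge0 ?sqr_ge0.
- by rewrite addr0 ln1 add0r invr1 subrr mul0r subr0.
Qed.

(* The density of a standardised gamma variable, up to normalisation. *)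
Definition gamma_shape {R : realType} (k : nat) (v : R) : R :=
  if - Num.sqrt k.+1%:R < v then
    (1 + v / Num.sqrt k.+1%:R) ^+ k.+1 * expR (- (Num.sqrt k.+1%:R * v))
  else 0.

Lemma gamma_shapeE {R : realType} (k : nat) (v : R) :
  - Num.sqrt k.+1%:R < v ->
  gamma_shape k v =
    expR (k.+1%:R * (ln (1 + v / Num.sqrt k.+1%:R) - v / Num.sqrt k.+1%:R)).
Proof.
move=> kv; rewrite /gamma_shape kv.
have s0 : (0:R) < Num.sqrt k.+1%:R by rewrite sqrtr_gt0 ltr0n.
have w1 : 0 < 1 + v / Num.sqrt k.+1%:R.
  by rewrite -ltrBlDl sub0r ltr_pdivlMr// mulN1r.
rewrite expRM_natl expRD lnK; last by rewrite qualifE/= w1.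
rewrite exprMn -expRM_natl; congr (_ * expR _).
have ss : Num.sqrt k.+1%:R ^+ 2 = k.+1%:R :> R by rewrite sqr_sqrtr ?ler0n.
by set s := Num.sqrt _ in ss s0 *; rewrite -ss; field; lra.
Qed.

Lemma gamma_shape_ge0 {R : realType} (k : nat) (v : R) : 0 <= gamma_shape k v.
Proof.
have [kv|kv] := ltP (- Num.sqrt k.+1%:R) v.
  by rewrite gamma_shapeE// expR_ge0.
by rewrite /gamma_shape ltNge kv.
Qed.

(** A dominating function uniform in k. For v >= 0 the exponent is at most -v^2/(2(1 + w)) with w =
    v/sqrt(k+1) <= v, hence at most (1 - v)/2. For v < 0 it is at most -v^2/2, which is below (1 +
    v)/2. *)
Lemma gamma_shape_le {R : realType} (k : nat) (v : R) :
  gamma_shape k v <= expR ((1 - `|v|) / 2).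
Proof.
have [kv|kv] := ltP (- Num.sqrt k.+1%:R) v; last first.
  by rewrite /gamma_shape ltNge kv expR_ge0.
rewrite gamma_shapeE// ler_expR.
set M : R := k.+1%:R; set s := Num.sqrt M; pose w := v / s.
have s1 : 1 <= s by rewrite -sqrtr1 ler_sqrt// ler1n.
have s0 : 0 < s by lra.
have ss : s ^+ 2 = M by rewrite sqr_sqrtr ?ler0n.
have vE : v = s * w by rewrite /w; field; lra.
have w1 : -1 < w by rewrite ltr_pdivlMr// mulN1r.
have lo := ln1D_lower w1; have up := ln1D_upper w1.
rewrite -/w; have [v0|v0] := leP 0 v.
  rewrite (ger0_norm v0).
  have [w00|w0'] := eqVneq w 0.
    have v00 : v = 0 by rewrite vE w00 mulr0.
    by rewrite w00 addr0 ln1 subrr mulr0; lra.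
  have w0 : 0 < w by rewrite lt_neqAle eq_sym w0' /w divr_ge0// ltW.
  rewrite pmulr_lge0// in up.
  apply: (@le_trans _ _ (M * (- (w ^+ 2 / (2 * (1 + w)))))).
    by rewrite ler_pM2l ?ltr0n//; lra.
  have -> : M * - (w ^+ 2 / (2 * (1 + w))) = - (v ^+ 2 / (2 * (1 + w))).
    by rewrite -ss vE; field; lra.
  have wv : w <= v by rewrite vE ler_peMl// ltW.
  have : v ^+ 2 / (2 * (1 + v)) <= v ^+ 2 / (2 * (1 + w)).
    by apply: ler_wpM2l; [exact: sqr_ge0|rewrite lef_pV2 ?posrE; lra].
  have : (v - 1) / 2 <= v ^+ 2 / (2 * (1 + v)).
    by rewrite ler_pdivlMr; [nra|lra].
  by lra.
rewrite (ltr0_norm v0).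
have w0 : w < 0 by rewrite /w pmulr_llt0// invr_gt0.
rewrite nmulr_lge0// in lo.
apply: (@le_trans _ _ (M * (- (w ^+ 2 / 2)))).
  by rewrite ler_pM2l ?ltr0n//; lra.
have -> : M * - (w ^+ 2 / 2) = - (v ^+ 2 / 2) by rewrite -ss vE; field.
by nra.
Qed.

Lemma cvg_sqrt_nat {R : realType} : Num.sqrt (k.+1%:R : R) @[k --> \oo] --> +oo.
Proof.
apply/cvgryPge => A; near=> k.
have A1 : `|A| ^+ 2 <= k.+1%:R.
  near: k; exists (Num.bound (`|A| ^+ 2)) => // k /= Ak.
  rewrite (le_trans (ltW (archi_boundP (exprn_ge0 _ (normr_ge0 _)))))// ler_nat.
  exact: leqW.
rewrite (le_trans (ler_norm _))// -(sqrtr_sqr A) ler_sqrt ?ler0n//.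
by rewrite -real_normK ?num_real.
Unshelve. all: by end_near. Qed.

(** The two logarithmic bounds squeeze the exponent: scaled by k+1 they lie within v^2/2 times
    |w|/(1 + w) of each other, and w = v/sqrt(k+1) tends to 0. *)
Lemma gamma_shape_cvg {R : realType} (v : R) :
  gamma_shape k v @[k --> \oo] --> expR (- (v ^+ 2 / 2)).
Proof.
pose w k : R := v / Num.sqrt k.+1%:R.
have w0 : w k @[k --> \oo] --> (0:R).
  rewrite -[X in _ --> X](mulr0 v); apply: cvgM; first exact: cvg_cst.
  apply/gtr0_cvgV0; last exact: cvg_sqrt_nat.
  by near=> k; rewrite sqrtr_gt0 ltr0n.
pose e k : R := k.+1%:R * (ln (1 + w k) - w k).
suff E : e k @[k --> \oo] --> - (v ^+ 2 / 2).
  have := cvg_comp _ _ E (@continuous_expR R (- (v ^+ 2 / 2))).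
  apply: cvg_trans; apply: near_eq_cvg; near=> k.
  rewrite /= gamma_shapeE//.
  have : `|w k| < 1.
    by near: k; have /cvgrPdist_lt/(_ 1 ltr01) := w0; under eq_near do rewrite sub0r normrN.
  have s0 : (0:R) < Num.sqrt k.+1%:R by rewrite sqrtr_gt0 ltr0n.
  by rewrite ltr_norml => /andP[+ _]; rewrite /w ltr_pdivlMr// mulN1r.
have B : v ^+ 2 / 2 * (`|w k| / (1 + w k)) @[k --> \oo] --> (0:R).
  rewrite [X in _ --> X](_ : 0 = v ^+ 2 / 2 * (`|0 : R| / (1 + 0))); last first.
    by rewrite normr0 mul0r mulr0.
  apply: cvgM; first exact: cvg_cst.
  apply: cvgM; first exact: cvg_norm.
  apply: cvgV; first by rewrite addr0 oner_eq0.
  by apply: cvgD => //; exact: cvg_cst.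
apply/cvgrPdist_le => eps eps0.
have /cvgrPdist_le/(_ eps eps0) := B.
apply: filter_app; near=> k; rewrite sub0r normrN => Bk.
have w1 : `|w k| < 1.
  by near: k; have /cvgrPdist_lt/(_ 1 ltr01) := w0; under eq_near do rewrite sub0r normrN.
have {}w1 : -1 < w k by move: w1; rewrite ltr_norml => /andP[].
apply: le_trans Bk; rewrite [leRHS]ger0_norm; last first.
  by rewrite mulr_ge0 ?divr_ge0 ?sqr_ge0 ?normr_ge0//; lra.
have lo := ln1D_lower w1; have up := ln1D_upper w1.
set W := w k in lo up w1 *; set L := ln (1 + W) in lo up *.
have ss : Num.sqrt k.+1%:R ^+ 2 = k.+1%:R :> R by rewrite sqr_sqrtr ?ler0n.
have s0 : (0:R) < Num.sqrt k.+1%:R by rewrite sqrtr_gt0 ltr0n.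
have vE : v = Num.sqrt k.+1%:R * W by rewrite /W /w; field; lra.
rewrite /e -/W -/L.
have -> : v ^+ 2 / 2 = k.+1%:R * (W ^+ 2 / 2) by rewrite {1}vE exprMn ss; field.
rewrite -opprD normrN -mulrDr normrM (ger0_norm (ler0n _ _)) -mulrA.
apply: ler_wpM2l; first exact: ler0n.
have E : W ^+ 2 / 2 - W ^+ 2 / (2 * (1 + W)) = W ^+ 2 / 2 * (W / (1 + W)).
  by field; lra.
have -> : W ^+ 2 / 2 + (L - W) = L - W + W ^+ 2 / 2 by ring.
have [W0|W0|W0] := ltgtP W 0.
- rewrite (nmulr_lge0 _ W0) in lo; rewrite (nmulr_lge0 _ W0) in up.
  by rewrite (ler0_norm lo) (ltr0_norm W0) mulNr mulrN; lra.
- rewrite (pmulr_lge0 _ W0) in lo; rewrite (pmulr_lge0 _ W0) in up.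
  by rewrite (ger0_norm lo) (gtr0_norm W0); lra.
- by rewrite /L W0 addr0 ln1 subrr expr0n/= !mul0r addr0 normr0.
Unshelve. all: by end_near. Qed.

Lemma gamma_cdf_cvg1 {R : realType} (q : nat) :
  gamma_cdf q (x : R) @[x --> +oo] --> (1 : R).
Proof.
elim: q => [|k IH].
  rewrite (_ : gamma_cdf 0 = cst 1); first exact: cvg_cst.
  by apply/funext => x; rewrite /gamma_cdf big_ord0 mulr0 subr0.
rewrite (_ : (fun x : R => _) =
    (fun x => gamma_cdf k x - expR (- x) * (x ^+ k / k`!%:R))); last first.
  by apply/funext => x; rewrite /gamma_cdf big_ord_recr/= mulrDr opprD addrA.
rewrite -[X in _ --> X]subr0; apply: cvgB => //.
(* A single Poisson weight is at most 1. Applied to the index k+1, it bounds the weight of index k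
   by (k+1)/x. *)
have bound (j : nat) (x : R) : 0 <= x -> expR (- x) * (x ^+ j / j`!%:R) <= 1.
  move=> x0; have := gamma_cdf_ge0 j.+1 x0.
  rewrite /gamma_cdf subr_ge0; apply: le_trans; apply: ler_wpM2l; first exact: expR_ge0.
  rewrite big_ord_recr/= lerDr; apply: sumr_ge0 => i _.
  by rewrite divr_ge0 ?exprn_ge0 ?ler0n.
have inv0 : k.+1%:R / x @[x --> +oo] --> (0:R).
  rewrite -(mulr0 k.+1%:R); apply: cvgM; first exact: cvg_cst.
  by apply/gtr0_cvgV0; [exact: nbhs_pinfty_gt|exact: cvg_id].
apply: (squeeze_cvgr _ (cvg_cst 0) inv0).
near=> x.
have x0 : 0 < x by near: x; exact: nbhs_pinfty_gt.
apply/andP; split.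
  by rewrite mulr_ge0 ?expR_ge0 ?divr_ge0 ?exprn_ge0 ?ler0n// ltW.
rewrite ler_pdivlMr//.
have := bound k.+1 x (ltW x0); rewrite factS natrM exprS.
have k0 : (0 : R) < k.+1%:R by rewrite ltr0n.
rewrite (_ : expR (- x) * (x * x ^+ k / (k.+1%:R * k`!%:R)) =
  expR (- x) * (x ^+ k / k`!%:R) * x / k.+1%:R).
  by rewrite ler_pdivrMr// mul1r.
by rewrite invfM; ring.
Unshelve. all: by end_near. Qed.

Lemma integrable_expR_abs {R : realType} :
  (@lebesgue_measure R).-integrable [set: R]
    (fun v => (expR ((1 - `|v|) / 2))%:E).
Proof.
have ce : continuous (fun v : R => expR ((1 - v) / 2)).
  move=> v; apply: (@continuous_comp _ _ _ (fun v : R => (1 - v) / 2) expR); last exact: continuous_expR.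
  by apply: cvgM; [apply: cvgB; [exact: cvg_cst|exact: cvg_id]|exact: cvg_cst].
have cf : continuous (fun v : R => expR ((1 - `|v|) / 2)).
  move=> v; apply: (@continuous_comp _ _ _ (fun v : R => `|v|) (fun v => expR ((1 - v) / 2))); last exact: ce.
  exact: norm_continuous.
apply/integrableP; split.
  by apply/measurable_EFinP; exact: continuous_measurable_fun.
under eq_integral do rewrite /= ger0_norm ?expR_ge0//.
rewrite ge0_symfun_integralT//; last by move=> v /=; rewrite normrN.
rewrite (_ : [set x : R | _] = `[0, +oo[%classic); last first.
  by apply/seteqP; split => v/=; rewrite in_itv/= andbT.
rewrite (_ : (\int[_]_(x in _) _)%E =
   (\int[leb]_(v in `[0%R, +oo[) (expR ((1 - v) / 2))%:E)%E); last first.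
  apply: eq_integral => v; rewrite inE/= in_itv/= andbT => v0.
  by rewrite ger0_norm.
have dF (x : R) : is_derive x 1 (fun v : R => - 2 * expR ((1 - v) / 2)) (expR ((1 - x) / 2)).
  have D1 : is_derive x 1 (fun v : R => (1 - v) / 2) (- 2^-1).
    have := is_deriveM (is_deriveB (is_derive_cst (1:R) x 1) (is_derive_id x 1)) (is_derive_cst (2^-1:R) x 1).
    by move/is_derive_eq; apply; rewrite !fctE /GRing.scale/=; ring.
  have D2 := @is_derive1_comp R expR (fun v => (1 - v) / 2) x _ _ (is_derive_expR _) D1.
  have := is_deriveM (is_derive_cst (- 2:R) x 1) D2.
  by move/is_derive_eq; apply; rewrite !fctE /GRing.scale/=; field.
rewrite (@ge0_continuous_FTC2y _ _ (fun v : R => - 2 * expR ((1 - v) / 2)) _ 0)//.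
- by rewrite -EFinB -EFinM ltry.
- exact: continuous_subspaceT.
- rewrite -(mulr0 (-2)); apply: cvgM; first exact: cvg_cst.
  rewrite (_ : (fun x : R => _) = (fun x => expR (2^-1) * expR (- (x / 2)))); last first.
    by apply/funext => x; rewrite -expRD; congr expR; field.
  rewrite -(mulr0 (expR 2^-1)); apply: cvgM; first exact: cvg_cst.
  apply: (@cvg_comp _ _ _ (fun x : R => x / 2) (fun x => expR (- x)) _ (pinfty_nbhs R)); last exact: cvgr_expR.
  by apply: gt0_cvgMly; [rewrite invr_gt0|exact: cvg_id].
- by apply: cvg_at_right_filter; exact: (is_derive_continuous (dF 0)).
- by move=> x _; rewrite derive1E; have [_ ->] := dF x.
Qed.

Lemma measurable_gamma_shape {R : realType} (k : nat) :
  measurable_fun [set: R] (gamma_shape k).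
Proof.
rewrite /gamma_shape; apply: measurable_fun_ifT => //.
- by apply: measurable_fun_ltr => //; exact: measurable_cst.
- apply: measurable_funM.
    by apply: measurable_funX; apply: measurable_funD => //; exact: measurable_funM.
  by apply: measurableT_comp => //; apply: measurableT_comp => //; exact: measurable_funM.
Qed.

Lemma cvg_integral_gamma_shape {R : realType} (D : set R) : measurable D ->
  (\int[leb]_(v in D) (gamma_shape k v)%:E @[k --> \oo] -->
   \int[leb]_(v in D) (expR (- (v ^+ 2 / 2)))%:E)%E.
Proof.
move=> mD.
have [] := @dominated_convergence _ _ R (@lebesgue_measure R) D mD
  (fun k v => (gamma_shape k v)%:E) (fun v => (expR (- (v ^+ 2 / 2)))%:E)
  (fun v => (expR ((1 - `|v|) / 2))%:E).
- move=> k; apply/measurable_EFinP/measurable_funTS; exact: measurable_gamma_shape.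
- apply/measurable_EFinP/measurable_funTS.
  by apply: measurableT_comp => //; apply: measurableT_comp => //; exact: measurable_funM.
- apply: aeW => v _; apply/cvg_EFin; first exact: nearW.
  exact: gamma_shape_cvg.
- by apply: (integrableS _ _ (@subsetT _ _)) => //; exact: integrable_expR_abs.
- apply: aeW => v k _; rewrite /= lee_fin ger0_norm ?gamma_shape_ge0//.
  exact: gamma_shape_le.
by [].
Qed.

(** The constant that makes [gamma_shape k] a probability density. In [gamma_clt] it is read off as
    the inverse of the total mass and cancels in a quotient of two integrals. *)
Definition gamma_scale {R : realType} (k : nat) : R :=
  Num.sqrt k.+1%:R * expR (- k.+1%:R) * (k.+1%:R ^+ k.+1 / (k.+1)`!%:R).

(** The integrand is the derivative of [gamma_cdf k.+2] along the affine map that sends v to M +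
    sqrt(M) v, with M = k+1. *)
Lemma gamma_scale_integral {R : realType} (k : nat) (a : R) :
  - Num.sqrt k.+1%:R <= a ->
  (\int[leb]_(v in `[a, +oo[) (gamma_scale k * gamma_shape k v)%:E =
   (1 - gamma_cdf k.+2 (k.+1%:R + Num.sqrt k.+1%:R * a))%:E)%E.
Proof.
move=> ka; set M : R := k.+1%:R; set s := Num.sqrt M.
have M0 : 0 < M by rewrite ltr0n.
have s0 : 0 < s by rewrite sqrtr_gt0.
have ss : s ^+ 2 = M by rewrite sqr_sqrtr ?ler0n.
pose f (v : R) : R := gamma_scale k * ((1 + v / s) ^+ k.+1 * expR (- (s * v))).
have dF (x : R) : is_derive x 1 (fun v : R => gamma_cdf k.+2 (M + s * v)) (f x).
  have D1 : is_derive x 1 (fun v : R => M + s * v) s.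
    have := is_deriveD (is_derive_cst M x 1) (is_deriveM (is_derive_cst s x 1) (is_derive_id x 1)).
    by move/is_derive_eq; apply; rewrite !fctE /GRing.scale/=; ring.
  have := @is_derive1_comp R (gamma_cdf k.+2) (fun v => M + s * v) x _ _ (is_derive_gamma_cdf k.+1 _) D1.
  move/is_derive_eq; apply; rewrite /f /gamma_scale -/M -/s.
  rewrite (_ : M + s * x = M * (1 + x / s)); last by rewrite -ss; field; lra.
  rewrite (_ : expR (- (M * (1 + x / s))) = expR (- M) * expR (- (s * x))); last first.
    by rewrite -expRD; congr expR; rewrite -ss; field; lra.
  by rewrite exprMn; ring.
have fge0 x : a <= x -> 0 <= f x.
  move=> ax; have w1 : 0 <= 1 + x / s.
    have : - 1 <= x / s by rewrite ler_pdivlMr// mulN1r (le_trans ka).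
    by lra.
  by rewrite /f /gamma_scale !mulr_ge0 ?expR_ge0 ?invr_ge0 ?ler0n ?exprn_ge0 ?sqrtr_ge0.
transitivity (\int[leb]_(v in `[a, +oo[) (f v)%:E)%E.
  apply: eq_integral => v; rewrite inE/= in_itv/= andbT => av.
  congr (_%:E); rewrite /f /gamma_shape; case: ltP => // vs.
  have -> : v = - s by apply/eqP; rewrite eq_le vs (le_trans ka).
  by rewrite mulNr divff ?gt_eqF// subrr expr0n/= !mul0r.
rewrite (@ge0_continuous_FTC2y _ _ (fun v : R => gamma_cdf k.+2 (M + s * v)) _ 1)//.
- apply: continuous_subspaceT => v; apply: cvgM; first exact: cvg_cst.
  apply: cvgM.
    rewrite /=; apply: (@continuous_comp _ _ _ (fun v : R => 1 + v / s) (fun y => y ^+ k.+1)); last exact: exprn_continuous.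
    by apply: cvgD; [exact: cvg_cst|apply: cvgM; [exact: cvg_id|exact: cvg_cst]].
  apply: (@continuous_comp _ _ _ (fun v : R => - (s * v)) expR); last exact: continuous_expR.
  by apply: cvgN; apply: cvgM; [exact: cvg_cst|exact: cvg_id].
- apply: (@cvg_comp _ _ _ (fun v : R => M + s * v) (gamma_cdf k.+2) _ (pinfty_nbhs R)); last exact: gamma_cdf_cvg1.
  apply/cvgryPge => A; near=> x.
  have : (A - M) / s <= x by near: x; apply: nbhs_pinfty_ge; exact: num_real.
  by rewrite ler_pdivrMr// => ?; lra.
- by apply: cvg_at_right_filter; exact: (is_derive_continuous (dF a)).
- by move=> x _; rewrite derive1E; have [_ ->] := dF x.
Unshelve. all: by end_near. Qed.

Definition normal_cdf {R : realType} (m s x : R) : R :=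
  fine (normal_prob m s `]-oo, x]%classic).

Lemma normal_cdfE {R : realType} (m s x : R) :
  normal_prob m s `]-oo, x]%classic = (normal_cdf m s x)%:E.
Proof.
pose N : probability (measurableTypeR R) R := normal_prob m s.
by rewrite /normal_cdf fineK//; exact: (@fin_num_measure _ _ _ N).
Qed.

Lemma normal_pdf_shape {R : realType} (m s z : R) : 0 < s ->
  normal_pdf m s z = normal_peak s * expR (- ((z - m) ^+ 2 / (2 * s ^+ 2))).
Proof.
move=> s0; rewrite normal_pdfE ?gt_eqF//; congr (_ * expR _).
by rewrite mulNr mulr_natl.
Qed.

Lemma normal_cdf_compl {R : realType} (m s x : R) :
  ((normal_cdf m s x)%:E = 1 - \int[leb]_(v in `[x, +oo[) (normal_pdf m s v)%:E)%E.
Proof.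
pose N : probability (measurableTypeR R) R := normal_prob m s.
rewrite -normal_cdfE -integral_itv_obnd_cbnd; last first.
  by apply: measurable_funTS; apply/measurable_EFinP; exact: measurable_normal_pdf.
change (N `]-oo, x]%classic = 1 - N `]x, +oo[%classic)%E.
rewrite -(setCitvl (BRight x)) probability_setC//.
have fn : N `]-oo, x]%classic \is a fin_num by rewrite fin_num_measure.
by rewrite -(fineK fn) -!EFinB opprB addrC subrK.
Qed.

(** The second conjunct evaluates the total Gaussian mass, the limit of the denominators in
    [gamma_clt]. *)
Lemma normal_cdf01 {R : realType} (a : R) :
  ((normal_cdf 0 1 a)%:E = 1 -
   (normal_peak 1%R)%:E * \int[leb]_(v in `[a, +oo[) (expR (- (v ^+ 2 / 2)))%:E
  /\ (normal_peak (1%R:R))%:E * \int[leb]_(v in [set: R]) (expR (- (v ^+ 2 / 2)))%:E = 1)%E.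
Proof.
have scale D : measurable D -> (\int[leb]_(v in D) (normal_pdf 0 1 v)%:E =
    (normal_peak (1%R:R))%:E * \int[leb]_(v in D) (expR (- (v ^+ 2 / 2)))%:E)%E.
  move=> mD; rewrite -ge0_integralZl//.
  - apply: eq_integral => v _; rewrite (normal_pdf_shape _ _ ltr01) -EFinM.
    by rewrite subr0 expr1n mulr1.
  - apply/measurable_funTS/measurable_EFinP.
    by apply: measurableT_comp => //; apply: measurableT_comp => //; exact: measurable_funM.
  - by rewrite lee_fin normal_peak_ge0.
by rewrite normal_cdf_compl -!scale// integral_normal_pdf.
Qed.

(* [k.+2] exponentials centred at [k.+1]: the mode of their gamma density. *)
Lemma gamma_clt {R : realType} (a : R) :
  gamma_cdf k.+2 (k.+1%:R + Num.sqrt k.+1%:R * a) @[k --> \oo] -->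
  normal_cdf 0 1 a.
Proof.
have [E0 E1] := normal_cdf01 a.
pose Ga : \bar R := (\int[leb]_(v in `[a, +oo[) (expR (- (v ^+ 2 / 2)))%:E)%E.
pose GR : \bar R := (\int[leb]_(v in [set: R]) (expR (- (v ^+ 2 / 2)))%:E)%E.
pose A k : \bar R := (\int[leb]_(v in `[a, +oo[) (gamma_shape k v)%:E)%E.
pose B k : \bar R := (\int[leb]_(v in [set: R]) (gamma_shape k v)%:E)%E.
have p0 : 0 < normal_peak (1:R) by rewrite normal_peak_gt0// oner_eq0.
have GRE : GR = ((normal_peak 1)^-1)%:E.
  have -> : GR = ((normal_peak 1)^-1%:E * ((normal_peak 1)%:E * GR))%E.
    by rewrite muleA -EFinM mulVf ?gt_eqF// mul1e.
  by rewrite [X in (_ * X)%E]E1 mule1.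
have e0 D : (0 <= \int[leb]_(v in D) (expR (- (v ^+ 2 / 2)))%:E :> \bar R)%E.
  by apply: integral_ge0 => v _; rewrite lee_fin expR_ge0.
have GaF : Ga \is a fin_num.
  rewrite ge0_fin_numE ?e0//; apply: (@le_lt_trans _ _ GR); last by rewrite GRE ltry.
  apply: ge0_subset_integral => //.
  apply/measurable_EFinP.
  by apply: measurableT_comp => //; apply: measurableT_comp => //; exact: measurable_funM.
have cA : A k @[k --> \oo] --> Ga by exact: cvg_integral_gamma_shape.
have cB : B k @[k --> \oo] --> GR by exact: cvg_integral_gamma_shape.
have c0 k : 0 < gamma_scale k :> R.
  by rewrite /gamma_scale !mulr_gt0 ?expR_gt0 ?sqrtr_gt0 ?invr_gt0 ?exprn_gt0 ?ltr0n ?fact_gt0.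
have sc k D : measurable D -> (\int[leb]_(v in D) (gamma_scale k * gamma_shape k v)%:E =
     (gamma_scale k)%:E * \int[leb]_(v in D) (gamma_shape k v)%:E :> \bar R)%E.
  move=> mD; under eq_integral do rewrite EFinM.
  rewrite ge0_integralZl//.
  - by apply/measurable_EFinP/measurable_funTS; exact: measurable_gamma_shape.
  - by move=> v _; rewrite lee_fin gamma_shape_ge0.
  - by rewrite lee_fin ltW.
(* The left end of the support of [gamma_shape] corresponds to x = 0, where the gamma distribution
   function vanishes. *)
have BE k : B k = ((gamma_scale k)^-1)%:E.
  have H := @gamma_scale_integral R k (- Num.sqrt k.+1%:R) (lexx _).
  rewrite sc// mulrN -expr2 sqr_sqrtr ?ler0n// subrr gamma_cdf0 subr0 in H.
  have -> : B k = (\int[leb]_(v in `[(- Num.sqrt k.+1%:R)%R, +oo[) (gamma_shape k v)%:E)%E.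
    rewrite [RHS]integral_mkcond; apply: eq_integral => v _; rewrite patchE mem_setE in_itv/= andbT.
    case: ifPn => // kv; rewrite /gamma_shape; case: ltP => // /ltW kv'.
    by rewrite kv' in kv.
  set I := (X in X = _).
  have -> : I = ((gamma_scale k)^-1%:E * ((gamma_scale k)%:E * I))%E.
    by rewrite muleA -EFinM mulVf ?gt_eqF// mul1e.
  by rewrite [X in (_ * X)%E]H mule1.
(* The tail becomes a quotient of unnormalised integrals, each of which converges by domination. The
   side condition holds for large k. *)
have AE k : - Num.sqrt k.+1%:R <= a ->
   gamma_cdf k.+2 (k.+1%:R + Num.sqrt k.+1%:R * a) = 1 - fine (A k) / fine (B k).
  move=> ka; have H := gamma_scale_integral ka.
  rewrite sc// -/(A k) in H.
  have AF : A k = ((gamma_scale k)^-1 * (1 - gamma_cdf k.+2 (k.+1%:R + Num.sqrt k.+1%:R * a)))%:E.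
    by rewrite EFinM -H muleA -EFinM mulVf ?gt_eqF// mul1e.
  rewrite AF BE /= invrK mulrAC mulVf ?gt_eqF// mul1r; ring.
have -> : normal_cdf 0 1 a = 1 - fine Ga / fine GR.
  by apply: EFin_inj; rewrite E0 -/Ga GRE -(fineK GaF) -EFinM -EFinB/= invrK mulrC.
apply: (@cvg_trans _ ((1 - fine (A k) / fine (B k)) @[k --> \oo])).
  apply: near_eq_cvg; near=> k; rewrite AE//.
  rewrite lerNl; near: k; move: (@cvg_sqrt_nat R) => /cvgryPge; exact.
apply: cvgB; first exact: cvg_cst.
apply: cvgM; first by apply: fine_cvg; rewrite fineK.
apply: cvgV; first by rewrite GRE/= invr_eq0 gt_eqF.
by apply: fine_cvg; rewrite fineK // GRE.
Unshelve. all: by end_near. Qed.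

(** * Convergence in probability *)

(* Convergence of [fun p => Y p.1 p.2] along this filter on [nat * T] is
   convergence in probability of [Y n]. *)
Definition whp {d : measure_display} {T : measurableType d} {R : realType}
    (P : probability T R) : set_system (nat * T) :=
  [set Q | forall delta : R, 0 < delta -> \forall n \near \oo,
     exists N : set T, [/\ measurable N, (P N <= delta%:E)%E &
       forall w, ~ N w -> Q (n, w)]].

(** The filter laws give convergence in probability the usual algebra of limits, squeezing and
    [near] reasoning. An intersection spends delta/2 on each exceptional set; these sets are
    measurable while [Q] may fail to be. *)
Instance whp_filter {d : measure_display} {T : measurableType d} {R : realType}
    (P : probability T R) : Filter (whp P).
Proof.
split.
- move=> delta delta0; near=> n; exists set0; split => //.
  by rewrite measure0 lee_fin ltW.
- move=> Q1 Q2 H1 H2 delta delta0.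
  have d2 : 0 < delta / 2 by rewrite divr_gt0.
  have E1 := H1 _ d2; have E2 := H2 _ d2.
  near=> n.
  have [N1 [m1 p1 s1]] : exists N : set T, [/\ measurable N, (P N <= (delta / 2)%:E)%E &
       forall w, ~ N w -> Q1 (n, w)] by near: n.
  have [N2 [m2 p2 s2]] : exists N : set T, [/\ measurable N, (P N <= (delta / 2)%:E)%E &
       forall w, ~ N w -> Q2 (n, w)] by near: n.
  exists (N1 `|` N2); split; first exact: measurableU.
  + apply: (le_trans (measureU2 _ m1 m2)).
    by rewrite [delta]splitr EFinD leeD.
  + by move=> w /not_orP[w1 w2]; split; [exact: s1|exact: s2].
- move=> Q1 Q2 Q12 H1 delta delta0; have := H1 _ delta0.
  by apply: filterS => n [N [m p s]]; exists N; split => // w /s /Q12.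
Unshelve. all: by end_near. Qed.

Lemma whp_fst {d : measure_display} {T : measurableType d} {R : realType}
    (P : probability T R) : fst @ whp P --> \oo.
Proof.
move=> Q Qoo delta delta0; have := Qoo; apply: filterS => n Qn.
exists set0; split => //.
by rewrite measure0 lee_fin ltW.
Qed.

Lemma whp_seq {d : measure_display} {T : measurableType d} {R : realType}
    (P : probability T R) {U : topologicalType} (a : nat -> U) (l : set_system U) :
  a n @[n --> \oo] --> l -> a p.1 @[p --> whp P] --> l.
Proof. by move=> al; apply: cvg_comp al; exact: whp_fst. Qed.

Lemma whp_near {d : measure_display} {T : measurableType d} {R : realType}
    (P : probability T R) (Q : nat -> Prop) :
  (\forall n \near \oo, Q n) -> \forall p \near whp P, Q p.1.
Proof. exact: whp_fst. Qed.

Lemma whp_prob {d : measure_display} {T : measurableType d} {R : realType}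
    (P : probability T R) (N : nat -> set T) (Q : set (nat * T)) :
  (forall n, measurable (N n)) -> P (N n) @[n --> \oo] --> 0%E ->
  (forall n w, ~ N n w -> Q (n, w)) -> whp P Q.
Proof.
move=> mN N0 NQ delta delta0.
have N0' : fine (P (N n)) @[n --> \oo] --> (0 : R) by exact: fine_cvg.
near=> n; exists (N n); split => //; last exact: NQ.
rewrite -(fineK (fin_num_measure P _ (mN n))) lee_fin ltW//.
by near: n; exact: (cvgr_lt _ N0').
Unshelve. all: by end_near. Qed.

(** The pair has the product law, and Tonelli factors the nonnegative integrand. *)
Lemma indep_expectation_mul {d : measure_display} {T : measurableType d}
    {R : realType} (P : probability T R) (X : nat -> {RV P >-> R})
    (g : R -> R) (i j : nat) :
  independent_RVs X -> i != j -> measurable_fun [set: R] g ->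
  (forall x, 0 <= g x) ->
  (\int[P]_w (g (X i w) * g (X j w))%:E =
   \int[P]_w (g (X i w))%:E * \int[P]_w (g (X j w))%:E)%E.
Proof.
move=> indep ij mg g0.
pose K := [set i].
have Kj : ~ K j by move=> /= ji; move: ij; rewrite ji eqxx.
pose W0 w : R * R := (X i w, X j w).
have mW0 : measurable_fun setT W0 by apply/measurable_fun_pairP; split; exact: measurable_funP.
pose W : {mfun T >-> (R * R)%type} := HB.pack W0 (isMeasurableFun.Build _ _ _ _ W0 mW0).
pose m1 : probability R R := distribution P (X i).
pose m2 : probability R R := distribution P (X j).
have prodE M : measurable M -> (m1 \x m2)%E M = distribution P W M.
  apply: product_measure_unique => A B mA mB.
  rewrite /m1 /m2 /distribution /pushforward/=.
  rewrite -(@indep_sigma _ _ _ P X K j (X i @^-1` A) B indep Kj)//.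
  have m : measurable_fun [set: sub_space X K] (X i : sub_space X K -> R).
    exact: measurable_sub_space_RV.
  by have := m measurableT A mA; rewrite setTI.
pose f (p : R * R) : \bar R := (g p.1 * g p.2)%:E.
have mgE : measurable_fun [set: R] (fun x => (g x)%:E) by exact/measurable_EFinP.
have mf : measurable_fun [set: R * R] f.
  by apply/measurable_EFinP; apply: measurable_funM; apply: measurableT_comp mg _.
have f0 p : (0 <= f p)%E by rewrite lee_fin mulr_ge0.
transitivity (\int[distribution P W]_p f p)%E; first by rewrite ge0_integral_distribution.
transitivity (\int[m1 \x m2]_p f p)%E.
  by apply: eq_measure_integral => M mM _; exact: esym (prodE M mM).
rewrite fubini_tonelli1// /fubini_F.
have EX k : (\int[P]_w (g (X k w))%:E = \int[distribution P (X k)]_x (g x)%:E)%E.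
  by rewrite ge0_integral_distribution// => x; rewrite lee_fin.
have c0 : (0 <= \int[m2]_y (g y)%:E)%E by apply: integral_ge0 => y _; rewrite lee_fin.
transitivity (\int[m1]_x ((g x)%:E * \int[m2]_y (g y)%:E))%E.
  apply: eq_integral => x _; rewrite /f/=.
  under eq_integral do rewrite EFinM.
  by rewrite ge0_integralZl// => [y _|]; rewrite lee_fin.
rewrite ge0_integralZr//= ?EX//.
by move=> x _; rewrite lee_fin.
Qed.

(** Chebyshev for a triangular array. Since 0 <= g_n <= 1, the variance of the sum is at most its
    mean n q_n; after division by rho_n^2 it is (n q_n/rho_n)/rho_n, which tends to 0. *)
Lemma wlln {d : measure_display} {T : measurableType d}
    {R : realType} (P : probability T R) (X : nat -> {RV P >-> R})
    (g : nat -> R -> R) (q rho : nat -> R) (l : R) :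
  independent_RVs X -> (forall n, measurable_fun [set: R] (g n)) ->
  (forall n x, 0 <= g n x <= 1) ->
  (forall n i, \int[P]_w (g n (X i w))%:E = (q n)%:E)%E ->
  rho n @[n --> \oo] --> +oo -> n%:R * q n / rho n @[n --> \oo] --> l ->
  (rho p.1)^-1 * (\sum_(i <- iota 0 p.1) g p.1 (X i p.2)) @[p --> whp P] --> l.
Proof.
move=> indep mg g01 Eg rhooo ql.
have g0 n x : 0 <= g n x by have /andP[] := g01 n x.
have g1 n x : g n x <= 1 by have /andP[] := g01 n x.
pose S n w := \sum_(i <- iota 0 n) g n (X i w).
have mgX n i : measurable_fun [set: T] (fun w => g n (X i w)).
  by apply: (measurableT_comp (mg n)).
have mS n : measurable_fun [set: T] (S n) by apply: measurable_sum_in => i _.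
have S0 n w : 0 <= S n w by apply: sumr_ge0.
have q0 n : 0 <= q n.
  by rewrite -lee_fin -(Eg n 0%N); apply: integral_ge0 => w _; rewrite lee_fin.
have ES n : (\int[P]_w (S n w)%:E = (n%:R * q n)%:E)%E.
  under eq_integral do rewrite /S -sumEFin.
  rewrite ge0_integral_sum//; first last.
  - by move=> i w _; rewrite lee_fin.
  - by move=> i; exact/measurable_EFinP.
  under eq_bigr do rewrite Eg.
  by rewrite sumEFin big_const_seq count_predT size_iota iter_addr_0 mulr_natl.
have ES2 n : (\int[P]_w ((S n w) ^+ 2)%:E <= ((n%:R * q n) ^+ 2 + n%:R * q n)%:E)%E.
  have -> : (fun w => ((S n w) ^+ 2)%:E) =
      (fun w => \sum_(i <- iota 0 n) \sum_(j <- iota 0 n) (g n (X i w) * g n (X j w))%:E)%E.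
    apply/funext => w; under eq_bigr do rewrite sumEFin.
    rewrite sumEFin; congr EFin; rewrite expr2 {1}/S mulr_suml.
    by apply: eq_bigr => i _; rewrite mulr_sumr.
  have mgg i j : measurable_fun [set: T] (fun w => (g n (X i w) * g n (X j w))%:E).
    by apply/measurable_EFinP; exact: measurable_funM.
  have gg0 i j w : (0 <= (g n (X i w) * g n (X j w))%:E)%E by rewrite lee_fin mulr_ge0.
  rewrite ge0_integral_sum//; first last.
  - by move=> i w _; apply: sume_ge0.
  - by move=> i; apply: emeasurable_sum.
  (* The diagonal term is at most q_n because g_n^2 <= g_n. Each of the n - 1 other terms is q_n^2
     by independence, and their number is rounded up to n. *)
  have step i : i \in iota 0 n ->
      (\int[P]_w (\sum_(j <- iota 0 n) (g n (X i w) * g n (X j w))%:E)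
       <= (n%:R * q n ^+ 2 + q n)%:E)%E.
    move=> iN; rewrite ge0_integral_sum//.
    rewrite (perm_big _ (perm_to_rem iN))/= big_cons/=.
    rewrite addrC EFinD; apply: leeD.
      rewrite big_seq (eq_bigr (fun=> (q n ^+ 2)%:E)); last first.
        move=> j; rewrite (mem_rem_uniq _ (iota_uniq _ _)) inE => /andP[ji _].
        by rewrite (@indep_expectation_mul _ _ _ P X (g n) i j indep)// 1?eq_sym// !Eg -EFinM.
      rewrite -big_seq sumEFin lee_fin big_const_seq count_predT iter_addr_0 -[leLHS]mulr_natl.
      apply: ler_wpM2r; first exact: sqr_ge0.
      by rewrite ler_nat size_rem// size_iota leq_pred.
    rewrite -(Eg n i); apply: ge0_le_integral => //.
    - exact/measurable_EFinP.
    - by move=> w _; rewrite lee_fin -[leRHS]mulr1 ler_wpM2l.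
  rewrite big_seq; apply: (le_trans (lee_sum _ step)).
  rewrite -big_seq sumEFin lee_fin big_const_seq count_predT size_iota iter_addr_0 -[leLHS]mulr_natl.
  by rewrite le_eqVlt; apply/orP; left; apply/eqP; ring.
have var n : (\int[P]_w ((S n w - n%:R * q n) ^+ 2)%:E <= (n%:R * q n)%:E)%E.
  set m := n%:R * q n; have m0 : 0 <= m by rewrite mulr_ge0.
  (* The square is expanded with the cross term moved to the left, so that every integrand is
     nonnegative and the integrals add. *)
  have E : (\int[P]_w ((S n w - m) ^+ 2)%:E + (2 * m * m)%:E =
            \int[P]_w ((S n w) ^+ 2)%:E + (m ^+ 2)%:E)%E.
    rewrite (_ : (m ^+ 2)%:E = \int[P]_w (cst (m ^+ 2)%:E w))%E; last first.
      by rewrite integral_cst//= probability_setT mule1.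
    rewrite [X in (_ + X)%E](_ : _ = \int[P]_w (2 * m * S n w)%:E)%E; last first.
      under [RHS]eq_integral do rewrite EFinM.
      rewrite ge0_integralZl//; first by rewrite ES -EFinM.
      - exact/measurable_EFinP.
      - by move=> w _; rewrite lee_fin.
      - by rewrite lee_fin mulr_ge0.
    rewrite -!ge0_integralD//.
    + by apply: eq_integral => w _; rewrite /= -!EFinD; congr EFin; ring.
    + by move=> w _; rewrite lee_fin sqr_ge0.
    + by apply/measurable_EFinP; exact: measurable_funX.
    + by move=> w _; rewrite lee_fin sqr_ge0.
    + by move=> w _; rewrite lee_fin sqr_ge0.
    + by apply/measurable_EFinP; apply: measurable_funX; exact: measurable_funB.
    + by move=> w _; rewrite lee_fin !mulr_ge0.
    + by apply/measurable_EFinP; exact: measurable_funM.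
  rewrite -(leeD2rE (x := (2 * m * m)%:E))// E.
  apply: (le_trans (leeD2r _ (ES2 n))).
  by rewrite -!EFinD lee_fin -/m le_eqVlt; apply/orP; left; apply/eqP; ring.
suff H : (rho p.1)^-1 * (S p.1 p.2 - p.1%:R * q p.1) @[p --> whp P] --> (0:R).
  rewrite (_ : (fun p => _) = (fun p : nat * T =>
      (rho p.1)^-1 * (S p.1 p.2 - p.1%:R * q p.1) + p.1%:R * q p.1 / rho p.1)).
    rewrite -[l]add0r; apply: cvgD => //; exact: whp_seq ql.
  by apply/funext => p; rewrite mulrBr [p.1%:R * _ / _]mulrC subrK.
apply/cvgrPdist_lt => eps eps0.
apply: (whp_prob (N := fun n => [set w | eps <= `|(rho n)^-1 * (S n w - n%:R * q n)|])).
- move=> n; apply: measurable_set_le; first exact: measurable_cst.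
  apply: measurableT_comp => //; apply: measurable_funM => //.
  exact: measurable_funB.
- have bnd : (eps ^- 2 * ((n%:R * q n / rho n) * (rho n)^-1))%:E @[n --> \oo] --> 0%E.
    apply: cvg_EFin; first exact: nearW.
    rewrite -[X in _ --> X](mulr0 (eps ^- 2)); apply: cvgM; first exact: cvg_cst.
    rewrite -[X in _ --> X](mulr0 l); apply: cvgM => //.
    apply/gtr0_cvgV0 => //; move/cvgryPgt : rhooo => /(_ 0); exact.
  apply: (squeeze_cvge _ (cvg_cst 0%E) bnd).
  near=> n.
  have r0 : 0 < rho n by near: n; move/cvgryPgt : rhooo => /(_ 0); exact.
  rewrite measure_ge0/=.
  set N := [set w | _].
  have mN : measurable N.
    apply: measurable_set_le; first exact: measurable_cst.
    apply: measurableT_comp => //; apply: measurable_funM => //.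
    exact: measurable_funB.
  (* Chebyshev: on [N] the squared deviation is at least (eps rho_n)^2. *)
  have : (\int[P]_(w in N) ((eps * rho n) ^+ 2)%:E <= (n%:R * q n)%:E)%E.
    apply: le_trans (var n).
    apply: (@le_trans _ _ (\int[P]_(w in N) ((S n w - n%:R * q n) ^+ 2)%:E)%E).
      apply: ge0_le_integral => //.
      - by move=> w _; rewrite lee_fin sqr_ge0.
      - apply/measurable_EFinP/measurable_funTS; apply: measurable_funX.
        exact: measurable_funB.
      - move=> w; rewrite /N/= => Nw; rewrite lee_fin -[leRHS]real_normK ?num_real//.
        have er0 : 0 <= eps * rho n by apply: mulr_ge0; exact: ltW.
        rewrite ler_sqr ?nnegrE// -ler_pdivlMr//.
        by move: Nw; rewrite normrM gtr0_norm ?invr_gt0// mulrC.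
    apply: ge0_subset_integral => //.
    - by apply/measurable_EFinP; apply: measurable_funX; exact: measurable_funB.
    - by move=> w _; rewrite lee_fin sqr_ge0.
  rewrite integral_cst// => H.
  have PN : P N \is a fin_num by rewrite fin_num_measure.
  have {}H : (((eps * rho n) ^+ 2)%:E * (fine (P N))%:E <= (n%:R * q n)%:E)%E.
    by rewrite fineK.
  rewrite -EFinM lee_fin in H; rewrite -(fineK PN) lee_fin.
  rewrite mulrC -ler_pdivlMr in H; last by rewrite exprn_gt0// mulr_gt0.
  apply: (le_trans H); rewrite le_eqVlt; apply/orP; left; apply/eqP.
  by field; rewrite !gt_eqF.
- by move=> n w /negP; rewrite -ltNge sub0r normrN.
Unshelve. all: by end_near. Qed.

(** * Convergence in law to a normal variable and negligible errors *)

Lemma normal_cdf_itv {R : realType} (m s a b : R) : a <= b ->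
  normal_prob m s `]a, b]%classic = (normal_cdf m s b - normal_cdf m s a)%:E.
Proof.
move=> ab; pose N : probability (measurableTypeR R) R := normal_prob m s.
have : N `]-oo, b]%classic = (N `]-oo, a]%classic + N `]a, b]%classic)%E.
  rewrite -measureU//.
    congr (N _); rewrite predeqE => x /=; rewrite !in_itv/=.
    split=> [xb|[xa|/andP[]//]]; last exact: le_trans xa ab.
    by case: leP => xa; [left|right].
  by rewrite predeqE => x; split => // -[] /=; rewrite !in_itv/= leNgt => /negP + /andP[].
have Nf A : measurable A -> N A \is a fin_num by exact: fin_num_measure.
rewrite [X in X = _](normal_cdfE m s b) [X in (X + _)%E](normal_cdfE m s a).
rewrite -(fineK (Nf `]a, b]%classic _))// -EFinD => -[E].
change (N `]a, b]%classic = (normal_cdf m s b - normal_cdf m s a)%:E).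
by rewrite -(fineK (Nf `]a, b]%classic _))// E addrC addKr.
Qed.

Lemma normal_cdf_lipschitz {R : realType} (m s a b : R) : s != 0 -> a <= b ->
  0 <= normal_cdf m s b - normal_cdf m s a <= normal_peak s * (b - a).
Proof.
move=> s0 ab; pose N : probability (measurableTypeR R) R := normal_prob m s.
rewrite -!lee_fin -normal_cdf_itv//; apply/andP; split; first exact: (measure_ge0 N).
apply: (@le_trans _ _ (\int[leb]_(x in `]a, b]) (cst (normal_peak s)%:E x))%E).
  apply: ge0_le_integral => //.
  - by move=> x _; rewrite lee_fin normal_pdf_ge0.
  - by apply/measurable_EFinP/measurable_funTS; exact: measurable_normal_pdf.
  - by move=> x _; rewrite lee_fin normal_pdf_ub.
rewrite integral_cst//= lebesgue_measure_itv/=.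
rewrite lte_fin; case: ltP => ba; first by rewrite -EFinB -EFinM.
by rewrite mule0 lee_fin mulr_ge0 ?normal_peak_ge0// subr_ge0.
Qed.

Lemma normal_cdf_tight {R : realType} (m s : R) :
  normal_cdf m s n%:R - normal_cdf m s (- n%:R) @[n --> \oo] --> (1 : R).
Proof.
pose N : probability (measurableTypeR R) R := normal_prob m s.
have := @nondecreasing_cvg_mu _ _ _ N (fun n => `](- n%:R : R), n%:R]%classic).
have -> : \bigcup_n `](- n%:R : R), n%:R]%classic = setT.
  rewrite predeqE => x; split => // _; exists (Num.bound `|x|).+1 => //=.
  rewrite in_itv/=; have := archi_boundP (normr_ge0 x).
  rewrite -natr1 => xb; have := ler_norm x; have := ler_norm (- x).
  by rewrite normrN; lra.
move=> /(_ _ _ _) H.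
have {}H : N `](- n%:R : R), n%:R]%classic @[n --> \oo] --> 1%E.
  rewrite -(probability_setT N); apply: H => //.
  move=> i j ij; apply/subsetPset => x /=; rewrite !in_itv/= => /andP[x1 x2].
  have : (i%:R : R) <= j%:R by rewrite ler_nat.
  by lra.
rewrite (_ : (fun n => _) = (fun n : nat => fine (N `](- n%:R : R), n%:R]%classic))).
  exact: fine_cvg.
apply/funext => n; have nn : - n%:R <= n%:R :> R by rewrite ge0_cp ?ler0n.
by rewrite [X in fine X](normal_cdf_itv m s nn).
Qed.

Lemma prob_le_union {d : measure_display} {T : measurableType d} {R : realType}
    (P : probability T R) (A B N : set T) :
  measurable A -> measurable B -> measurable N -> A `<=` B `|` N ->
  fine (P A) <= fine (P B) + fine (P N).
Proof.
move=> mA mB mN AB; rewrite -lee_fin EFinD !fineK ?fin_num_measure//.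
apply: (@le_trans _ _ (P (B `|` N))).
  by apply: le_measure; rewrite ?inE//; exact: measurableU.
exact: measureU2.
Qed.

(** Off a small event, Y <= y lies between two events Z <= x - h and Z <= x + h. The error eps is
    shared equally by the exceptional event, the convergence of the laws of Z, and the Lipschitz
    bound on the normal distribution function. *)
Lemma slutsky {d : measure_display} {T : measurableType d} {R : realType}
    (P : probability T R) (Z Y : nat -> T -> R) (mu sigma y : R) :
  0 < sigma ->
  (forall n, measurable_fun [set: T] (Z n)) ->
  (\forall n \near \oo, measurable_fun [set: T] (Y n)) ->
  (forall z, fine (P [set w | Z n w <= z]) @[n --> \oo] --> normal_cdf 0 1 z) ->
  Y p.1 p.2 - (mu + sigma * Z p.1 p.2) @[p --> whp P] --> (0 : R) ->
  fine (P [set w | Y n w <= y]) @[n --> \oo] --> normal_cdf 0 1 ((y - mu) / sigma).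
Proof.
move=> s0 mZ mY HZ HD; apply/cvgrPdist_le => eps eps0.
set x := (y - mu) / sigma; pose L : R := normal_peak 1.
have L0 : 0 < L by rewrite normal_peak_gt0// oner_eq0.
have e3 : 0 < eps / 3 by lra.
(* The largest shift that costs at most eps/3 in normal probability, L being the height of the
   density. *)
pose h := eps / 3 / L; have h0 : 0 < h by rewrite divr_gt0.
have Lh : L * h = eps / 3 by rewrite /h; field; lra.
have sh0 : 0 < sigma * h by rewrite mulr_gt0.
have /cvgrPdist_lt/(_ _ sh0)/(_ _ e3) := HD.
have /cvgrPdist_lt/(_ _ e3) := HZ (x + h).
have /cvgrPdist_lt/(_ _ e3) := HZ (x - h).
move=> H1 H2 H3; near=> n.
have mYn : measurable_fun [set: T] (Y n) by near: n.
have mYy : measurable [set w | Y n w <= y].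
  by apply: measurable_set_le => //; exact: measurable_cst.
have mZz z : measurable [set w | Z n w <= z].
  by apply: measurable_set_le => //; exact: measurable_cst.
have [N [mN PN HN]] : exists N : set T, [/\ measurable N, (P N <= (eps / 3)%:E)%E &
    forall w, ~ N w -> `|0 - (Y n w - (mu + sigma * Z n w))| < sigma * h] by near: n.
have PN' : fine (P N) <= eps / 3 by rewrite -lee_fin fineK ?fin_num_measure.
have B1 : `|normal_cdf 0 1 (x - h) - fine (P [set w | Z n w <= x - h])| < eps / 3 by near: n.
have B2 : `|normal_cdf 0 1 (x + h) - fine (P [set w | Z n w <= x + h])| < eps / 3 by near: n.
have yE : y = mu + sigma * x by rewrite /x; field; lra.
have U : fine (P [set w | Y n w <= y]) <= fine (P [set w | Z n w <= x + h]) + fine (P N).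
  apply: prob_le_union => // w /= Yy; have [Nw|Nw] := pselect (N w); first by right.
  left => /=; have := HN w Nw; rewrite sub0r normrN ltr_norml => /andP[Hl _].
  rewrite leNgt; apply/negP => xz; have : sigma * (x + h) < sigma * Z n w by rewrite ltr_pM2l.
  by rewrite mulrDr; lra.
have V : fine (P [set w | Z n w <= x - h]) <= fine (P [set w | Y n w <= y]) + fine (P N).
  apply: prob_le_union => // w /= Zx; have [Nw|Nw] := pselect (N w); first by right.
  left => /=; have := HN w Nw; rewrite sub0r normrN ltr_norml => /andP[_ Hr].
  have : sigma * Z n w <= sigma * (x - h) by rewrite ler_pM2l.
  by rewrite mulrBr; lra.
have one0 : (1 : R) != 0 by exact: oner_neq0.
have xh1 : x - h <= x by lra.
have xh2 : x <= x + h by lra.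
have /andP[l1 u1] := normal_cdf_lipschitz 0 one0 xh1.
have /andP[l2 u2] := normal_cdf_lipschitz 0 one0 xh2.
have e1 : normal_peak 1 * (x - (x - h)) = eps / 3 by rewrite -Lh; congr (_ * _); lra.
have e2 : normal_peak 1 * (x + h - x) = eps / 3 by rewrite -Lh; congr (_ * _); lra.
rewrite e1 in u1; rewrite e2 in u2.
move: B1 B2 U V PN' u1 u2; rewrite !ltr_norml ler_norml; clear.
by move=> /andP[? ?] /andP[? ?] ? ? ? ? ?; apply/andP; split; lra.
Unshelve. all: by end_near. Qed.

(** A sequence that converges in law is bounded in probability, so a factor that tends to 0 in
    probability annihilates it. *)
Lemma whp_tight {d : measure_display} {T : measurableType d} {R : realType}
    (P : probability T R) (Z c : nat -> T -> R) :
  (forall n, measurable_fun [set: T] (Z n)) ->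
  (forall z, fine (P [set w | Z n w <= z]) @[n --> \oo] --> normal_cdf 0 1 z) ->
  c p.1 p.2 @[p --> whp P] --> (0 : R) ->
  c p.1 p.2 * Z p.1 p.2 @[p --> whp P] --> (0 : R).
Proof.
move=> mZ HZ c0; apply/cvgrPdist_lt => eps eps0 delta delta0.
have d4 : 0 < delta / 4 by lra.
have d2 : 0 < delta / 2 by lra.
(* The normal mass outside [-K, K] is below delta/4, and the two approximation errors of delta/8
   bring P(A) to at most delta/2; the other half is spent on c. *)
have [K [K0 HK]] : exists K : R, 0 < K /\
    1 - delta / 4 < normal_cdf 0 1 K - normal_cdf 0 1 (- K).
  have /cvgrPdist_lt/(_ _ d4) [k _ Hk] := @normal_cdf_tight R 0 1.
  exists k.+1%:R; rewrite ltr0n; split => //.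
  have := Hk k.+1 (leqnSn k); rewrite /= ltr_norml => /andP[_]; lra.
have eK : 0 < eps / K by rewrite divr_gt0.
have /cvgrPdist_lt/(_ _ eK)/(_ _ d2) H1 := c0.
have d8 : 0 < delta / 8 by lra.
have /cvgrPdist_lt/(_ _ d8) H2 := HZ K.
have /cvgrPdist_lt/(_ _ d8) H3 := HZ (- K).
near=> n.
have [N [mN PN HN]] : exists N : set T, [/\ measurable N, (P N <= (delta / 2)%:E)%E &
    forall w, ~ N w -> `|0 - c n w| < eps / K] by near: n.
have B1 : `|normal_cdf 0 1 K - fine (P [set w | Z n w <= K])| < delta / 8 by near: n.
have B2 : `|normal_cdf 0 1 (- K) - fine (P [set w | Z n w <= - K])| < delta / 8 by near: n.
have mZz z : measurable [set w | Z n w <= z].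
  by apply: measurable_set_le => //; exact: measurable_cst.
pose A := [set w | Z n w <= - K] `|` ~` [set w | Z n w <= K].
have mA : measurable A by apply: measurableU => //; exact: measurableC.
have PA : (P A <= (delta / 2)%:E)%E.
  have : (P A <= P [set w | Z n w <= - K]%R + P (~` [set w | Z n w <= K]%R))%E.
    exact: (measureU2 _ (mZz _) (measurableC (mZz _))).
  move/le_trans; apply.
  rewrite probability_setC// -(fineK (fin_num_measure P _ (mZz (- K)))).
  rewrite -(fineK (fin_num_measure P _ (mZz K))) -EFinB -EFinD lee_fin.
  by move: B1 B2; rewrite !ltr_norml => /andP[? ?] /andP[? ?]; lra.
exists (N `|` A); split; first exact: measurableU.
  apply: (le_trans (measureU2 _ mN mA)).
  by rewrite [delta]splitr EFinD leeD.
move=> w /not_orP[Nw /not_orP[A1 A2]].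
have {}A2 : Z n w <= K by apply: contrapT.
have {}A1 : - K < Z n w by rewrite ltNge; apply/negP.
have := HN w Nw; rewrite /= !sub0r !normrN normrM => cw.
have ZK : `|Z n w| <= K by rewrite ler_norml A2 ltW.
apply: (@le_lt_trans _ _ (`|c n w| * K)); first by rewrite ler_wpM2l.
by rewrite -ltr_pdivlMr.
Unshelve. all: by end_near. Qed.

(** * Moments of the normal law *)

Lemma normal_peak_scale {R : realType} (s : R) : 0 < s ->
  normal_peak s = normal_peak 1 / s.
Proof.
move=> s0; rewrite /normal_peak expr1n mul1r -mulrnAr sqrtrM ?sqr_ge0//.
by rewrite sqrtr_sqr gtr0_norm// invfM mulrC.
Qed.

Lemma is_derive_normal_pdf {R : realType} (m s z : R) : 0 < s ->
  is_derive z 1 (normal_pdf m s) (- ((z - m) / s ^+ 2) * normal_pdf m s z).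
Proof.
move=> s0.
have -> : normal_pdf m s = (fun z => normal_peak s * expR (- ((z - m) ^+ 2 / (2 * s ^+ 2)))).
  by apply/funext => v; rewrite normal_pdf_shape.
have Dm : is_derive z 1 (fun v : R => v - m) 1.
  by have := is_deriveB (is_derive_id z 1) (is_derive_cst m z 1); rewrite subr0.
have D1 : is_derive z 1 (fun v : R => - ((v - m) ^+ 2 / (2 * s ^+ 2))) (- ((z - m) / s ^+ 2)).
  have := is_deriveN (is_deriveM (is_deriveX 2 Dm) (is_derive_cst ((2 * s ^+ 2)^-1) z 1)).
  rewrite (_ : - _ = (fun v : R => - ((v - m) ^+ 2 / (2 * s ^+ 2)))); last first.
    by apply/funext => v; rewrite opprfctE mulrfctE exprfctE.
  by move/is_derive_eq; apply; rewrite !fctE /GRing.scale/=; field; lra.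
have D2 := @is_derive1_comp R expR (fun v => - ((v - m) ^+ 2 / (2 * s ^+ 2))) z _ _ (is_derive_expR _) D1.
have := is_deriveM (is_derive_cst (normal_peak s) z 1) D2.
by move/is_derive_eq; apply; rewrite !fctE /GRing.scale/=; ring.
Qed.

Lemma normal_cdf_standard {R : realType} (m s x : R) : 0 < s ->
  normal_cdf m s x = normal_cdf 0 1 ((x - m) / s).
Proof.
move=> s0; apply: EFin_inj; rewrite !normal_cdf_compl; congr (1 - _)%E.
pose F (v : R) : R := (v - m) / s.
have dF (v : R) : is_derive v 1 F s^-1.
  have := is_deriveM (is_deriveB (is_derive_id v 1) (is_derive_cst m v 1)) (is_derive_cst (s^-1) v 1).
  by move/is_derive_eq; apply; rewrite !fctE /GRing.scale/=; ring.
have F'E : F^`()%classic = cst s^-1.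
  by apply/funext => v; rewrite derive1E; have [_ ->] := dF v.
rewrite -/(F x) (@increasing_ge0_integration_by_substitutiony _ F (normal_pdf 0 1))//.
- apply: eq_integral => v _; rewrite F'E mulrfctE /=; congr EFin.
  rewrite (normal_pdf_shape _ _ s0) (normal_pdf_shape _ _ ltr01).
  rewrite (normal_peak_scale s0) [RHS]mulrAC; congr (_ / _ * expR _).
  by rewrite /F subr0; field; lra.
- by move=> a b _ _ ab; rewrite /F ltr_pM2r ?invr_gt0// ltrD2r.
- by move=> v _; rewrite F'E; exact: cvg_cst.
- by rewrite F'E; exact: is_cvg_cst.
- by rewrite F'E; exact: is_cvg_cst.
- split; first by move=> v _; have [] := dF v.
  by apply: cvg_at_right_filter; exact: (is_derive_continuous (dF x)).
- apply/cvgryPge => A; near=> v.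
  by rewrite /F ler_pdivlMr// lerBrDr; near: v; apply: nbhs_pinfty_ge; exact: num_real.
- by apply: continuous_subspaceT; apply: continuous_normal_pdf; exact: oner_neq0.
- by move=> v _; exact: normal_pdf_ge0.
Unshelve. all: by end_near. Qed.

(** The function -s^2 (z + m) times the density is an antiderivative of (z^2 - m^2 - s^2) times the
    density. On intervals centred at m, the second moment is thus m^2 + s^2 times the mass plus a
    boundary term. *)
Lemma normal_second_moment {R : realType} (m s : R) : 0 < s ->
  (\int[leb]_(z in [set: R]) (z ^+ 2 * normal_pdf m s z)%:E =
   (m ^+ 2 + s ^+ 2)%:E)%E.
Proof.
move=> s0; set C := m ^+ 2 + s ^+ 2.
have C0 : 0 < C by rewrite ltr_wpDl ?sqr_ge0// exprn_gt0.
pose G (z : R) : R := - s ^+ 2 * (z + m) * normal_pdf m s z.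
have dG (z : R) : is_derive z 1 G ((z ^+ 2 - C) * normal_pdf m s z).
  have D1 : is_derive z 1 (fun z : R => - s ^+ 2 * (z + m)) (- s ^+ 2).
    have := is_deriveM (is_derive_cst (- s ^+ 2) z 1) (is_deriveD (is_derive_id z 1) (is_derive_cst m z 1)).
    by move/is_derive_eq; apply; rewrite !fctE /GRing.scale/=; ring.
  have := is_deriveM D1 (is_derive_normal_pdf m z s0).
  by move/is_derive_eq; apply; rewrite ?fctE /GRing.scale/= /C; field; lra.
have ms0 : s != 0 by rewrite gt_eqF.
have cpdf := continuous_normal_pdf (m := m) ms0.
have cz2 : continuous (fun z : R => z ^+ 2 * normal_pdf m s z).
  by move=> z; apply: cvgM; [exact: exprn_continuous|exact: cpdf].
pose I n : set (measurableTypeR R) := `[(m - n.+1%:R)%R, (m + n.+1%:R)%R]%classic.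
have mI n : measurable (I n) by exact: measurable_itv.
have ndI : nondecreasing_seq I.
  move=> i j ij; apply/subsetPset => x; rewrite /I/= !in_itv/= => /andP[x1 x2].
  have : (i.+1%:R : R) <= j.+1%:R by rewrite ler_nat.
  by lra.
have UI : \bigcup_n I n = setT.
  rewrite predeqE => x; split => // _; exists (Num.bound `|x - m|) => //=.
  rewrite /I/= in_itv/=; have := archi_boundP (normr_ge0 (x - m)).
  have := ler_norm (x - m); have := ler_norm (- (x - m)).
  by rewrite normrN -natr1; lra.
pose f (z : R) := (z ^+ 2 * normal_pdf m s z)%:E.
pose p (z : R) := (normal_pdf m s z)%:E.
have f0 z : (0 <= f z)%E by rewrite lee_fin mulr_ge0 ?sqr_ge0 ?normal_pdf_ge0.
have p0 z : (0 <= p z)%E by rewrite lee_fin normal_pdf_ge0.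
have mf : measurable_fun [set: R] f by apply/measurable_EFinP; exact: continuous_measurable_fun.
have mp : measurable_fun [set: R] p by apply/measurable_EFinP; exact: measurable_normal_pdf.
have L1 : (\int[leb]_(x in I i) f x @[i --> \oo] --> \int[leb]_(x in \bigcup_i I i) f x)%E.
  by apply: ge0_nondecreasing_set_cvg_integral => // i; exact: measurable_funTS.
have L2 : (\int[leb]_(x in I i) p x @[i --> \oo] --> \int[leb]_(x in \bigcup_i I i) p x)%E.
  by apply: ge0_nondecreasing_set_cvg_integral => // i; exact: measurable_funTS.
rewrite UI in L1 L2.
rewrite [X in _ --> X]integral_normal_pdf in L2.
pose pn i := fine (\int[leb]_(x in I i) p x)%E.
have pnE i : (\int[leb]_(x in I i) p x = (pn i)%:E)%E.
  rewrite /pn fineK// ge0_fin_numE; last by apply: integral_ge0.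
  apply: (@le_lt_trans _ _ (\int[leb]_x p x)%E); last by rewrite integral_normal_pdf ltry.
  exact: ge0_subset_integral.
have pn1 : pn i @[i --> \oo] --> (1 : R) by apply: fine_cvg.
pose r i : R := G (m + i.+1%:R) - G (m - i.+1%:R).
have fnE i : (\int[leb]_(x in I i) f x = (C * pn i + r i)%:E)%E.
  have lt : m - i.+1%:R < m + i.+1%:R.
    by have := ltr0Sn R i; lra.
  have H := @continuous_FTC2 R (fun z => (z ^+ 2 - C) * normal_pdf m s z) G _ _ lt.
  have {}H : (\int[leb]_(x in I i) ((x ^+ 2 - C) * normal_pdf m s x)%:E = (r i)%:E)%E.
    rewrite [LHS]H//.
    - apply: continuous_subspaceT => z; apply: cvgM; last exact: cpdf.
      by apply: cvgB; [exact: exprn_continuous|exact: cvg_cst].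
    - split; first by move=> z _; have [] := dG z.
      + by apply/cvg_at_right_filter; exact: (is_derive_continuous (dG _)).
      + by apply/cvg_at_left_filter; exact: (is_derive_continuous (dG _)).
    - by move=> z _; rewrite derive1E; have [_ ->] := dG z.
  have intp : lebesgue_measure.-integrable (I i) p.
    by apply: (integrableS _ _ (@subsetT _ _)) => //; exact: integrable_normal_pdf.
  have intf : lebesgue_measure.-integrable (I i) f.
    apply: continuous_compact_integrable; first exact: segment_compact.
    exact: continuous_subspaceT.
  rewrite EFinD EFinM -pnE -H -integralZl//.
  rewrite -integralD//=.
  - by apply: eq_integral => z _; rewrite /f /p -EFinM -EFinD; congr EFin; ring.
  - exact: integrableZl.
  - apply: continuous_compact_integrable; first exact: segment_compact.
    apply: continuous_subspaceT => z; apply: cvgM; last exact: cpdf.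
    by apply: cvgB; [exact: exprn_continuous|exact: cvg_cst].
have r0 : r i @[i --> \oo] --> (0 : R).
  have rE i : r i = - (2 * s ^+ 2 * normal_peak s) * (i.+1%:R * expR (- (i.+1%:R ^+ 2 / (2 * s ^+ 2)))).
    rewrite /r /G !normal_pdf_shape//.
    rewrite (_ : m + i.+1%:R - m = i.+1%:R); last by ring.
    rewrite (_ : m - i.+1%:R - m = - i.+1%:R); last by ring.
    by rewrite sqrrN; ring.
  rewrite (funext rE).
  rewrite -[X in _ --> X](mulr0 (- (2 * s ^+ 2 * normal_peak s))).
  apply: cvgM; first exact: cvg_cst.
  (* The boundary term is a multiple of b expR (- t) with b = i+1 and t = b^2/(2 s^2), and expR (-
     t) <= 1/t leaves 2 s^2/b. *)
  have up : 2 * s ^+ 2 / i.+1%:R @[i --> \oo] --> (0 : R).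
    rewrite -[X in _ --> X](mulr0 (2 * s ^+ 2)); apply: cvgM; first exact: cvg_cst.
    exact: cvg_harmonic.
  apply: (squeeze_cvgr _ (cvg_cst 0) up).
  apply: nearW => i; rewrite mulr_ge0 ?expR_ge0//=.
  have i0 : (0 : R) < i.+1%:R by rewrite ltr0n.
  set b : R := i.+1%:R; set t := b ^+ 2 / (2 * s ^+ 2).
  have t0 : 0 < t by rewrite divr_gt0 ?exprn_gt0 ?mulr_gt0 ?exprn_gt0.
  have -> : 2 * s ^+ 2 / b = b * t^-1 by rewrite /t; field; rewrite !gt_eqF.
  apply: ler_wpM2l; first exact: ltW.
  rewrite expRN lef_pV2 ?posrE ?expR_gt0//.
  by apply: le_trans (expR_ge1Dx t); lra.
have L3 : (\int[leb]_(x in I i) f x @[i --> \oo] --> C%:E)%E.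
  rewrite (funext fnE).
  apply: cvg_EFin; first exact: nearW.
  rewrite -[X in _ --> X]addr0 -[X in _ --> X + _]mulr1; apply: cvgD => //.
  by apply: cvgM => //; exact: cvg_cst.
exact: (cvg_unique _ L1 L3).
Qed.

(** Truncation at K confines the integral of tail probabilities to a bounded interval, where they
    are dominated by 1. The first conjunct is the measurability that dominated convergence asks
    for. *)
Lemma truncated_layer_cake {d : measure_display} {T : measurableType d}
    {R : realType} (P : probability T R) (Y : T -> R) (K : R) :
  measurable_fun [set: T] Y -> (forall w, 0 <= Y w) -> 0 < K ->
  measurable_fun [set: R] (fun t => P [set w | t < Y w]) /\
  (\int[P]_w (Num.min (Y w) K)%:E =
   \int[leb]_(t in `[0%R, K[) P [set w | (t < Y w)%R])%E.
Proof.
move=> mY Y0 K0.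
have toRV (Z : T -> R) : measurable_fun [set: T] Z ->
    exists Z' : {RV P >-> R}, (Z' : T -> R) = Z.
  move=> mZ; pose Z' : {mfun T >-> R} := HB.pack Z (isMeasurableFun.Build _ _ _ _ Z mZ).
  by exists Z'.
have ccdfE (Z : {RV P >-> R}) t : ccdf (P := P) Z t = P [set w | t < Z w].
  rewrite /ccdf /distribution /pushforward/=; congr (P _).
  by rewrite predeqE => w /=; rewrite in_itv/= andbT.
have mm : measurable_fun [set: T] (fun w => Num.min (Y w) K).
  by apply: measurable_minr => //; exact: measurable_cst.
have [Y' Y'E] := toRV _ mY; have [M ME] := toRV _ mm.
split.
  rewrite -Y'E (_ : (fun t => _) = ccdf (P := P) Y'); first exact: ccdf_measurable.
  by apply/funext => t; rewrite ccdfE.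
have M0 w : 0 <= M w by rewrite ME le_min Y0 ltW.
have := ge0_expectation_ccdf M0.
rewrite unlock/= ME => ->.
rewrite (_ : `[0%R, K[%classic = `[0%R, +oo[%classic `&` [set t : R | t < K]); last first.
  by rewrite predeqE => t; rewrite /= !in_itv/= andbT; split => [/andP[]//|[-> ->]].
rewrite integral_mkcondr; apply: eq_integral => t _.
rewrite ccdfE ME patchE; case: ifPn => [|].
  rewrite inE/= => tK; congr (P _); rewrite predeqE => w /=.
  by rewrite lt_min tK andbT.
rewrite notin_setE/= => tK; rewrite (_ : [set w | _] = set0) ?measure0//.
by rewrite predeqE => w /=; split => //; rewrite lt_min => /andP[_].
Qed.

(** The strict event is squeezed between the events at y - h and at y, and the limit law is
    continuous. *)
Lemma cdf_left_limit {d : measure_display} {T : measurableType d}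
    {R : realType} (P : probability T R) (Y : nat -> T -> R) (m s y : R) :
  s != 0 -> (forall n, measurable_fun [set: T] (Y n)) ->
  (forall y, fine (P [set w | Y n w <= y]) @[n --> \oo] --> normal_cdf m s y) ->
  fine (P [set w | Y n w < y]) @[n --> \oo] --> normal_cdf m s y.
Proof.
move=> s0 mY HY; apply/cvgrPdist_le => eps eps0.
have L0 : 0 < normal_peak s by exact: normal_peak_gt0.
pose h := eps / 2 / normal_peak s.
have h0 : 0 < h by rewrite divr_gt0// divr_gt0.
have yh : y - h <= y by lra.
have /andP[l1 u1] := normal_cdf_lipschitz m s0 yh.
have e1 : normal_peak s * (y - (y - h)) = eps / 2.
  by rewrite /h; field; rewrite gt_eqF.
rewrite e1 in u1.
have e2 : 0 < eps / 2 by rewrite divr_gt0.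
have /cvgrPdist_lt/(_ _ e2) H1 := HY y.
have /cvgrPdist_lt/(_ _ e2) H2 := HY (y - h).
near=> n.
have B1 : `|normal_cdf m s y - fine (P [set w | Y n w <= y])| < eps / 2 by near: n.
have B2 : `|normal_cdf m s (y - h) - fine (P [set w | Y n w <= y - h])| < eps / 2 by near: n.
have m1 z : measurable [set w | Y n w <= z].
  by apply: measurable_set_le => //; exact: measurable_cst.
have m2 : measurable [set w | Y n w < y].
  by apply: measurable_set_lt => //; exact: measurable_cst.
have U : fine (P [set w | Y n w < y]) <= fine (P [set w | Y n w <= y]).
  rewrite -lee_fin !fineK ?fin_num_measure//; apply: le_measure; rewrite ?inE//.
  by move=> w /ltW.
have V : fine (P [set w | Y n w <= y - h]) <= fine (P [set w | Y n w < y]).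
  rewrite -lee_fin !fineK ?fin_num_measure//; apply: le_measure; rewrite ?inE//.
  by move=> w /= /le_lt_trans; apply; lra.
move: B1 B2; rewrite !ltr_norml ler_norml => /andP[? ?] /andP[? ?].
by apply/andP; split; lra.
Unshelve. all: by end_near. Qed.

Lemma square_tail_limit {d : measure_display} {T : measurableType d}
    {R : realType} (P : probability T R) (Y : nat -> T -> R) (m s t : R) :
  s != 0 -> (forall n, measurable_fun [set: T] (Y n)) ->
  (forall y, fine (P [set w | Y n w <= y]) @[n --> \oo] --> normal_cdf m s y) ->
  0 <= t ->
  P [set w | t < Y n w ^+ 2] @[n --> \oo] -->
    (normal_cdf m s (- Num.sqrt t) + (1 - normal_cdf m s (Num.sqrt t)))%:E.
Proof.
move=> s0 mY HY t0; set q := Num.sqrt t.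
have q0 : 0 <= q by exact: sqrtr_ge0.
have tE : t = q ^+ 2 by rewrite sqr_sqrtr.
have E n : P [set w | t < Y n w ^+ 2] =
   (fine (P [set w | Y n w < - q]) + (1 - fine (P [set w | Y n w <= q])))%:E.
  have m1 : measurable [set w | Y n w <= q].
    by apply: measurable_set_le => //; exact: measurable_cst.
  have m2 : measurable [set w | Y n w < - q].
    by apply: measurable_set_lt => //; exact: measurable_cst.
  rewrite EFinD EFinB !fineK ?fin_num_measure// -probability_setC//.
  rewrite -measureU//.
  - congr (P _); rewrite predeqE => w /=; rewrite tE.
    split.
      move=> qY; have [|Yq] := ltP (Y n w) (- q); first by left.
      right; apply/negP; rewrite -ltNge; rewrite ltNge; apply/negP => Yq'.
      by move: qY; rewrite ltNge => /negP; apply; nra.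
    by move=> [Yq|/negP]; [nra|rewrite -ltNge => Yq; nra].
  - exact: measurableC.
  - rewrite predeqE => w /=; split => // -[Yq /negP].
    by rewrite -ltNge; lra.
rewrite (funext E); apply: cvg_EFin; first exact: nearW.
apply: cvgD; first exact: cdf_left_limit.
by apply: cvgB => //; exact: cvg_cst.
Qed.

Lemma truncated_second_moment_limit {d : measure_display} {T : measurableType d}
    {R : realType} (P : probability T R) (Y : nat -> T -> R) (m s C K : R) :
  0 < s -> 0 < C -> 0 < K -> (forall n, measurable_fun [set: T] (Y n)) ->
  (forall y, fine (P [set w | Y n w <= y]) @[n --> \oo] --> normal_cdf m s y) ->
  (\int[P]_w (Num.min (Y n w ^+ 2 / C) K)%:E @[n --> \oo] -->
   \int[leb]_z (Num.min (z ^+ 2 / C) K * normal_pdf m s z)%:E)%E.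
Proof.
move=> s0 C0 K0 mY HY; have sn : s != 0 by rewrite gt_eqF.
pose N : probability (measurableTypeR R) R := normal_prob m s.
(* The constant sequence equal to the identity under the normal law satisfies the same hypotheses.
   Applying [square_tail_limit] to it identifies the limit as a normal tail probability. *)
pose id' (n : nat) : measurableTypeR R -> R := fun z => z.
have mid n : measurable_fun [set: measurableTypeR R] (id' n).
  by move=> _ A mA; rewrite setTI.
have Hid y : fine (N [set w | id' n w <= y]) @[n --> \oo] --> normal_cdf m s y.
  rewrite (_ : (fun n => _) = cst (normal_cdf m s y)); first exact: cvg_cst.
  by apply/funext => n; rewrite /normal_cdf; congr (fine (N _)).
have mq n : measurable_fun [set: T] (fun w => Y n w ^+ 2 / C).
  by apply: measurable_funM; [exact: measurable_funX|exact: measurable_cst].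
have mqi : measurable_fun [set: measurableTypeR R] (fun z : measurableTypeR R => (z ^+ 2 / C : R)).
  move=> mT A mA.
  have mm : measurable_fun [set: R] (fun z : R => z ^+ 2 / C).
    by apply: measurable_funM; [exact: measurable_funX|exact: measurable_cst].
  exact: (mm mT A mA).
have q0 (x : R) : 0 <= x ^+ 2 / C by rewrite divr_ge0 ?sqr_ge0// ltW.
have LC n := @truncated_layer_cake _ _ _ P _ K (mq n) (fun w => q0 _) K0.
have [mN LN] := @truncated_layer_cake _ _ _ N _ K mqi (fun w => q0 _) K0.
have tE (x t : R) : (t < x ^+ 2 / C) = (C * t < x ^+ 2) by rewrite ltr_pdivlMr// mulrC.
have lim t : 0 <= t -> P [set w | (t < Y n w ^+ 2 / C)%R] @[n --> \oo] -->
    N [set z | (t < z ^+ 2 / C)%R].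
  move=> t0; have Ct0 : 0 <= C * t by rewrite mulr_ge0// ltW.
  have L1 := square_tail_limit sn mY HY Ct0.
  have L2 := square_tail_limit sn mid Hid Ct0.
  pose c := N [set w | C * t < id' 0%N w ^+ 2].
  change (cst c @ \oo --> (normal_cdf m s (- Num.sqrt (C * t)) + (1 - normal_cdf m s (Num.sqrt (C * t))))%:E) in L2.
  have E := cvg_unique (@ereal_hausdorff R) L2 (@cvg_cst _ c _ _ _).
  rewrite E in L1.
  have -> : [set z | (t < z ^+ 2 / C)%R] = [set w | C * t < id' 0%N w ^+ 2].
    by rewrite predeqE => z /=; rewrite tE.
  rewrite (_ : (fun n => _) = (fun n => P [set w | C * t < Y n w ^+ 2]))//.
  by apply/funext => n; congr (P _); rewrite predeqE => w /=; rewrite tE.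
have -> : (\int[leb]_z (Num.min (z ^+ 2 / C) K * normal_pdf m s z)%:E =
     \int[N]_z (Num.min (z ^+ 2 / C) K)%:E)%E.
  have mf : measurable_fun [set: measurableTypeR R] (fun z : measurableTypeR R => (Num.min (z ^+ 2 / C) K)%:E).
    apply/measurable_EFinP; apply: measurable_minr => //; exact: measurable_cst.
  rewrite (@integral_density _ N (normal_pdf m s) (fun z => (Num.min (z ^+ 2 / C) K)%:E) setT)//.
  - exact: measurable_normal_pdf.
  - by move=> x; exact: normal_pdf_ge0.
  - apply: (@le_integrable _ _ _ _ setT _ _ (cst K%:E)) => //.
    + move=> z _; rewrite /= lee_fin ger0_norm ?gtr0_norm// ?ge_min ?lexx ?orbT//.
      by rewrite le_min q0 ltW.
    + exact: finite_measure_integrable_cst.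
rewrite LN (_ : (fun n => _) = (fun n => \int[leb]_(t in `[0%R, K[) P [set w | (t < Y n w ^+ 2 / C)%R])%E); last first.
  by apply/funext => n; have [_] := LC n.
have [|||||_ _] := @dominated_convergence _ _ _ (@lebesgue_measure R) `[0%R, K[%classic (measurable_itv _)
    (fun n t => P [set w | (t < Y n w ^+ 2 / C)%R]) (fun t => N [set z | t < z ^+ 2 / C]) (cst 1%E).
- by move=> n; apply: measurable_funTS; have [] := LC n.
- exact: measurable_funTS.
- by apply: aeW => t /=; rewrite in_itv/= => /andP[t0 _]; exact: lim.
- apply/integrableP; split; first exact: measurable_cst.
  under eq_integral do rewrite /= normr1.
  by rewrite integral_cst//= lebesgue_measure_itv/= lte_fin K0 mul1e -EFinD ltry.
- apply: aeW => t n _; rewrite gee0_abs ?measure_ge0//.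
  apply: probability_le1; apply: (measurable_set_lt (f := cst t)) => //.
exact.
Qed.

Lemma truncated_second_moment_fin_num {R : realType} (m s C K : R) : 0 < C -> 0 <= K ->
  (\int[leb]_z (Num.min (z ^+ 2 / C) K * normal_pdf m s z)%:E)%E \is a fin_num.
Proof.
move=> C0 K0.
have q0 (x : R) : 0 <= x ^+ 2 / C by rewrite divr_ge0 ?sqr_ge0// ltW.
have m0 (z : R) : 0 <= Num.min (z ^+ 2 / C) K by rewrite le_min q0.
have mpdf := measurable_normal_pdf m s.
have mf : measurable_fun [set: R] (fun z : R => (Num.min (z ^+ 2 / C) K * normal_pdf m s z)%:E).
  apply/measurable_EFinP; apply: measurable_funM => //.
  apply: measurable_minr; last exact: measurable_cst.
  by apply: measurable_funM; [exact: measurable_funX|exact: measurable_cst].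
have f0 (z : R) : (0 <= (Num.min (z ^+ 2 / C) K * normal_pdf m s z)%:E)%E.
  by rewrite lee_fin mulr_ge0 ?m0 ?normal_pdf_ge0.
rewrite ge0_fin_numE; last by apply: integral_ge0.
apply: (@le_lt_trans _ _ (\int[leb]_z (K%:E * (normal_pdf m s z)%:E))%E).
  apply: ge0_le_integral => //.
  - by apply/measurable_EFinP; apply: measurable_funM.
  - by move=> z _; rewrite -EFinM lee_fin ler_wpM2r ?normal_pdf_ge0// ge_min lexx orbT.
rewrite ge0_integralZl//.
- by rewrite integral_normal_pdf mule1 ltry.
- exact/measurable_EFinP.
- by move=> z _; rewrite lee_fin normal_pdf_ge0.
Qed.

Lemma normal_second_moment_limit {R : realType} (m s : R) : 0 < s ->
  fine (\int[leb]_z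
    (Num.min (z ^+ 2 / (m ^+ 2 + s ^+ 2)) K * normal_pdf m s z)%:E)%E
  @[K --> +oo] --> (1 : R).
Proof.
move=> s0; set C := m ^+ 2 + s ^+ 2.
have C0 : 0 < C by rewrite ltr_wpDl ?sqr_ge0// exprn_gt0.
have q0 (x : R) : 0 <= x ^+ 2 / C by rewrite divr_ge0 ?sqr_ge0// ltW.
have mq : measurable_fun [set: R] (fun z : R => z ^+ 2 / C).
  by apply: measurable_funM; [exact: measurable_funX|exact: measurable_cst].
have mpdf := measurable_normal_pdf m s.
pose J K := (\int[leb]_z (Num.min (z ^+ 2 / C) K * normal_pdf m s z)%:E)%E.
have mJ (K : R) : measurable_fun [set: R] (fun z : R => (Num.min (z ^+ 2 / C) K * normal_pdf m s z)%:E).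
  apply/measurable_EFinP; apply: measurable_funM => //.
  by apply: measurable_minr => //; exact: measurable_cst.
have m0 (K z : R) : 0 <= K -> 0 <= Num.min (z ^+ 2 / C) K by move=> K0; rewrite le_min q0.
have tot : (\int[leb]_z (z ^+ 2 / C * normal_pdf m s z)%:E = 1)%E.
  under eq_integral do rewrite mulrAC mulrC EFinM.
  rewrite ge0_integralZl//.
  - by rewrite normal_second_moment// -EFinM mulVf ?gt_eqF.
  - by apply/measurable_EFinP; apply: measurable_funM => //; exact: measurable_funX.
  - by move=> z _; rewrite lee_fin mulr_ge0 ?sqr_ge0 ?normal_pdf_ge0.
  - by rewrite lee_fin invr_ge0 ltW.
have mt : measurable_fun [set: R] (fun z : R => (z ^+ 2 / C * normal_pdf m s z)%:E).
  by apply/measurable_EFinP; exact: measurable_funM.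
have J1 K : 0 <= K -> (0 <= J K <= 1)%E.
  move=> K0; rewrite -tot; apply/andP; split.
    by apply: integral_ge0 => z _; rewrite lee_fin mulr_ge0 ?m0 ?normal_pdf_ge0.
  apply: ge0_le_integral => //.
  - by move=> z _; rewrite lee_fin mulr_ge0 ?m0 ?normal_pdf_ge0.
  - exact: mJ.
  - by move=> z _; rewrite lee_fin ler_wpM2r ?normal_pdf_ge0// ge_min lexx.
have Jle K1 K2 : 0 <= K1 -> K1 <= K2 -> (J K1 <= J K2)%E.
  move=> K10 K12; apply: ge0_le_integral => //.
  - by move=> z _; rewrite lee_fin mulr_ge0 ?m0 ?normal_pdf_ge0.
  - exact: mJ.
  - exact: mJ.
  - move=> z _; rewrite lee_fin ler_wpM2r ?normal_pdf_ge0// le_min ge_min lexx/=.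
    by rewrite ge_min K12 orbT.
have Jfin K : 0 <= K -> J K \is a fin_num.
  exact: truncated_second_moment_fin_num.
(* Monotone convergence along integer truncation levels; real levels follow because [J] is
   nondecreasing and bounded by 1. *)
have Jn : (J n%:R @[n --> \oo] --> 1)%E.
  rewrite -tot.
  pose g (n : nat) (z : measurableTypeR R) : \bar R := (Num.min (z ^+ 2 / C) n%:R * normal_pdf m s z)%:E.
  have lg z : limn (g^~ z) = (z ^+ 2 / C * normal_pdf m s z)%:E.
    apply: cvg_lim => //; apply: cvg_near_cst; near=> n; rewrite /g min_l//.
    near: n; exact: nbhs_infty_ger.
  have := @cvg_monotone_convergence _ _ _ (@lebesgue_measure R) setT measurableT g.
  under [X in _ --> X]eq_integral do rewrite lg.
  apply => //.
  - by move=> n; exact: mJ.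
  - by move=> n z _; rewrite lee_fin mulr_ge0 ?m0 ?normal_pdf_ge0.
  - move=> z _ i j ij; rewrite lee_fin ler_wpM2r ?normal_pdf_ge0// le_min ge_min lexx/=.
    by rewrite ge_min ler_nat ij orbT.
apply/cvgrPdist_le => eps eps0.
have /fine_cvgP[_ /cvgrPdist_le/(_ _ eps0)[k _ Hk]] := Jn.
have {}Hk := Hk k (leqnn k).
near=> K.
have kK : k%:R <= K by near: K; apply: nbhs_pinfty_ge; exact: num_real.
have K0 : 0 <= K by apply: le_trans kK.
rewrite -/(J K); have k0 : (0 : R) <= k%:R by [].
have := Jle _ _ k0 kK; have /andP[_] := J1 _ K0.
rewrite -(fineK (Jfin _ K0)) -(fineK (Jfin _ k0)) !lee_fin.
move: Hk; rewrite /= !ler_norml => /andP[? ?] ? ?.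
by apply/andP; split; lra.
Unshelve. all: by end_near. Qed.

(** * Regular variation of the survival function *)

Lemma cvg_near_ext {R : realType} {U : Type} (G : set_system U) {FG : Filter G}
    (f g : U -> R) (l : R) : f x @[x --> G] --> l ->
  (\forall x \near G, f x = g x) -> g x @[x --> G] --> l.
Proof.
by move=> fl fg; apply: cvg_trans fl; apply: near_eq_cvg.
Qed.

Lemma cvg_powR {R : realType} {U : Type} (G : set_system U) {FG : Filter G}
    (f : U -> R) (l a : R) : 0 < l -> f x @[x --> G] --> l ->
  f x `^ a @[x --> G] --> l `^ a.
Proof.
move=> l0 fl; apply: (@continuous_cvg _ _ _ G FG f (fun x : R => x `^ a)) => //.
by apply: (@is_derive_continuous R (fun x => x `^ a)); exact: is_derive1_powR.
Qed.

Lemma cvg_powR_pinfty {R : realType} (a : R) : 0 < a ->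
  x `^ a @[x --> +oo] --> +oo.
Proof.
move=> a0; apply/cvgryPge => M; near=> x.
have x1 : `|M| `^ a^-1 <= x by near: x; apply: nbhs_pinfty_ge; exact: num_real.
apply: (le_trans (ler_norm M)).
have -> : `|M| = (`|M| `^ a^-1) `^ a by rewrite -powRrM mulVf ?gt_eqF// powRr1.
apply: ge0_ler_powR; rewrite ?nnegrE ?powR_ge0 ?(ltW a0)//.
Unshelve. all: by end_near. Qed.

Lemma cvg_powRN_pinfty {R : realType} (a : R) : 0 < a ->
  x `^ (- a) @[x --> +oo] --> (0 : R).
Proof.
move=> a0; rewrite (_ : (fun x => _) = (fun x : R => (x `^ a)^-1)); last first.
  by apply/funext => x; rewrite powRN.
have := cvg_powR_pinfty a0 => H; apply/gtr0_cvgV0 => //.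
  near=> x; apply: powR_gt0; near: x; apply: nbhs_pinfty_gt; exact: num_real.
Unshelve. all: by end_near. Qed.

(** * Survival function and probability integral transform *)

Definition survival {R : realType} (F : R -> R) (x : R) : R := 1 - F x.

Section cdf.
Context {d : measure_display} {T : measurableType d} {R : realType}
  (P : probability T R) (Y : {RV P >-> R}) (F : R -> R) (YF : has_cdf Y F).

Lemma has_cdf_le x y : x <= y -> F x <= F y.
Proof. by move=> xy; rewrite -lee_fin -!YF; exact: cdf_nondecreasing. Qed.

Lemma has_cdf_ge0 x : 0 <= F x.
Proof. by rewrite -lee_fin -YF; exact: cdf_ge0. Qed.

Lemma has_cdf_le1 x : F x <= 1.
Proof. by rewrite -lee_fin -YF; exact: cdf_le1. Qed.

Lemma survival_le x y : x <= y -> survival F y <= survival F x.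
Proof. by move=> xy; rewrite lerD2l lerN2 has_cdf_le. Qed.

Lemma survival_ge0 x : 0 <= survival F x.
Proof. by rewrite subr_ge0 has_cdf_le1. Qed.

Lemma survival_le1 x : survival F x <= 1.
Proof. by rewrite lerBlDr lerDl has_cdf_ge0. Qed.

Lemma cdf_reach v : continuous F -> 0 < v < 1 -> exists x, F x = v.
Proof.
move=> cF /andP[v0 v1].
have E : cdf (P := P) Y = EFin \o F by apply/funext => x; exact: YF.
have /fine_cvgP[_ H1] := cvg_cdfy1 Y; have /fine_cvgP[_ H0] := cvg_cdfNy0 Y.
rewrite E in H1 H0.
have [b bv] : exists b, v < F b.
  suff : \forall b \near +oo, v < F b by exact: filter_ex.
  exact: (cvgr_gt _ H1).
have [a av] : exists a, F a < v.
  suff : \forall a \near -oo, F a < v by exact: filter_ex.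
  exact: (cvgr_lt _ H0).
have ab : a <= b.
  by rewrite leNgt; apply/negP => /ltW /has_cdf_le; rewrite leNgt (lt_trans av).
have [|c _ cv] := @IVT R F a b v ab (continuous_subspaceT cF).
  by rewrite ge_min (ltW av)/= le_max (ltW bv) orbT.
by exists c.
Qed.

(** The variable 1 - F(Y) is uniform. F may be flat at the level q = 1 - c, so a point x with F x =
    q yields only the lower bound for P(F(Y) <= q); the upper bound comes from points with F x
    slightly above q. *)
Lemma prob_survival_lt c : continuous F -> 0 <= c <= 1 ->
  P [set w | survival F (Y w) < c] = c%:E.
Proof.
move=> cF /andP[c0 c1].
have mF : measurable_fun [set: T] (fun w => F (Y w)).
  by apply: (measurableT_comp (continuous_measurable_fun cF)).
pose q := 1 - c; set B := [set w | F (Y w) <= q].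
have mB : measurable B by apply: measurable_set_le => //; exact: measurable_cst.
have -> : [set w | survival F (Y w) < c] = ~` B.
  rewrite predeqE => w; rewrite /B/= /survival /q; split.
    by move=> H; apply/negP; rewrite -ltNge; lra.
  by move/negP; rewrite -ltNge; lra.
have mY x : measurable [set w | Y w <= x].
  by apply: measurable_set_le => //; exact: measurable_cst.
have PY x : P [set w | Y w <= x] = (F x)%:E.
  by rewrite -YF /cdf /distribution /pushforward; congr (P _); rewrite predeqE => w /=; rewrite in_itv.
rewrite probability_setC//.
suff -> : P B = q%:E by rewrite -EFinB /q; congr EFin; ring.
have fB : P B \is a fin_num by rewrite fin_num_measure.
apply/eqP; rewrite eq_le; apply/andP; split.
- have [q1|q1] := leP 1 q; first by apply: le_trans (probability_le1 _ _) _; rewrite ?lee_fin.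
  rewrite -(fineK fB) lee_fin; apply/ler_addgt0Pr => e e0.
  (* A level above q by at most e that still lies below 1, hence is attained by F. *)
  pose v := q + Num.min e ((1 - q) / 2).
  have hv : q < v < 1.
    rewrite /v ltrDl lt_min e0/= divr_gt0// ?subr_gt0//=.
    have : Num.min e ((1 - q) / 2) <= (1 - q) / 2 by rewrite ge_min lexx orbT.
    by lra.
  have q0 : 0 <= q by rewrite /q; lra.
  have [|x xv] := @cdf_reach v cF; first by lra.
  apply: (@le_trans _ _ v); last first.
    by rewrite lerD2l ge_min lexx.
  rewrite -lee_fin fineK// -xv -PY; apply: le_measure; rewrite ?inE//.
  move=> w; rewrite /B/= => Fq; rewrite leNgt; apply/negP => /ltW /has_cdf_le.
  by rewrite xv; lra.
- have [q0|q0] := leP q 0; first by apply: le_trans (measure_ge0 _ _); rewrite lee_fin.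
  have [q1|q1] := leP 1 q.
    rewrite (_ : B = setT) ?probability_setT ?lee_fin ?/q; first by lra.
    by rewrite predeqE => w; rewrite /B/=; split => // _; exact: le_trans (has_cdf_le1 _) q1.
  have [|x xv] := @cdf_reach q cF; first by rewrite q0.
  rewrite -xv -PY; apply: le_measure; rewrite ?inE//.
  by move=> w; rewrite /B/= -xv => /has_cdf_le.
Qed.

Lemma prob_survival_lt_min c : continuous F -> 0 <= c ->
  P [set w | survival F (Y w) < c] = (Num.min c 1)%:E.
Proof.
move=> cF c0; have [c1|c1] := leP c 1; first by rewrite prob_survival_lt// c0.
rewrite (_ : [set w | _] = setT) ?probability_setT//.
by rewrite predeqE => w /=; split => // _; apply: le_lt_trans c1; exact: survival_le1.
Qed.

Lemma log_survival_exponential t : continuous F -> (forall x, 0 < survival F x) ->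
  0 <= t -> P [set w | t < - ln (survival F (Y w))] = (expR (- t))%:E.
Proof.
move=> cF S0 t0; rewrite -prob_survival_lt//; last first.
  by rewrite expR_ge0/= -expR0 ler_expR; lra.
congr (P _); rewrite predeqE => w /=.
rewrite -{2}(lnK (S0 (Y w))) ltr_expR; split; lra.
Qed.

End cdf.

(** * Consequences of the Hall condition *)

Lemma hall_survival {R : realType} (F : R -> R) (alpha beta A B : R) :
  hall_class F alpha beta A B ->
  x `^ beta * (survival F x * x `^ alpha / A - 1) @[x --> +oo] --> B.
Proof.
move=> [a0 b2 A0 B0 H].
have H1 : B + A^-1 * (x `^ (alpha + beta) *
    (1 - F x - A * x `^ (- alpha) * (1 + B * x `^ (- beta)))) @[x --> +oo] --> B + A^-1 * 0.
  by apply: cvgD; [exact: cvg_cst|apply: cvgM H; exact: cvg_cst].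
rewrite mulr0 addr0 in H1; apply: (cvg_near_ext H1); near=> x.
have x0 : 0 < x by near: x; apply: nbhs_pinfty_gt; exact: num_real.
rewrite /survival !powRN powRD; last by rewrite (gt_eqF x0) implybT.
have xa : x `^ alpha != 0 by rewrite gt_eqF ?powR_gt0.
have xb : x `^ beta != 0 by rewrite gt_eqF ?powR_gt0.
by field; rewrite xa xb gt_eqF.
Unshelve. all: by end_near. Qed.

Lemma hall_survival_lim {R : realType} (F : R -> R) (alpha beta A B : R) :
  hall_class F alpha beta A B ->
  survival F x * x `^ alpha @[x --> +oo] --> A.
Proof.
move=> FH; have H := hall_survival FH; have [a0 b2 A0 B0 _] := FH.
have b0 : 0 < beta by lra.
have H2 : x `^ (- beta) * (x `^ beta * (survival F x * x `^ alpha / A - 1)) @[x --> +oo] --> 0 * B.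
  by apply: cvgM H; exact: cvg_powRN_pinfty.
have {}H2 : A * (x `^ (- beta) * (x `^ beta * (survival F x * x `^ alpha / A - 1)) + 1)
    @[x --> +oo] --> A * (0 * B + 1).
  by apply: cvgM; [exact: cvg_cst|apply: cvgD H2 _; exact: cvg_cst].
rewrite mul0r add0r mulr1 in H2; apply: (cvg_near_ext H2); near=> x.
have x0 : 0 < x by near: x; apply: nbhs_pinfty_gt; exact: num_real.
have xb : x `^ beta != 0 by rewrite gt_eqF ?powR_gt0.
by rewrite powRN; field; rewrite xb gt_eqF.
Unshelve. all: by end_near. Qed.

(** The tail is positive far out, being equivalent to A x^(-alpha), and it decreases. Hence the
    logarithm of the survival function is meaningful everywhere. *)
Lemma hall_survival_gt0 {d : measure_display} {T : measurableType d} {R : realType}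
    (P : probability T R) (Y : {RV P >-> R}) (F : R -> R) (alpha beta A B : R) :
  has_cdf Y F -> hall_class F alpha beta A B -> forall x, 0 < survival F x.
Proof.
move=> YF FH x; have H := hall_survival_lim FH; have [_ _ A0 _ _] := FH.
have E : \forall y \near +oo, 0 < survival F y * y `^ alpha by exact: (cvgr_gt _ H).
have [y [y0 xy]] : exists y, 0 < survival F y * y `^ alpha /\ x <= y.
  suff : \forall y \near +oo, 0 < survival F y * y `^ alpha /\ x <= y by exact: filter_ex.
  near=> y; split; first by near: y.
  by near: y; apply: nbhs_pinfty_ge; exact: num_real.
apply: lt_le_trans (survival_le YF xy).
rewrite lt_neqAle (survival_ge0 YF) andbT eq_sym; apply/eqP => S0.
by move: y0; rewrite S0 mul0r ltxx.
Unshelve. all: by end_near. Qed.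

(** Taking logarithms of S(x) x^alpha/A = 1 + y with x^beta y tending to B gives the numerator. The
    scale x^(-beta) is then expressed through S(x), using that S(x) x^alpha tends to A; this
    produces the power of A. *)
Lemma hall_log_expansion {R : realType} (F : R -> R) (alpha beta A B : R) :
  hall_class F alpha beta A B ->
  (alpha * ln x + ln (survival F x) - ln A) / survival F x `^ (beta / alpha)
    @[x --> +oo] --> B * A `^ (- (beta / alpha)).
Proof.
move=> FH; have [a0 b2 A0 B0 _] := FH.
have H := hall_survival FH; have HA := hall_survival_lim FH.
have b0 : 0 < beta by lra.
pose y (x : R) := survival F x * x `^ alpha / A - 1.
have y0 : y x @[x --> +oo] --> (0 : R).
  rewrite -[X in _ --> X](subrr (A / A)) {2}divff ?gt_eqF//.
  apply: cvgB; last exact: cvg_cst.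
  by apply: cvgM => //; exact: cvg_cst.
have L : x `^ beta * ln (1 + y x) @[x --> +oo] --> B.
  (* The enclosure y/(1 + y) <= ln (1 + y) <= y; its left half is the right half applied to 1/(1 +
     y). *)
  have lo : x `^ beta * y x / (1 + y x) @[x --> +oo] --> B.
    rewrite -[X in _ --> X]divr1 -[X in _ / X]addr0; apply: cvgM => //.
    apply: cvgV; first by rewrite addr0.
    by apply: cvgD => //; exact: cvg_cst.
  apply: (squeeze_cvgr _ lo H); near=> x.
  have y1 : -1 < y x by near: x; apply: (cvgr_gt _ y0); lra.
  have x0 : 0 <= x `^ beta by exact: powR_ge0.
  apply/andP; split; last by rewrite ler_wpM2l// le_ln1Dx.
  rewrite -mulrA ler_wpM2l//.
  have p0 : 0 < 1 + y x by lra.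
  have i0 : 0 < (1 + y x)^-1 by rewrite invr_gt0.
  have : ln (1 + ((1 + y x)^-1 - 1)) <= (1 + y x)^-1 - 1 by apply: le_ln1Dx; lra.
  rewrite addrCA subrr addr0 lnV ?posrE// => h.
  have -> : y x / (1 + y x) = 1 - (1 + y x)^-1 by field; rewrite gt_eqF.
  by lra.
have Q : (survival F x * x `^ alpha) `^ (- (beta / alpha)) @[x --> +oo] --> A `^ (- (beta / alpha)).
  exact: cvg_powR.
apply: (cvg_near_ext (cvgM L Q)); near=> x.
have x0 : 0 < x by near: x; apply: nbhs_pinfty_gt; exact: num_real.
have sx : 0 < survival F x * x `^ alpha by near: x; exact: (cvgr_gt _ HA).
have S0 : 0 < survival F x by move: sx; rewrite pmulr_lgt0// powR_gt0.
have xa : 0 < x `^ alpha by rewrite powR_gt0.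
have -> : (survival F x * x `^ alpha) `^ (- (beta / alpha)) =
    (survival F x `^ (beta / alpha))^-1 * (x `^ beta)^-1.
  rewrite powRM ?(ltW S0) ?(ltW xa)// -powRrM !powRN mulrN powRN.
  by rewrite [alpha * _]mulrC divfK ?gt_eqF.
have -> : ln (1 + y x) = alpha * ln x + ln (survival F x) - ln A.
  rewrite /y addrC subrK ln_div ?posrE// lnM ?posrE// ln_powR; ring.
field.
by rewrite !gt_eqF ?powR_gt0.
Unshelve. all: by end_near. Qed.

(** * Mean excess *)

Lemma ge0_integral_shift {R : realType} (f : R -> \bar R) (u : R) :
  measurable_fun [set: R] f -> (forall y, 0 <= f y)%E ->
  (\int[leb]_(x in `[0%R, +oo[) f (x + u)%R =
   \int[leb]_(y in `[u, +oo[) f y)%E.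
Proof.
move=> mf f0.
pose g0 (x : measurableTypeR R) : measurableTypeR R := x + u.
have mg0 : measurable_fun setT g0.
  move=> mT A mA.
  have mm : measurable_fun [set: R] (fun x : R => x + u) by exact: measurable_funD.
  exact: (mm mT A mA).
pose g : {mfun measurableTypeR R >-> measurableTypeR R} :=
  HB.pack g0 (isMeasurableFun.Build _ _ _ _ g0 mg0).
have pre a b : g0 @^-1` `]a, b]%classic = `](a - u), (b - u)]%classic.
  by rewrite predeqE => x; rewrite /g0 /= !in_itv/= ltrBlDr lerBrDr.
have E A : measurable A -> pushforward (@lebesgue_measure R) g A = lebesgue_measure A.
  move=> mA; apply/esym.
  apply: (@lebesgue_measure_unique R (pushforward (@lebesgue_measure R) g)) => // _ [[a b]] _ <-.
  change (lebesgue_measure `]a, b]%classic = lebesgue_measure (g0 @^-1` `]a, b]%classic)).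
  rewrite pre !lebesgue_measure_itv/= !lte_fin ltrD2r.
  by case: ifP => // _; rewrite -!EFinB; congr EFin; ring.
have -> : `[0%R, +oo[%classic = g @^-1` `[u, +oo[%classic.
  by rewrite predeqE => x /=; rewrite !in_itv/= !andbT /g0 lerDr.
rewrite -(@ge0_integral_pushforward _ _ _ _ R g mg0 lebesgue_measure _ f)//.
- by apply: eq_measure_integral => A mA _; exact: E.
- exact: measurable_funTS.
Qed.

Lemma expectation_density {d : measure_display} {T : measurableType d}
    {R : realType} (P : probability T R) (Y : {RV P >-> R}) (f : R -> R)
    (h : R -> R) : has_density Y f ->
  measurable_fun [set: R] h -> (forall y, 0 <= h y) ->
  (\int[P]_w (h (Y w))%:E < +oo)%E ->
  (\int[P]_w (h (Y w))%:E = \int[leb]_y (h y * f y)%:E)%E.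
Proof.
move=> [mf f0 Yf] mh h0 hfin.
pose Y0 : T -> measurableTypeR R := Y.
have mY0 : measurable_fun setT Y0.
  by move=> mT A mA; have mY := @measurable_funP _ _ _ _ setT Y; exact: (mY mT A mA).
pose Y' : {RV P >-> measurableTypeR R} := HB.pack Y0 (isMeasurableFun.Build _ _ _ _ Y0 mY0).
pose nu : probability (measurableTypeR R) R := distribution P Y'.
have mhE : measurable_fun [set: R] (fun y => (h y)%:E) by exact/measurable_EFinP.
have E : (\int[P]_w (h (Y w))%:E = \int[nu]_y (h y)%:E)%E.
  by rewrite ge0_integral_distribution// => y; rewrite lee_fin.
rewrite E (@integral_density _ nu f (fun y => (h y)%:E) setT)//.
apply/integrableP; split => //.
by under eq_integral do rewrite abse_EFin ger0_norm//; rewrite -E.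
Qed.

Lemma integral_powR_tail {R : realType} (a u : R) : 1 < a -> 0 < u ->
  (\int[leb]_(y in `[u, +oo[) (y `^ (- a))%:E =
   (u `^ (1 - a) / (a - 1))%:E)%E.
Proof.
move=> a1 u0.
pose F (y : R) : R := (1 - a)^-1 * y `^ (1 - a).
have a10 : 1 - a != 0 by lra.
have dF (y : R) : 0 < y -> is_derive y 1 F (y `^ (- a)).
  move=> y0; have := is_deriveM (is_derive_cst (1 - a)^-1 y 1) (is_derive1_powR (1 - a) y0).
  move/is_derive_eq; apply; rewrite /= ?fctE /GRing.scale/= mulr0 addr0.
  by rewrite mulrA mulVf// mul1r; congr (_ `^ _); ring.
rewrite (@ge0_continuous_FTC2y _ _ F _ 0).
- rewrite -EFinB; congr EFin; rewrite /F; field; lra.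
- by move=> y _; exact: powR_ge0.
- apply: continuous_in_subspaceT => y; rewrite inE/= in_itv/= andbT => uy.
  apply: (@is_derive_continuous R (fun x => x `^ (- a))).
  by apply: is_derive1_powR; exact: lt_le_trans uy.
- rewrite -[X in _ --> X](mulr0 (1 - a)^-1); apply: cvgM; first exact: cvg_cst.
  rewrite (_ : 1 - a = - (a - 1)); last by ring.
  by apply: cvg_powRN_pinfty; lra.
- by move=> y uy; have [] := dF y (lt_trans u0 uy).
- by apply: cvg_at_right_filter; exact: (is_derive_continuous (dF u u0)).
- move=> y; rewrite in_itv/= andbT => uy; rewrite derive1E.
  by have [_ ->] := dF y (lt_trans u0 uy).
Qed.

(** The constant |A B| absorbs the second-order term, and the added 1 absorbs the vanishing
    remainder. *)
Lemma hall_survival_bound {R : realType} (F : R -> R) (alpha beta A B : R) :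
  hall_class F alpha beta A B -> exists C : R, 0 < C /\
  \forall x \near +oo, `|survival F x - A * x `^ (- alpha)| <= C * x `^ (- (alpha + beta)).
Proof.
move=> FH; have [a0 b2 A0 B0 H] := FH; exists (`|A * B| + 1); split.
  by rewrite ltr_wpDl.
have H1 : \forall x \near +oo, `|x `^ (alpha + beta) *
        (1 - F x - A * x `^ (- alpha) * (1 + B * x `^ (- beta)))| < 1.
  by have /cvgr0Pnorm_lt/(_ _ ltr01) := H.
near=> x.
have x0 : 0 < x by near: x; apply: nbhs_pinfty_gt; exact: num_real.
have h : `|x `^ (alpha + beta) *
        (1 - F x - A * x `^ (- alpha) * (1 + B * x `^ (- beta)))| < 1 by near: x.
rewrite (powRN x (alpha + beta)) ler_pdivlMr ?powR_gt0//.
have xab : 0 <= x `^ (alpha + beta) by exact: powR_ge0.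
rewrite -(ger0_norm xab) -normrM.
have -> : (survival F x - A * x `^ (- alpha)) * x `^ (alpha + beta) =
   x `^ (alpha + beta) * (1 - F x - A * x `^ (- alpha) * (1 + B * x `^ (- beta))) + A * B.
  rewrite /survival (_ : x `^ (alpha + beta) = x `^ alpha * x `^ beta); last first.
    by rewrite powRD// (gt_eqF x0) implybT.
  rewrite !powRN; field.
  by rewrite !gt_eqF ?powR_gt0.
by apply: (le_trans (ler_normD _ _)); rewrite addrC lerD2l ltW.
Unshelve. all: by end_near. Qed.

(* Integration by parts, in layer-cake form. *)
Lemma mean_excess_survival {d : measure_display} {T : measurableType d}
    {R : realType} (P : probability T R) (Y : {RV P >-> R}) (F f : R -> R) (u : R) :
  has_cdf Y F -> has_density Y f -> 0 < survival F u ->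
  (\int[leb]_(y in `[u, +oo[) (survival F y)%:E < +oo)%E ->
  mean_excess F f u =
    fine (\int[leb]_(y in `[u, +oo[) (survival F y)%:E)%E / survival F u.
Proof.
move=> YF Yf Su Jfin; have [mf f0 _] := Yf.
have SE y : (survival F y)%:E = ccdf (P := P) Y y.
  by rewrite ccdf_1_cdf YF.
have mS : measurable_fun [set: R] (fun y => (survival F y)%:E).
  by rewrite (funext SE); exact: ccdf_measurable.
have S0 := survival_ge0 YF.
pose h (y : R) := Num.max (y - u) 0.
have h0 y : 0 <= h y by rewrite le_max lexx orbT.
have mh : measurable_fun [set: R] h.
  by apply: measurable_maxr; [exact: measurable_funB|exact: measurable_cst].
have mhY : measurable_fun [set: T] (fun w => h (Y w)) by exact: measurableT_comp.
pose M : {RV P >-> R} := HB.pack (fun w => h (Y w)) (isMeasurableFun.Build _ _ _ _ (fun w => h (Y w)) mhY).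
(* For z >= 0 the positive part of Y - u exceeds z exactly when Y exceeds z + u, so the layer-cake
   integral is a shifted tail integral. *)
have J1 : (\int[P]_w (h (Y w))%:E = \int[leb]_(y in `[u, +oo[) (survival F y)%:E)%E.
  have := @ge0_expectation_ccdf _ _ _ P M (fun w => h0 _).
  rewrite unlock => ->; rewrite -ge0_integral_shift//.
  apply: eq_integral => z; rewrite inE/= in_itv/= andbT => z0.
  rewrite SE /ccdf /distribution /pushforward; congr (P _).
  rewrite predeqE => w /=; rewrite !in_itv/= !andbT /h lt_max [(z < 0)%R]ltNge z0 orbF.
  by rewrite ltrBrDr.
have J2 := expectation_density Yf mh h0.
rewrite J1 in J2; have {}J2 := J2 Jfin; rewrite J2.
have mhf : measurable_fun [set: R] (fun y => (h y * f y)%:E).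
  by apply/measurable_EFinP; exact: measurable_funM.
have J3 : (\int[leb]_y (h y * f y)%:E =
    \int[leb]_(x in `[0%R, +oo[) (x * f (x + u))%:E)%E.
  transitivity (\int[leb]_(x in `[u, +oo[) (h x * f x)%:E)%E.
    rewrite [RHS]integral_mkcond; apply: eq_integral => y _; rewrite patchE.
    case: ifPn => //; rewrite notin_setE/= in_itv/= andbT => /negP; rewrite -ltNge => yu.
    by rewrite /h max_r ?mul0r// subr_le0 ltW.
  rewrite -ge0_integral_shift//; last by move=> y; rewrite lee_fin mulr_ge0.
  apply: eq_integral => x; rewrite inE/= in_itv/= andbT => x0.
  by rewrite /h addrK max_l.
have mshift : measurable_fun [set: R] (fun x => (x * f (x + u))%:E).
  apply/measurable_EFinP; apply: measurable_funM => //.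
  by apply: (measurableT_comp mf); exact: measurable_funD.
rewrite /mean_excess /Rintegral J3.
under eq_integral do rewrite mulrA mulrC EFinM.
rewrite ge0_integralZl//.
- rewrite fineM//; first by rewrite mulrC.
  rewrite -J3 -J2 ge0_fin_numE//; apply: integral_ge0 => y _; by rewrite lee_fin.
- exact: measurable_funTS.
- by move=> x; rewrite /= in_itv/= andbT => x0; rewrite lee_fin mulr_ge0.
- by rewrite lee_fin invr_ge0; exact: ltW.
Qed.

(** With e(u) = J/S(u), J being the tail integral of S, both J/u and S(u)/(alpha - 1) equal A
    u^(-alpha)/(alpha - 1) up to O(u^(-alpha - beta)). Dividing their difference by S(u) leaves
    O(u^(-beta)). *)
Lemma mean_excess_hall {d : measure_display} {T : measurableType d}
    {R : realType} (P : probability T R) (Y : {RV P >-> R}) (F f : R -> R)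
    (alpha beta A B : R) :
  has_cdf Y F -> has_density Y f -> hall_class F alpha beta A B -> 1 < alpha ->
  exists K : R, \forall u \near +oo,
    `|mean_excess F f u / u - (alpha - 1)^-1| <= K * u `^ (- beta).
Proof.
move=> YF Yf FH a1; have [a0 b2 A0 B0 _] := FH.
have [C [C0 [M [_ HM]]]] := hall_survival_bound FH.
have HA := hall_survival_lim FH.
have S0 := hall_survival_gt0 YF FH.
have mS : measurable_fun [set: R] (fun y => (survival F y)%:E).
  rewrite (_ : (fun y => _) = ccdf (P := P) Y); first exact: ccdf_measurable.
  by apply/funext => y; rewrite ccdf_1_cdf YF.
(* The factor c comes from integrating y^(-alpha-beta), the other summand from the error of S(u)
   itself; 2/A below comes from S(u) >= (A/2) u^(-alpha). *)
pose c := (alpha + beta - 1)^-1; pose K0 := C * (c + (alpha - 1)^-1).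
have c0 : 0 < c by rewrite invr_gt0; lra.
exists (2 / A * K0); near=> u.
have u0 : 0 < u by near: u; apply: nbhs_pinfty_gt; exact: num_real.
have uM : M < u by near: u; apply: nbhs_pinfty_gt; exact: num_real.
have SA : A / 2 < survival F u * u `^ alpha.
  by near: u; apply: (cvgr_gt _ HA); lra.
have bnd y : u <= y -> `|survival F y - A * y `^ (- alpha)| <= C * y `^ (- (alpha + beta)).
  by move=> uy; apply: HM; exact: lt_le_trans uy.
set J := (\int[leb]_(y in `[u, +oo[) (survival F y)%:E)%E.
have mp (k a : R) : measurable_fun `[u, +oo[ (fun y : R => (k * y `^ a)%:E).
  by apply/measurable_funTS/measurable_EFinP; apply: measurable_funM => //; exact: measurable_powR.
have ip (k a : R) : 1 < a -> 0 <= k ->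
    (\int[leb]_(y in `[u, +oo[) (k * y `^ (- a))%:E = (k * (u `^ (1 - a) / (a - 1)))%:E)%E.
  move=> a'1 k0; under eq_integral do rewrite EFinM.
  rewrite ge0_integralZl//.
  - by rewrite integral_powR_tail// -EFinM.
  - by apply/measurable_funTS/measurable_EFinP; exact: measurable_powR.
  - by move=> y _; rewrite lee_fin powR_ge0.
set I1 := A * (u `^ (1 - alpha) / (alpha - 1)).
set I2 := C * (u `^ (1 - (alpha + beta)) / (alpha + beta - 1)).
have EI1 := ip A alpha a1 (ltW A0); have EI2 := ip C (alpha + beta) _ (ltW C0).
have ab1 : 1 < alpha + beta by lra.
have {}EI2 := EI2 ab1.
have Sg y : (0 <= (survival F y)%:E)%E by rewrite lee_fin ltW.
have U : (J <= (I1 + I2)%:E)%E.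
  rewrite EFinD -EI1 -EI2 -ge0_integralD//.
  - apply: ge0_le_integral => //.
    + exact: measurable_funTS.
    + by apply: emeasurable_funD; exact: mp.
    + move=> y; rewrite /= in_itv/= andbT => /bnd; rewrite ler_norml lee_fin; lra.
  - by move=> y _; rewrite lee_fin mulr_ge0 ?powR_ge0// ltW.
  - exact: mp.
  - by move=> y _; rewrite lee_fin mulr_ge0 ?powR_ge0// ltW.
  - exact: mp.
(* The error integral is added to [J] instead of being subtracted from [I1], so that all integrands
   stay nonnegative. *)
have L : (I1%:E <= J + I2%:E)%E.
  rewrite -EI1 -EI2 -ge0_integralD//.
  - apply: ge0_le_integral => //.
    + by move=> y _; rewrite lee_fin mulr_ge0 ?powR_ge0// ltW.
    + exact: mp.
    + by apply: emeasurable_funD; [exact: measurable_funTS|exact: mp].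
    + move=> y; rewrite /= in_itv/= andbT => /bnd; rewrite ler_norml lee_fin; lra.
  - exact: measurable_funTS.
  - by move=> y _; rewrite lee_fin mulr_ge0 ?powR_ge0// ltW.
  - exact: mp.
have Jlt : (J < +oo)%E by apply: le_lt_trans U _; exact: ltry.
have J0 : (0 <= J)%E by apply: integral_ge0.
rewrite (mean_excess_survival YF Yf (S0 u) Jlt) -/J.
have Jf : J \is a fin_num by rewrite ge0_fin_numE.
set j := fine J; have jE : J = j%:E by rewrite /j fineK.
rewrite jE -EFinD !lee_fin in U L.
have /bnd := lexx u; set S := survival F u.
set p := u `^ (- alpha); set q := u `^ (- beta).
have pq : u `^ (- (alpha + beta)) = p * q.
  by rewrite opprD powRD// (gt_eqF u0) implybT.
have p0 : 0 < p by exact: powR_gt0.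
have q0 : 0 < q by exact: powR_gt0.
have up : u `^ (1 - alpha) = u * p.
  by rewrite powRD ?powRr1// ?(gt_eqF u0) ?implybT// ltW.
have upq : u `^ (1 - (alpha + beta)) = u * (p * q).
  by rewrite -pq powRD ?powRr1// ?(gt_eqF u0) ?implybT// ltW.
rewrite pq => SB.
have Sp : A / 2 * p < S.
  by rewrite /p powRN ltr_pdivrMr ?powR_gt0.
have Sgt0 : 0 < S by exact: S0.
have -> : j / S / u - (alpha - 1)^-1 = (j / u - S / (alpha - 1)) / S.
  by field; rewrite !gt_eqF// subr_gt0.
rewrite normrM (ger0_norm (_ : 0 <= S^-1)) ?invr_ge0 ?(ltW Sgt0)// ler_pdivrMr//.
have key : `|j / u - S / (alpha - 1)| <= K0 * (p * q).
  have j1 : `|j / u - A * p / (alpha - 1)| <= C * c * (p * q).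
    have -> : j / u - A * p / (alpha - 1) = (j - I1) / u.
      by rewrite /I1 up; field; rewrite !gt_eqF// subr_gt0.
    rewrite normrM (ger0_norm (_ : 0 <= u^-1)) ?invr_ge0 ?(ltW u0)// ler_pdivrMr//.
    have -> : C * c * (p * q) * u = I2 by rewrite /I2 upq /c; ring.
    move: U L; clearbody j I1 I2; clear; rewrite ler_norml => U L.
    by apply/andP; split; lra.
  have j2 : `|A * p / (alpha - 1) - S / (alpha - 1)| <= C * (alpha - 1)^-1 * (p * q).
    rewrite -mulrBl normrM (ger0_norm (_ : 0 <= (alpha - 1)^-1)) ?invr_ge0 ?subr_ge0 ?(ltW a1)//.
    rewrite -[leRHS]mulrA [_^-1 * _]mulrC mulrA ler_wpM2r ?invr_ge0 ?subr_ge0 ?(ltW a1)//.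
    by rewrite distrC.
  have := ler_normD (j / u - A * p / (alpha - 1)) (A * p / (alpha - 1) - S / (alpha - 1)).
  rewrite addrA subrK => /le_trans; apply.
  by apply: le_trans (lerD j1 j2) _; rewrite /K0; lra.
apply: (le_trans key).
have K00 : 0 <= K0 by rewrite mulr_ge0 ?(ltW C0)// addr_ge0 ?(ltW c0)// invr_ge0; lra.
have -> : K0 * (p * q) = 2 / A * K0 * q * (A / 2 * p) by field; rewrite gt_eqF.
apply: ler_wpM2l; last exact: ltW.
by rewrite mulr_ge0 ?(ltW q0)// mulr_ge0// divr_ge0// ltW.
Unshelve. all: by end_near. Qed.

(** * Hill estimator *)

Lemma order_stat_le {T : Type} {R : realType} (X : nat -> T -> R)
    (n k l : nat) (w : T) : (0 < k <= l)%N -> (l <= n)%N ->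
  order_stat X n k w <= order_stat X n l w.
Proof.
move=> /andP[k0 kl] ln; rewrite /order_stat; set s := sort _ _.
have sz : size s = n by rewrite size_sort size_map size_iota.
have ss : sorted <=%O s by apply: sort_sorted; exact: le_total.
by apply: (sorted_leq_nth le_trans le_refl 0 ss); rewrite ?inE ?sz; lia.
Qed.

(** Averages the expansion of alpha ln x over the top values minus its value at the threshold. The
    constant a cancels, and the term in D changes sign since q decreases. Each remainder is at most
    eps q at the threshold, and every difference has two of them. *)
Lemma hill_expansion {T : Type} {R : realType} (X : nat -> T -> R)
    (phi q : R -> R) (n r : nat) (alpha a D eps M : R) (w : T) :
  (forall x y, x <= y -> phi x <= phi y) ->
  (forall x y, x <= y -> q y <= q x) ->
  (forall x, M <= x -> `|alpha * ln x - phi x - a - D * q x| <= eps * q x) ->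
  0 <= eps -> (0 < r < n)%N -> M <= order_stat X n (n - r) w ->
  `|alpha * (hill X n r w)^-1 -
     (r%:R^-1 * exceed_sum (fun i w => phi (X i w)) (iota 0 n) (phi (order_stat X n (n - r) w)) w
      - D * (r%:R^-1 * \sum_(i <- iota 0 n) Num.max (q (order_stat X n (n - r) w) - q (X i w)) 0))|
  <= 2 * eps * q (order_stat X n (n - r) w).
Proof.
move=> phile qle Hexp eps0 /andP[r0 rn] Mt; rewrite /hill invrK.
have rR : (0 : R) < r%:R by rewrite ltr0n.
set t := order_stat X n (n - r) w in Mt *.
pose Y j := order_stat X n (n - j + 1) w.
have tY j : (1 <= j < r.+1)%N -> t <= Y j.
  by move=> /andP[j1 jr]; apply: order_stat_le; lia.
have Sphi := @sum_top _ _ X n r w phi rn phile.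
have Sq := @sum_top _ _ X n r w (fun x => - q x) rn.
rewrite /exceed_sum -Sphi.
have -> : \sum_(i <- iota 0 n) Num.max (q t - q (X i w)) 0 =
    \sum_(1 <= j < r.+1) (q t - q (Y j)).
  transitivity (\sum_(i <- iota 0 n) Num.max (- q (X i w) - - q t) 0).
    by apply: eq_bigr => i _; rewrite opprK addrC.
  rewrite -Sq; last by move=> x y xy; rewrite lerN2 qle.
  by apply: eq_bigr => j _; rewrite opprK addrC.
pose rho x := alpha * ln x - phi x - a - D * q x.
have cst (c : R) : \sum_(1 <= j < r.+1) c = r%:R * c.
  by rewrite big_const_nat subn1/= iter_addr_0 mulr_natl.
have -> : alpha * (r%:R^-1 * (\sum_(1 <= j < r.+1) ln (order_stat X n (n - j + 1) w)) - ln t) -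
    (r%:R^-1 * \sum_(1 <= j < r.+1) (phi (order_stat X n (n - j + 1) w) - phi t) -
     D * (r%:R^-1 * \sum_(1 <= j < r.+1) (q t - q (Y j)))) =
    r%:R^-1 * \sum_(1 <= j < r.+1) (rho (Y j) - rho t).
  have -> : \sum_(1 <= j < r.+1) (rho (Y j) - rho t) =
     alpha * \sum_(1 <= j < r.+1) ln (Y j) - r%:R * (alpha * ln t)
     - \sum_(1 <= j < r.+1) (phi (Y j) - phi t) + D * \sum_(1 <= j < r.+1) (q t - q (Y j)).
    rewrite -cst !mulr_sumr -!sumrB -big_split/=; apply: eq_bigr => j _.
    by rewrite /rho; ring.
  by rewrite -/Y; field; rewrite gt_eqF.
rewrite normrM gtr0_norm ?invr_gt0// ler_pdivrMl//.
have rhob x : t <= x -> `|rho x| <= eps * q t.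
  move=> tx; apply: (le_trans (Hexp _ (le_trans Mt tx))).
  by rewrite ler_wpM2l// qle.
apply: (le_trans (ler_norm_sum _ _ _)).
rewrite -cst big_nat [leRHS]big_nat; apply: ler_sum => j jr.
have := rhob _ (tY _ jr); have := rhob _ (lexx t).
by move=> h1 h2; apply: (le_trans (ler_normB _ _)); lra.
Qed.

Lemma measurable_survival {R : realType} (F : R -> R) :
  continuous F -> measurable_fun [set: R] (survival F).
Proof.
move=> cF; apply: measurable_funB; first exact: measurable_cst.
exact: continuous_measurable_fun.
Qed.

(** With U = 1 - F(Y) uniform this is the integral of 1 - (v/c)^p over [0, c]. It is computed
    through the exponential variable -ln U, whose integration formula is already available. *)
Lemma survival_power_expectation {d : measure_display} {T : measurableType d}
    {R : realType} (P : probability T R) (Y : {RV P >-> R}) (F : R -> R) (c p : R) :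
  has_cdf Y F -> continuous F -> (forall x, 0 < survival F x) ->
  0 < c <= 1 -> 0 < p ->
  (\int[P]_w (Num.max (1 - (survival F (Y w) / c) `^ p) 0)%:E = (c * (p / (1 + p)))%:E)%E.
Proof.
move=> YF cF S0 /andP[c0 c1] p0.
have mS := measurable_survival cF.
pose xi0 w := - ln (survival F (Y w)).
have mxi0 : measurable_fun [set: T] xi0.
  apply: measurableT_comp => //; apply: measurableT_comp; first exact: measurable_ln.
  exact: measurableT_comp.
pose xi : {RV P >-> R} := HB.pack xi0 (isMeasurableFun.Build _ _ _ _ xi0 mxi0).
pose L := - ln c.
have cE : c = expR (- L) by rewrite /L opprK lnK.
have L0 : 0 <= L by rewrite /L oppr_ge0 ln_le0.
pose f (y : R) : R := Num.max (1 - expR (p * (L - y))) 0.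
have ecp : continuous (fun y : R => expR (p * (L - y))).
  move=> y; apply: (@continuous_comp _ _ _ (fun y : R => p * (L - y)) expR).
    by apply: cvgM; [exact: cvg_cst|apply: cvgB; [exact: cvg_cst|exact: cvg_id]].
  exact: continuous_expR.
have mf : measurable_fun [set: R] (fun y => (f y)%:E).
  apply/measurable_EFinP; apply: measurable_maxr; last exact: measurable_cst.
  apply: measurable_funB; first exact: measurable_cst.
  exact: continuous_measurable_fun.
have f01 y : (0 <= (f y)%:E <= 1)%E.
  rewrite !lee_fin le_max lexx orbT/= ge_max ler01 andbT lerBlDr lerDl.
  exact: expR_ge0.
have tail t : 0 <= t -> P [set w | t < xi w] = (expR (- t))%:E.
  by move=> t0; exact: (log_survival_exponential YF).
have := exponential_law tail mf f01.
rewrite ge0_integral_distribution//; last by move=> y; have /andP[] := f01 y.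
rewrite (_ : (\int[P]_w ((fun y => (f y)%:E) \o xi) w =
    \int[P]_w (Num.max (1 - (survival F (Y w) / c) `^ p) 0)%:E)%E); last first.
  apply: eq_integral => w _; rewrite /= /f; congr (Num.max (1 - _) 0)%:E.
  have Sc : 0 < survival F (Y w) / c by rewrite divr_gt0.
  rewrite /powR gt_eqF// ln_div ?posrE//; congr expR; rewrite /xi/= /xi0 /L; ring.
move=> ->.
pose g (y : R) : R := (1 - expR (p * (L - y))) * expR (- y).
(* An antiderivative of [g]; it vanishes at infinity and equals -c p/(1 + p) at L = -ln c. *)
pose G (y : R) : R := (p + 1)^-1 * expR (p * (L - y) - y) - expR (- y).
transitivity (\int[leb]_(y in `[L, +oo[) (g y)%:E)%E.
  rewrite (_ : `[L, +oo[%classic = `[0%R, +oo[%classic `&` `[L, +oo[%classic); last first.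
    by rewrite predeqE => y; rewrite /= !in_itv/= !andbT; split => [Ly|[]//]; split => //; exact: le_trans Ly.
  rewrite [RHS]integral_mkcondr; apply: eq_integral => y _; rewrite patchE -EFinM.
  case: ifPn => [|].
    rewrite inE/= in_itv/= andbT => Ly; rewrite /f max_l// subr_ge0 -expR0 ler_expR.
    by rewrite pmulr_rle0// subr_le0.
  rewrite notin_setE/= in_itv/= andbT => /negP; rewrite -ltNge => yL.
  rewrite /f max_r ?mul0r// subr_le0 -expR0 ler_expR pmulr_rge0// subr_ge0; exact: ltW.
have dlin (y : R) : is_derive y 1 (fun y : R => p * (L - y) - y) (- (p + 1)).
  have := is_deriveB (is_deriveM (is_derive_cst p y 1) (is_deriveB (is_derive_cst L y 1) (is_derive_id y 1))) (is_derive_id y 1).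
  by move/is_derive_eq; apply; rewrite /GRing.scale/=; ring.
have dneg (y : R) : is_derive y 1 (fun y : R => - y) (-1 : R).
  exact: (is_deriveN (is_derive_id y 1)).
have dG (y : R) : is_derive y 1 G (g y).
  have D1 := @is_derive1_comp R expR (fun y => p * (L - y) - y) y _ _ (is_derive_expR _) (dlin y).
  have D2 := @is_derive1_comp R expR (fun y => - y) y _ _ (is_derive_expR _) (dneg y).
  have := is_deriveB (is_deriveM (is_derive_cst (p + 1)^-1 y 1) D1) D2.
  move/is_derive_eq; apply; rewrite /g /GRing.scale/= mulr0 addr0.
  by rewrite expRD; field; lra.
rewrite (@ge0_continuous_FTC2y _ _ G _ 0)//.
- rewrite -EFinB; congr EFin; rewrite /G subrr mulr0 !add0r -cE; field; lra.
- move=> y Ly; rewrite mulr_ge0 ?expR_ge0// subr_ge0 -expR0 ler_expR.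
  by rewrite pmulr_rle0// subr_le0.
- apply: continuous_subspaceT => y; apply: cvgM.
    by apply: cvgB; [exact: cvg_cst|exact: ecp].
  by apply: (@continuous_comp _ _ _ (fun y : R => - y) expR); [exact: opp_continuous|exact: continuous_expR].
- have e0 : expR (- y) @[y --> +oo] --> (0 : R) by exact: cvgr_expR.
  rewrite -[X in _ --> X](subrr 0); apply: cvgB => //.
  have up : (p + 1)^-1 * expR (p * L) * expR (- y) @[y --> +oo] --> (0 : R).
    by rewrite -[X in _ --> X](mulr0 ((p + 1)^-1 * expR (p * L))); apply: cvgM => //; exact: cvg_cst.
  apply: (squeeze_cvgr _ (cvg_cst 0) up); near=> y.
  have y0 : 0 <= y by near: y; apply: nbhs_pinfty_ge; exact: num_real.
  have pi0 : 0 <= (p + 1)^-1 by rewrite invr_ge0; lra.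
  rewrite mulr_ge0 ?expR_ge0//= -mulrA ler_wpM2l// -expRD ler_expR.
  have : 0 <= p * y by rewrite mulr_ge0// ltW.
  lra.
- by apply: cvg_at_right_filter; exact: (is_derive_continuous (dG L)).
- by move=> y _; rewrite derive1E; have [_ ->] := dG y.
Unshelve. all: by end_near. Qed.

(** Changing the threshold from 1 to C alters only the terms below K, each by at most |C - 1|.
    Summed over the sample, this leaves |C - 1| times a count of order r. *)
Lemma max_sub_lipschitz {R : realDomainType} (C y K : R) : C <= K -> 1 <= K ->
  `|Num.max (C - y) 0 - Num.max (1 - y) 0| <= `|C - 1| * (y < K)%R%:R.
Proof.
move=> CK K1; have [yK|yK] := ltP y K; last first.
  by rewrite !max_r ?subr_le0 ?subrr ?normr0 ?mulr0// ?(le_trans CK)// (le_trans K1).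
rewrite mulr1 ler_norml.
have := ler_norm (C - 1); have := ler_norm (- (C - 1)); rewrite normrN.
by case: (leP (C - y) 0) => ?; case: (leP (1 - y) 0) => ? ? ?; apply/andP; split; lra.
Qed.

(** * Laws of large numbers near the upper quantile of level r/n *)

Section order_statistic_limits.
Context {d : measure_display} {T : measurableType d} {R : realType}
  (P : probability T R) (X : nat -> {RV P >-> R}) (F : R -> R) (r : nat -> nat)
  (indep : independent_RVs X) (XF : forall i, has_cdf (X i) F)
  (cF : continuous F) (S0 : forall x, 0 < survival F x)
  (roo : (r n)%:R @[n --> \oo] --> (+oo : set_system R))
  (rn0 : (r n)%:R / n%:R @[n --> \oo] --> (0 : R))
  (rbnd : \forall n \near \oo, (0 < r n < n)%N).

(* The default value keeps [level n] in (0, 1] for every [n], so that the means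
   computed below need no side condition. *)
Definition level (n : nat) : R := if (0 < r n < n)%N then (r n)%:R / n%:R else 1.

Lemma level_bounds n : 0 < level n <= 1.
Proof.
rewrite /level; case: ifPn => [/andP[r0 rn]|_]; last by rewrite ltr01 lexx.
have n0 : (0 : R) < n%:R by rewrite ltr0n; lia.
have r0' : (0 : R) < (r n)%:R by rewrite ltr0n.
by apply/andP; split; [exact: divr_gt0|rewrite ler_pdivrMr// mul1r ler_nat ltnW].
Qed.

Lemma level_near : \forall n \near \oo, level n = (r n)%:R / n%:R.
Proof. by apply: filterS rbnd => n; rewrite /level => ->. Qed.

Lemma level_cvg : level n @[n --> \oo] --> (0 : R).
Proof.
by apply: (cvg_near_ext rn0); apply: filterS level_near => n ->.
Qed.

Lemma survival_count_lln v : 0 < v ->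
  (r p.1)%:R^-1 * (\sum_(i <- iota 0 p.1) (survival F (X i p.2) < v * level p.1)%R%:R)
    @[p --> whp P] --> v.
Proof.
move=> v0; have c0 n : 0 <= v * level n.
  by have /andP[l0 _] := level_bounds n; rewrite mulr_ge0// ltW.
apply: (@wlln _ _ _ P X (fun n x => (survival F x < v * level n)%R%:R)
  (fun n => Num.min (v * level n) 1) (fun n => (r n)%:R) v indep) => //.
- move=> n; rewrite (_ : (fun x => _) = \1_[set x | survival F x < v * level n]).
    apply: measurable_indic; apply: measurable_set_lt; last exact: measurable_cst.
    exact: measurable_survival.
  by apply/funext => x; rewrite indicE; congr ((nat_of_bool _)%:R); apply/idP/idP; rewrite inE.
- by move=> n x; case: (_ < _); rewrite ler01 lexx.
- move=> n i; rewrite -(prob_survival_lt_min (XF i) cF (c0 n)).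
  have mA : measurable [set w | survival F (X i w) < v * level n].
    apply: measurable_set_lt; last exact: measurable_cst.
    by apply: (measurableT_comp (measurable_survival cF)).
  rewrite -[X in _ = P X]setIT -integral_indic//.
  apply: eq_integral => w _; rewrite indicE; congr ((nat_of_bool _)%:R%:E).
  by apply/idP/idP; rewrite inE.
(* Once v r/n < 1 the minimum with 1 is inactive, and n q_n/r equals v exactly. *)
- apply: (@cvg_near_ext _ _ _ _ (fun=> v)); first exact: cvg_cst.
  have vc : v * level n @[n --> \oo] --> v * 0.
    by apply: cvgM level_cvg; exact: cvg_cst.
  rewrite mulr0 in vc; near=> n.
  have /andP[r0 rn] : (0 < r n < n)%N by near: n.
  have lE : level n = (r n)%:R / n%:R by near: n; exact: level_near.
  have vc1 : v * level n < 1 by near: n; exact: (cvgr_lt _ vc).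
  have n0 : (0 : R) < n%:R by rewrite ltr0n; lia.
  have r0' : (0 : R) < (r n)%:R by rewrite ltr0n.
  by rewrite min_l ?(ltW vc1)// lE; field; rewrite !gt_eqF.
Unshelve. all: by end_near. Qed.

Let tau n := order_stat X n (n - r n).

Lemma order_stat_survival_lt n v w : (r n < n)%N ->
  (survival F (tau n w) < v) =
  ((r n)%:R < \sum_(i <- iota 0 n) (survival F (X i w) < v)%R%:R :> R).
Proof.
move=> rn; rewrite natr_count ltr_nat.
rewrite -(@order_stat_upper _ _ X n (r n) w (fun x => survival F x < v))//.
by move=> x y xy; apply: le_lt_trans; exact: (survival_le (XF 0)).
Qed.

(** Inversion of the counting law: about (1 + e) r values have survival below (1 + e) r/n, more than
    r, and about (1 - e) r values have it below (1 - e) r/n, fewer than r. The threshold is caught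
    in between. *)
Lemma order_stat_ratio :
  survival F (tau p.1 p.2) / level p.1 @[p --> whp P] --> (1 : R).
Proof.
apply/cvgrPdist_le => eps eps0.
(* The cap 1/2 keeps the lower level (1 - e) r/n positive. *)
pose e := Num.min eps (1 / 2).
have e0 : 0 < e by rewrite lt_min eps0/= divr_gt0.
have e1 : e <= eps by rewrite ge_min lexx.
have e2 : e <= 1 / 2 by rewrite ge_min lexx orbT.
have vp : 0 < 1 + e by lra.
have vm : 0 < 1 - e by lra.
pose N v (p : nat * T) : R := (r p.1)%:R^-1 *
  (\sum_(i <- iota 0 p.1) (survival F (X i p.2) < v * level p.1)%R%:R).
have Hp : N (1 + e) p @[p --> whp P] --> 1 + e := survival_count_lln vp.
have Hm : N (1 - e) p @[p --> whp P] --> 1 - e := survival_count_lln vm.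
have Hp1 : \forall p \near whp P, 1 < N (1 + e) p by apply: (cvgr_gt _ Hp); lra.
have Hm1 : \forall p \near whp P, N (1 - e) p < 1 by apply: (cvgr_lt _ Hm); lra.
have B := @whp_near _ _ _ P _ rbnd.
near=> p.
have /andP[r0 rn] : (0 < r p.1 < p.1)%N by near: p.
have r0' : (0 : R) < (r p.1)%:R by rewrite ltr0n.
have /andP[l0 _] := level_bounds p.1.
have Np : 1 < N (1 + e) p by near: p.
have Nm : N (1 - e) p < 1 by near: p.
rewrite /N in Np Nm.
rewrite ltr_pdivlMl// mulr1 -order_stat_survival_lt// in Np.
rewrite ltr_pdivrMl// mulr1 in Nm.
have {}Nm : (1 - e) * level p.1 <= survival F (tau p.1 p.2).
  by rewrite leNgt order_stat_survival_lt// -leNgt ltW.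
rewrite -ltr_pdivrMr// in Np; rewrite -ler_pdivlMr// in Nm.
by rewrite ler_norml; apply/andP; split; lra.
Unshelve. all: by end_near. Qed.

Lemma excess_power_lln p : 0 < p ->
  (r q.1)%:R^-1 * (\sum_(i <- iota 0 q.1)
     Num.max (1 - (survival F (X i q.2) / level q.1) `^ p) 0)
    @[q --> whp P] --> p / (1 + p).
Proof.
move=> p0.
apply: (@wlln _ _ _ P X (fun n x => Num.max (1 - (survival F x / level n) `^ p) 0)
  (fun n => level n * (p / (1 + p))) (fun n => (r n)%:R) _ indep) => //.
- move=> n; apply: measurable_maxr; last exact: measurable_cst.
  apply: measurable_funB; first exact: measurable_cst.
  apply: (measurableT_comp (measurable_powR _)).
  by apply: measurable_funM; [exact: measurable_survival|exact: measurable_cst].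
- by move=> n x; rewrite le_max lexx orbT/= ge_max ler01 andbT lerBlDr lerDl powR_ge0.
- by move=> n i; apply: survival_power_expectation => //; exact: level_bounds.
- apply: (@cvg_near_ext _ _ _ _ (fun=> p / (1 + p))); first exact: cvg_cst.
  near=> n.
  have /andP[r0 rn] : (0 < r n < n)%N by near: n.
  have lE : level n = (r n)%:R / n%:R by near: n; exact: level_near.
  have n0 : (0 : R) < n%:R by rewrite ltr0n; lia.
  have r0' : (0 : R) < (r n)%:R by rewrite ltr0n.
  by rewrite lE; field; rewrite !gt_eqF//; lra.
Unshelve. all: by end_near. Qed.

Lemma order_stat_ratio_power p :
  (survival F (tau q.1 q.2) / level q.1) `^ p @[q --> whp P] --> (1 : R).
Proof.
by rewrite (_ : 1 = 1 `^ p); [apply: cvg_powR => //; exact: order_stat_ratio|rewrite powR1].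
Qed.

(** The random threshold C, which tends to 1, is compared with the fixed threshold 1 of
    [excess_power_lln]. The difference is at most |C - 1| times the normalised count of values with
    survival below 2 r/n, which converges to 2. Any cutoff above 1 would serve as well as 2. *)
Lemma order_stat_excess_power p : 0 < p ->
  (r q.1)%:R^-1 * (\sum_(i <- iota 0 q.1)
     Num.max ((survival F (tau q.1 q.2) / level q.1) `^ p
              - (survival F (X i q.2) / level q.1) `^ p) 0)
    @[q --> whp P] --> p / (1 + p).
Proof.
move=> p0; have two0 : (0 : R) < 2 by [].
have C1 := order_stat_ratio_power p.
have N2 := survival_count_lln two0.
pose C (q : nat * T) := (survival F (tau q.1 q.2) / level q.1) `^ p.
pose N (q : nat * T) := (r q.1)%:R^-1 *
  (\sum_(i <- iota 0 q.1) (survival F (X i q.2) < 2 * level q.1)%R%:R) : R.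
pose A (q : nat * T) := (r q.1)%:R^-1 * (\sum_(i <- iota 0 q.1)
     Num.max (1 - (survival F (X i q.2) / level q.1) `^ p) 0) : R.
have HA : A q @[q --> whp P] --> p / (1 + p) by exact: excess_power_lln.
pose D (q : nat * T) := (r q.1)%:R^-1 * (\sum_(i <- iota 0 q.1)
     Num.max (C q - (survival F (X i q.2) / level q.1) `^ p) 0) - A q : R.
suff HD : D q @[q --> whp P] --> (0 : R).
  have H : A q + D q @[q --> whp P] --> p / (1 + p) + 0 by exact: cvgD HA HD.
  rewrite addr0 in H; apply: (cvg_near_ext H).
  by apply: nearW => q; rewrite /D/= addrC subrK.
have bd : `|C q - 1| * N q @[q --> whp P] --> (0 : R).
  rewrite -[X in _ --> X](mul0r (2 : R)); apply: cvgM => //.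
  rewrite -[X in _ --> X](@normr0 _ R); apply: cvg_norm.
  by rewrite -[X in _ --> X](subrr 1); apply: cvgB => //; exact: cvg_cst.
apply/norm_cvg0P; apply: (squeeze_cvgr _ (cvg_cst 0) bd).
pose Q (q : nat * T) : R := survival F (tau q.1 q.2) / level q.1.
have R1 : Q q @[q --> whp P] --> (1 : R) := order_stat_ratio.
have R2 : \forall q \near whp P, Q q < 2 by apply: (cvgr_lt _ R1); lra.
near=> q; rewrite normr_ge0/=.
have /andP[l0 _] := level_bounds q.1.
have Rq : Q q < 2 by near: q.
have Sn x : 0 <= survival F x / level q.1 by rewrite divr_ge0// ltW.
have pwle (x y : R) : 0 <= x -> x <= y -> x `^ p <= y `^ p.
  by move=> x0 xy; apply: ge0_ler_powR; rewrite ?nnegrE ?(ltW p0)// (le_trans x0).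
have CK : C q <= 2 `^ p by apply: pwle => //; exact: ltW.
have K1 : 1 <= 2 `^ p by have := pwle 1 2 ler01; rewrite powR1; apply; lra.
rewrite /D /A -mulrBr -sumrB normrM /N mulrCA.
rewrite ger0_norm ?invr_ge0// ler_wpM2l ?invr_ge0// mulr_sumr.
apply: (le_trans (ler_norm_sum _ _ _)); apply: ler_sum => i _.
apply: (le_trans (max_sub_lipschitz _ CK K1)).
rewrite ler_wpM2l// ler_nat; case: ltP => // yK.
rewrite -ltr_pdivrMr//; case: ltP => // SK.
by move: yK; rewrite ltNge pwle.
Unshelve. all: by end_near. Qed.

End order_statistic_limits.

Lemma cvg_sqrtr {R : realType} {U : Type} (G : set_system U) {FG : Filter G}
    (f : U -> R) (l : R) : f x @[x --> G] --> l ->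
  Num.sqrt (f x) @[x --> G] --> Num.sqrt l.
Proof.
move=> fl; apply: (@continuous_cvg _ _ _ G FG f (fun x : R => Num.sqrt x)) => //.
exact: sqrt_continuous.
Qed.

(** * Growth of the rank and of the convergence rate *)

Section rates.
Context {R : realType} (alpha beta s : R) (r : nat -> nat)
  (a0 : 0 < alpha) (b0 : 0 < beta) (s0 : 0 < s)
  (rs : (r n)%:R / (s * n%:R `^ (2 * beta / (2 * beta + alpha)))
          @[n --> \oo] --> (1 : R)).

Let nu n : R := n%:R `^ (2 * beta / (2 * beta + alpha)).
Let rate n : R := n%:R `^ (beta / (2 * beta + alpha)).

Let ba0 : 0 < 2 * beta + alpha.
Proof. by rewrite addr_gt0// mulr_gt0. Qed.

Lemma cvg_powR_natr (a : R) : 0 < a -> n%:R `^ a @[n --> \oo] --> (+oo : set_system R).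
Proof.
move=> a1; exact: (@cvg_comp _ _ _ (fun n : nat => n%:R : R) (fun x => x `^ a) _ _ _ (@cvgr_idn R) (cvg_powR_pinfty a1)).
Qed.

Lemma cvg_powRN_natr (a : R) : 0 < a -> n%:R `^ (- a) @[n --> \oo] --> (0 : R).
Proof.
move=> a1; exact: (@cvg_comp _ _ _ (fun n : nat => n%:R : R) (fun x => x `^ (- a)) _ _ _ (@cvgr_idn R) (cvg_powRN_pinfty a1)).
Qed.

Lemma rank_nu : (r n)%:R / nu n @[n --> \oo] --> s.
Proof.
have H : s * ((r n)%:R / (s * nu n)) @[n --> \oo] --> s * 1.
  by apply: cvgM => //; exact: cvg_cst.
rewrite mulr1 in H; apply: (cvg_near_ext H); near=> n.
have n0 : (0 : R) < n%:R by rewrite ltr0n; near: n; exact: nbhs_infty_gt.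
by field; rewrite !gt_eqF// powR_gt0.
Unshelve. all: by end_near. Qed.

Lemma rank_cvgy : (r n)%:R @[n --> \oo] --> (+oo : set_system R).
Proof.
have s2 : s / 2 < s by rewrite ltr_pdivrMr// ltr_pMr// ltr1n.
have nuy : nu n @[n --> \oo] --> (+oo : set_system R).
  by apply: cvg_powR_natr; rewrite divr_gt0// mulr_gt0.
apply/cvgryPge => M; near=> n.
have n0 : (0 : R) < n%:R by rewrite ltr0n; near: n; exact: nbhs_infty_gt.
have nu0 : 0 < nu n by exact: powR_gt0.
have h1 : s / 2 < (r n)%:R / nu n by near: n; exact: (cvgr_gt _ rank_nu).
have h2 : 2 / s * `|M| <= nu n.
  by near: n; move/cvgryPge : nuy; exact.
rewrite ltr_pdivlMr// in h1.
have : s / 2 * (2 / s * `|M|) <= s / 2 * nu n by rewrite ler_wpM2l// divr_ge0// ltW.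
have -> : s / 2 * (2 / s * `|M|) = `|M| by field; rewrite gt_eqF.
by have := ler_norm M; lra.
Unshelve. all: by end_near. Qed.

Lemma rank_ratio : (r n)%:R / n%:R @[n --> \oo] --> (0 : R).
Proof.
have al : 0 < alpha / (2 * beta + alpha) by exact: divr_gt0.
have H : (r n)%:R / nu n * n%:R `^ (- (alpha / (2 * beta + alpha))) @[n --> \oo] --> s * 0.
  by apply: cvgM; [exact: rank_nu|exact: cvg_powRN_natr].
rewrite mulr0 in H; apply: (cvg_near_ext H); near=> n.
have n0 : (0 : R) < n%:R by rewrite ltr0n; near: n; exact: nbhs_infty_gt.
have -> : - (alpha / (2 * beta + alpha)) = 2 * beta / (2 * beta + alpha) - 1.
  by field; rewrite gt_eqF.
rewrite powRB ?(gt_eqF n0) ?implybT// powRr1 ?(ltW n0)// -/(nu n).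
by field; rewrite !gt_eqF// powR_gt0.
Unshelve. all: by end_near. Qed.

Lemma rank_bounds : \forall n \near \oo, (0 < r n < n)%N.
Proof.
near=> n.
have n0 : (0 : R) < n%:R by rewrite ltr0n; near: n; exact: nbhs_infty_gt.
have r0 : (0 : R) < (r n)%:R by near: n; move/cvgryPgt : rank_cvgy; exact.
have : (r n)%:R / n%:R < 1 :> R by near: n; apply: (cvgr_lt _ rank_ratio).
by rewrite ltr_pdivrMr// mul1r ltr_nat => ->; rewrite -(ltr0n R) r0.
Unshelve. all: by end_near. Qed.

Lemma rank_inv : (r n)%:R^-1 @[n --> \oo] --> (0 : R).
Proof.
apply/gtr0_cvgV0; last exact: rank_cvgy.
by apply: filterS rank_bounds => n /andP[r0 _]; rewrite ltr0n.
Qed.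

Lemma rate_sqr n : rate n ^+ 2 = nu n.
Proof.
rewrite -powR_mulrn ?powR_ge0// /rate -powRrM /nu; congr (_ `^ _); ring.
Qed.

(** The square of the rate is the power of n to which r is proportional, so the rate is comparable
    with sqrt r. This is the source of the variance factor 1/s. *)
Lemma rate_sqrt_rank : rate n / Num.sqrt (r n)%:R @[n --> \oo] --> (Num.sqrt s)^-1.
Proof.
have H : (Num.sqrt ((r n)%:R / nu n))^-1 @[n --> \oo] --> (Num.sqrt s)^-1.
  apply: cvgV; first by rewrite gt_eqF// sqrtr_gt0.
  by apply: cvg_sqrtr; exact: rank_nu.
apply: (cvg_near_ext H); near=> n.
rewrite -rate_sqr sqrtrM ?ler0n// sqrtrV ?sqr_ge0// sqrtr_sqr ger0_norm ?powR_ge0//.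
by rewrite invfM invrK mulrC.
Unshelve. all: by end_near. Qed.

Lemma rate_rank : rate n / (r n)%:R @[n --> \oo] --> (0 : R).
Proof.
have H : rate n / Num.sqrt (r n)%:R * Num.sqrt (r n)%:R^-1 @[n --> \oo] --> (Num.sqrt s)^-1 * Num.sqrt 0.
  apply: cvgM; first exact: rate_sqrt_rank.
  by apply: cvg_sqrtr; exact: rank_inv.
rewrite sqrtr0 mulr0 in H; apply: (cvg_near_ext H); near=> n.
by rewrite sqrtrV ?ler0n// -mulrA -invfM -expr2 sqr_sqrtr ?ler0n.
Unshelve. all: by end_near. Qed.

(** The version with r - 1, since the gamma sum is standardised at the mode r - 1 of its density. *)
Lemma rate_fluctuation :
  rate n * Num.sqrt (r n).-1%:R / (r n)%:R @[n --> \oo] --> (Num.sqrt s)^-1.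
Proof.
have H : rate n / Num.sqrt (r n)%:R * Num.sqrt (1 - (r n)%:R^-1) @[n --> \oo] -->
    (Num.sqrt s)^-1 * Num.sqrt (1 - 0).
  apply: cvgM; first exact: rate_sqrt_rank.
  apply: cvg_sqrtr.
  by apply: cvgB; [exact: cvg_cst|exact: rank_inv].
rewrite subr0 sqrtr1 mulr1 in H; apply: (cvg_near_ext H); near=> n.
have /andP[r0 rn] : (0 < r n < n)%N by near: n; exact: rank_bounds.
have r0' : (0 : R) < (r n)%:R by rewrite ltr0n.
have E : 1 - (r n)%:R^-1 = (r n).-1%:R / (r n)%:R :> R.
  by rewrite -{1 3}(prednK r0) -natr1; field; rewrite natr1 prednK// gt_eqF.
rewrite E sqrtrM ?ler0n// sqrtrV ?ler0n// -[X in _ = _ / X](sqr_sqrtr (ltW r0')).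
by field; rewrite gt_eqF// sqrtr_gt0.
Unshelve. all: by end_near. Qed.

(** The size of the bias: r/n behaves as s n^(-alpha/(2 beta + alpha)), and the power beta/alpha
    turns this into the inverse of the rate. *)
Lemma rate_level : rate n * level r n `^ (beta / alpha) @[n --> \oo] --> s `^ (beta / alpha).
Proof.
have H : ((r n)%:R / nu n) `^ (beta / alpha) @[n --> \oo] --> s `^ (beta / alpha).
  by apply: cvg_powR => //; exact: rank_nu.
apply: (cvg_near_ext H); near=> n.
have n0 : (0 : R) < n%:R by rewrite ltr0n; near: n; exact: nbhs_infty_gt.
have -> : level r n = (r n)%:R / n%:R :> R.
  by near: n; apply: level_near; exact: rank_bounds.
have -> : rate n = (n%:R `^ (alpha / (2 * beta + alpha))) `^ (beta / alpha).
  by rewrite -powRrM; congr (_ `^ _); field; rewrite !gt_eqF.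
rewrite -powRM ?powR_ge0//; congr (_ `^ _).
have -> : alpha / (2 * beta + alpha) = 1 - 2 * beta / (2 * beta + alpha).
  by field; rewrite gt_eqF.
rewrite powRB ?(gt_eqF n0) ?implybT// powRr1 ?(ltW n0)// -/(nu n).
by field; rewrite !gt_eqF// powR_gt0.
Unshelve. all: by end_near. Qed.

End rates.

Lemma powR_div {R : realType} (x y p : R) : 0 <= x -> 0 < y ->
  (x / y) `^ p = x `^ p / y `^ p.
Proof.
move=> x0 y0; rewrite powRM ?invr_ge0 ?(ltW y0)//.
by rewrite -[y^-1]powR_inv1 ?(ltW y0)// -powRrM mulN1r powRN.
Qed.

(** * Limit law of the Hill estimator *)

Section hill_clt.
Context {d : measure_display} {T : measurableType d} {R : realType}
  (P : probability T R) (X : nat -> {RV P >-> R}) (F : R -> R)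
  (alpha beta A B s : R) (r : nat -> nat)
  (Xindep : independent_RVs X) (XF : forall i, has_cdf (X i) F)
  (Fcont : continuous F) (FHall : hall_class F alpha beta A B)
  (s0 : 0 < s)
  (rs : (r n)%:R / (s * n%:R `^ (2 * beta / (2 * beta + alpha)))
          @[n --> \oo] --> (1 : R)).

Let S := survival F.
Let p := beta / alpha.
Let D := B * A `^ (- p).
Let phi x := - ln (S x).
Let tau n := order_stat X n (n - r n).
Let rate n : R := n%:R `^ (beta / (2 * beta + alpha)).

Let a0 : 0 < alpha. Proof. by have [] := FHall. Qed.
Let b0 : 0 < beta. Proof. by have [_ b2 _ _ _] := FHall; lra. Qed.
Let p0 : 0 < p. Proof. exact: divr_gt0. Qed.
Let S0 x : 0 < S x. Proof. exact: (hall_survival_gt0 (XF 0) FHall). Qed.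

Let Sle x y : x <= y -> S y <= S x.
Proof. exact: (survival_le (XF 0)). Qed.

Let phile x y : x <= y -> phi x <= phi y.
Proof. by move=> xy; rewrite lerN2 ler_ln ?posrE ?S0// Sle. Qed.

Let mphi : measurable_fun [set: R] phi.
Proof.
apply: measurableT_comp => //; apply: measurableT_comp; first exact: measurable_ln.
exact: measurable_survival.
Qed.

Let mxi i : measurable_fun [set: T] (fun w => phi (X i w)).
Proof. exact: measurableT_comp. Qed.

Let xi i : {RV P >-> R} :=
  HB.pack (fun w => phi (X i w)) (isMeasurableFun.Build _ _ _ _ (fun w => phi (X i w)) (mxi i)).

Let xi_indep : independent_RVs xi.
Proof.
move=> J E mE.
have mE' i : measurable (phi @^-1` E i).
  by have := mphi measurableT (mE i); rewrite setTI.
exact: (Xindep J mE').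
Qed.

(* By Renyi's representation this has a gamma law with shape [r n]. *)
Definition spacing_sum n w : R :=
  exceed_sum (fun i w => - ln (survival F (X i w))) (iota 0 n)
    (- ln (survival F (order_stat X n (n - r n) w))) w.

(** Centred at the mode r - 1 and scaled by its square root, to match [gamma_clt]. The distance 1
    from the mean r reappears in [hill_clt] as the negligible term rate/r. *)
Definition standard_spacing n w : R :=
  (spacing_sum n w - (r n).-1%:R) / Num.sqrt (r n).-1%:R.

Lemma measurable_spacing_sum n : measurable_fun [set: T] (spacing_sum n).
Proof.
apply: measurable_exceed_sum => [i _|]; first exact: mxi.
by apply: (measurableT_comp mphi); exact: measurable_order_statT.
Qed.

Lemma measurable_standard_spacing n : measurable_fun [set: T] (standard_spacing n).
Proof.
apply: measurable_funM; last exact: measurable_cst.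
by apply: measurable_funB; [exact: measurable_spacing_sum|exact: measurable_cst].
Qed.

Lemma spacing_sum_gamma n x : (r n < n)%N -> 0 <= x ->
  P [set w | spacing_sum n w <= x] = (gamma_cdf (r n) x)%:E.
Proof.
move=> rn x0; apply: (@gamma_excess _ _ _ P X xi phi) => //.
by move=> i t t0; exact: (log_survival_exponential (XF i)).
Qed.

Let rbnd := rank_bounds a0 b0 s0 rs.
Let roo := rank_cvgy a0 b0 s0 rs.
Let rn0 := rank_ratio a0 b0 s0 rs.

Lemma standard_spacing_clt z :
  fine (P [set w | standard_spacing n w <= z]) @[n --> \oo] --> normal_cdf 0 1 z.
Proof.
have rnat : (r n - 2)%N @[n --> \oo] --> \oo.
  have H : r n @[n --> \oo] --> \oo by apply/(@cvgrnyP R); exact: roo.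
  apply/cvgnyPge => k; move/cvgnyPge : H => /(_ (k + 2)%N).
  by apply: filterS => n; lia.
pose G (k : nat) : R := gamma_cdf k.+2 (k.+1%:R + Num.sqrt k.+1%:R * z).
have HG : G k @[k --> \oo] --> normal_cdf 0 1 z by exact: gamma_clt.
have H : G (r n - 2)%N @[n --> \oo] --> normal_cdf 0 1 z.
  exact: (@cvg_comp _ _ _ (fun n => (r n - 2)%N) G _ _ _ rnat HG).
apply: (cvg_near_ext H).
(* This gives r >= 2, as [gamma_clt] starts at shape 2, and |z| <= sqrt(r - 1), so that the gamma
   distribution function is taken at a nonnegative point. *)
have bz : \forall n \near \oo, z ^+ 2 + 2 <= (r n)%:R.
  by move/cvgryPge : roo; exact.
near=> n.
have /andP[_ rn] : (0 < r n < n)%N by near: n; exact: rbnd.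
have zr : z ^+ 2 + 2 <= (r n)%:R by near: n.
have r2 : (2 <= r n)%N.
  by rewrite -(ler_nat R); apply: le_trans zr; rewrite lerDr sqr_ge0.
have [k kE] : exists k, r n = k.+2 by case: (r n) r2 => [|[|k]]// _; exists k.
rewrite (_ : (r n - 2)%N = k); last by rewrite kE subn2.
have -> : G k = gamma_cdf (r n) ((r n).-1%:R + Num.sqrt (r n).-1%:R * z) by rewrite kE.
set m : R := (r n).-1%:R.
have mE : m = (r n)%:R - 1 by rewrite /m -{2}(prednK (ltnW r2)) -natr1 addrK.
have m0 : 0 < m by rewrite /m kE ltr0n.
have q0 : 0 < Num.sqrt m by rewrite sqrtr_gt0.
have x0 : 0 <= m + Num.sqrt m * z.
  have mq : m = Num.sqrt m ^+ 2 by rewrite sqr_sqrtr// ltW.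
  rewrite {1}mq expr2 -mulrDr mulr_ge0 ?sqrtr_ge0//.
  have : `|z| <= Num.sqrt m.
    by rewrite -sqrtr_sqr ler_sqrt//; lra.
  by rewrite ler_norml => /andP[? _]; lra.
have -> : [set w | standard_spacing n w <= z] = [set w | spacing_sum n w <= m + Num.sqrt m * z].
  rewrite predeqE => w; rewrite /= /standard_spacing -/m ler_pdivrMr//.
  by rewrite lerBlDl [z * _]mulrC.
by rewrite spacing_sum_gamma.
Unshelve. all: by end_near. Qed.

(** The survival at the threshold is r/n times a ratio that tends to 1, so it falls below S M. The
    asymptotic expansion then applies to all of the top values. *)
Lemma order_stat_tail M : \forall v \near whp P, M <= tau v.1 v.2.
Proof.
have H : S (tau v.1 v.2) / level r v.1 * level r v.1 @[v --> whp P] --> (1 * 0 : R).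
  apply: cvgM; first exact: (order_stat_ratio Xindep XF Fcont roo rn0 rbnd).
  by apply: (@whp_seq _ _ _ P _ (level r)); exact: (level_cvg rn0 rbnd).
rewrite mul1r in H.
have Hn : \forall v \near whp P, S (tau v.1 v.2) / level r v.1 * level r v.1 < S M.
  by apply: (cvgr_lt _ H); exact: S0.
near=> v.
have h : S (tau v.1 v.2) / level r v.1 * level r v.1 < S M by near: v.
have /andP[l0 _] := level_bounds (R := R) r v.1.
move: h; rewrite divfK ?gt_eqF// => h.
by rewrite leNgt; apply/negP => /ltW /Sle; rewrite leNgt h.
Unshelve. all: by end_near. Qed.

Let q x := S x `^ p.

Let q0 x : 0 < q x. Proof. exact: powR_gt0. Qed.

Let qle x y : x <= y -> q y <= q x.
Proof.
move=> xy; apply: ge0_ler_powR; rewrite ?nnegrE ?(ltW p0) ?(ltW (S0 _))//.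
exact: Sle.
Qed.

Lemma rate_order_stat : rate v.1 * q (tau v.1 v.2) @[v --> whp P] --> s `^ p.
Proof.
have H : rate v.1 * level r v.1 `^ p * (S (tau v.1 v.2) / level r v.1) `^ p
    @[v --> whp P] --> s `^ p * 1.
  apply: cvgM; first by apply: (@whp_seq _ _ _ P _ (fun n => rate n * level r n `^ p)); exact: (rate_level a0 b0 s0 rs).
  exact: (order_stat_ratio_power Xindep XF Fcont roo rn0 rbnd).
rewrite mulr1 in H; apply: (cvg_near_ext H); apply: nearW => v.
have /andP[l0 _] := level_bounds (R := R) r v.1.
rewrite powR_div ?(ltW (S0 _))// /q.
by field; rewrite gt_eqF// powR_gt0.
Qed.

(** The bias. Positive parts are homogeneous, so the power of the level factors out of the sum;
    multiplied by the rate it tends to s^p, and [order_stat_excess_power] supplies p/(1 + p). *)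
Lemma rate_excess_power :
  rate v.1 * (D * ((r v.1)%:R^-1 * \sum_(i <- iota 0 v.1)
     Num.max (q (tau v.1 v.2) - q (X i v.2)) 0)) @[v --> whp P] -->
  D * s `^ p * (p / (1 + p)).
Proof.
have H : D * (rate v.1 * level r v.1 `^ p) * ((r v.1)%:R^-1 * (\sum_(i <- iota 0 v.1)
     Num.max ((S (tau v.1 v.2) / level r v.1) `^ p - (S (X i v.2) / level r v.1) `^ p) 0))
    @[v --> whp P] --> D * s `^ p * (p / (1 + p)).
  apply: cvgM.
    apply: cvgM; first exact: cvg_cst.
    by apply: (@whp_seq _ _ _ P _ (fun n => rate n * level r n `^ p)); exact: (rate_level a0 b0 s0 rs).
  exact: (order_stat_excess_power Xindep XF Fcont S0 roo rn0 rbnd p0).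
apply: (cvg_near_ext H); apply: nearW => v.
have /andP[l0 _] := level_bounds (R := R) r v.1.
set l := level r v.1 `^ p; have lp : 0 < l by exact: powR_gt0.
rewrite (eq_bigr (fun i => l^-1 * Num.max (q (tau v.1 v.2) - q (X i v.2)) 0)); last first.
  move=> i _; rewrite !powR_div ?(ltW (S0 _))// -/l /q -mulrBl mulrC.
  by rewrite maxr_pMr ?mulr0// invr_ge0 ltW.
rewrite -mulr_sumr; set W := \sum_(i <- _) _; set ri := _^-1.
have -> : D * (rate v.1 * l) * (ri * (l^-1 * W)) = (l / l) * (rate v.1 * (D * (ri * W))).
  by ring.
by rewrite divff ?mul1r// gt_eqF.
Qed.

Let hill_error (v : nat * T) : R :=
  alpha * (hill X v.1 (r v.1) v.2)^-1 -
    ((r v.1)%:R^-1 * spacing_sum v.1 v.2 -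
     D * ((r v.1)%:R^-1 * \sum_(i <- iota 0 v.1)
       Num.max (q (tau v.1 v.2) - q (X i v.2)) 0)).

Lemma rate_hill_error : rate v.1 * hill_error v @[v --> whp P] --> (0 : R).
Proof.
apply/cvgr0Pnorm_le => eps eps0.
have sp0 : 0 < s `^ p + 1 by rewrite ltr_wpDl// powR_ge0.
pose e1 := eps / (2 * (s `^ p + 1)).
have e10 : 0 < e1 by rewrite divr_gt0// mulr_gt0.
(* The final bound is 2 e1 times the rate times q at the threshold. That product tends to s^p and is
   eventually below s^p + 1, whence the choice of e1. *)
have /cvgrPdist_le/(_ _ e10) [M [_ HM]] := hall_log_expansion FHall.
have Hexp x : M + 1 <= x -> `|alpha * ln x - phi x - ln A - D * q x| <= e1 * q x.
  move=> Mx; have := HM x (lt_le_trans (_ : M < M + 1) Mx).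
  rewrite ltrDl ltr01 => /(_ isT) h.
  have E : alpha * ln x - phi x - ln A - D * q x =
     - (D - (alpha * ln x + ln (S x) - ln A) / q x) * q x.
    by rewrite /phi; field; rewrite gt_eqF.
  by rewrite E normrM normrN (gtr0_norm (q0 x)) ler_wpM2r// ltW.
have rb := @whp_near _ _ _ P _ rbnd.
have rq : \forall v \near whp P, rate v.1 * q (tau v.1 v.2) < s `^ p + 1.
  by apply: (cvgr_lt _ rate_order_stat); rewrite ltrDl.
have tl := order_stat_tail (M + 1).
near=> v.
have rv : (0 < r v.1 < v.1)%N by near: v.
have tM : M + 1 <= tau v.1 v.2 by near: v.
have rqv : rate v.1 * q (tau v.1 v.2) < s `^ p + 1 by near: v.
have rate0 : 0 <= rate v.1 by exact: powR_ge0.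
have := @hill_expansion _ _ X phi q v.1 (r v.1) alpha (ln A) D e1 (M + 1) v.2
  phile qle Hexp (ltW e10) rv tM.
rewrite normrM (ger0_norm rate0) => h.
apply: (le_trans (ler_wpM2l rate0 h)).
have -> : rate v.1 * (2 * e1 * q (tau v.1 v.2)) = 2 * e1 * (rate v.1 * q (tau v.1 v.2)).
  by ring.
have -> : eps = 2 * e1 * (s `^ p + 1) by rewrite /e1; field; rewrite gt_eqF.
by rewrite ler_wpM2l ?(ltW rqv)// mulr_ge0// ltW.
Unshelve. all: by end_near. Qed.

(** The scaled deviation is the expansion error, minus the bias, plus a_n Z, minus rate/r, where Z
    is the standardised gamma sum and a_n tends to 1/sqrt s. As Z is bounded in probability, a_n may
    be replaced with its limit. *)
Lemma hill_clt :
  rate v.1 * (alpha * (hill X v.1 (r v.1) v.2)^-1 - 1) -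
    (- (D * s `^ p * (p / (1 + p))) + (Num.sqrt s)^-1 * standard_spacing v.1 v.2)
  @[v --> whp P] --> (0 : R).
Proof.
pose a n : R := rate n * Num.sqrt (r n).-1%:R / (r n)%:R.
pose Q (v : nat * T) : R := rate v.1 * (D * ((r v.1)%:R^-1 * \sum_(i <- iota 0 v.1)
     Num.max (q (tau v.1 v.2) - q (X i v.2)) 0)).
have Ha : a n - (Num.sqrt s)^-1 @[n --> \oo] --> (0 : R).
  rewrite -[X in _ --> X](subrr (Num.sqrt s)^-1); apply: cvgB; last exact: cvg_cst.
  exact: (rate_fluctuation a0 b0 s0 rs).
have H1 : (a v.1 - (Num.sqrt s)^-1) * standard_spacing v.1 v.2 @[v --> whp P] --> (0 : R).
  apply: (@whp_tight _ _ _ P standard_spacing (fun n _ => a n - (Num.sqrt s)^-1)).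
  - exact: measurable_standard_spacing.
  - exact: standard_spacing_clt.
  - exact: (@whp_seq _ _ _ P _ (fun n => a n - (Num.sqrt s)^-1) _ Ha).
have H2 : Q v - D * s `^ p * (p / (1 + p)) @[v --> whp P] --> (0 : R).
  rewrite -[X in _ --> X](subrr (D * s `^ p * (p / (1 + p)))); apply: cvgB; last exact: cvg_cst.
  exact: rate_excess_power.
have H3 : rate v.1 / (r v.1)%:R @[v --> whp P] --> (0 : R).
  by apply: (@whp_seq _ _ _ P _ (fun n => rate n / (r n)%:R)); exact: (rate_rank a0 b0 s0 rs).
have H : rate v.1 * hill_error v - (Q v - D * s `^ p * (p / (1 + p))) +
    (a v.1 - (Num.sqrt s)^-1) * standard_spacing v.1 v.2 - rate v.1 / (r v.1)%:R
    @[v --> whp P] --> (0 - 0 + 0 - 0 : R).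
  by apply: cvgB => //; apply: cvgD => //; apply: cvgB => //; exact: rate_hill_error.
rewrite subrr add0r subrr in H; apply: (cvg_near_ext H).
have r2 : \forall n \near \oo, (2 : R) <= (r n)%:R.
  by move/cvgryPge : roo; exact.
have rb := @whp_near _ _ _ P _ r2.
near=> v.
have rv : (2 : R) <= (r v.1)%:R by near: v.
have {}rv : (2 <= r v.1)%N by rewrite -(ler_nat R).
have rE : (r v.1)%:R = (r v.1).-1%:R + 1 :> R by rewrite natr1 prednK// ltnW.
have m0 : (0 : R) < (r v.1).-1%:R by rewrite ltr0n -ltnS prednK// ltnW.
have TE : spacing_sum v.1 v.2 = (r v.1).-1%:R + Num.sqrt (r v.1).-1%:R * standard_spacing v.1 v.2.
  by rewrite /standard_spacing; field; rewrite gt_eqF// sqrtr_gt0.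
rewrite /hill_error TE /Q /a rE; set Z := standard_spacing _ _.
set hi := _^-1; set W := \sum_(i <- _) _; set k := Num.sqrt (r v.1).-1%:R.
set m := (r v.1).-1%:R in m0 *.
set c1 := p / (1 + p); set c2 := (Num.sqrt s)^-1.
have m1 : m + 1 != 0 by rewrite gt_eqF// addr_gt0.
by move: hi c1 c2 (s `^ p) => hi c1 c2 sp; field.
Unshelve. all: by end_near. Qed.

End hill_clt.

(** * Plug-in estimator *)

Lemma cvg_powR0 {R : realType} {U : Type} (G : set_system U) {FG : Filter G}
    (f : U -> R) (a : R) : 0 < a -> (forall x, 0 <= f x) ->
  f x @[x --> G] --> (0 : R) -> f x `^ a @[x --> G] --> (0 : R).
Proof.
move=> a1 f0 /cvgr0Pnorm_lt Hf; apply/cvgr0Pnorm_le => eps eps0.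
have e1 : 0 < eps `^ a^-1 by exact: powR_gt0.
have := Hf _ e1; apply: filterS => x.
rewrite ger0_norm// ger0_norm ?powR_ge0// => fx.
have -> : eps = (eps `^ a^-1) `^ a by rewrite -powRrM mulVf ?gt_eqF// powRr1// ltW.
by apply: ge0_ler_powR; rewrite ?nnegrE ?(ltW e1) ?(ltW a1)// ltW.
Qed.

(** The rate times u^(-beta) is the power beta of n^(1/(2 beta + alpha))/u, which tends to 0 by the
    assumption on u. *)
Lemma mean_excess_rate {d : measure_display} {T : measurableType d}
    {R : realType} (P : probability T R) (Y : {RV P >-> R}) (F f : R -> R)
    (alpha beta A B : R) (u : nat -> R) :
  has_cdf Y F -> has_density Y f -> hall_class F alpha beta A B -> 1 < alpha ->
  u n @[n --> \oo] --> +oo ->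
  n%:R `^ (1 / (2 * beta + alpha)) / u n @[n --> \oo] --> (0 : R) ->
  n%:R `^ (beta / (2 * beta + alpha)) *
    (mean_excess F f (u n) / u n - (alpha - 1)^-1) @[n --> \oo] --> (0 : R).
Proof.
move=> YF Yf FH a1 uoo urate.
have [a0 b2 _ _ _] := FH; have b0 : 0 < beta by lra.
have [K HK] := mean_excess_hall YF Yf FH a1.
have {}HK : \forall n \near \oo,
  `|mean_excess F f (u n) / u n - (alpha - 1)^-1| <= K * u n `^ (- beta) by exact: uoo HK.
have un0 : \forall n \near \oo, 0 < u n by move/cvgryPgt : uoo; exact.
have L0 : `|n%:R `^ (1 / (2 * beta + alpha)) / u n| `^ beta @[n --> \oo] --> (0 : R).
  apply: cvg_powR0 => //.
  by rewrite -[X in _ --> X](@normr0 _ R); exact: cvg_norm.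
have L1 : K * `|n%:R `^ (1 / (2 * beta + alpha)) / u n| `^ beta @[n --> \oo] --> (0 : R).
  by rewrite -[X in _ --> X](mulr0 K); apply: cvgM => //; exact: cvg_cst.
apply/norm_cvg0P; apply: (squeeze_cvgr _ (cvg_cst 0) L1).
near=> n; rewrite normr_ge0/=.
have u0 : 0 < u n by near: n.
have h : `|mean_excess F f (u n) / u n - (alpha - 1)^-1| <= K * u n `^ (- beta) by near: n.
rewrite normrM ger0_norm ?powR_ge0//.
apply: (le_trans (ler_wpM2l (powR_ge0 _ _) h)).
rewrite ger0_norm ?divr_ge0 ?powR_ge0 ?(ltW u0)//.
rewrite powR_div ?powR_ge0// -powRrM powRN.
rewrite (_ : 1 / (2 * beta + alpha) * beta = beta / (2 * beta + alpha)); last by ring.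
by rewrite mulrCA.
Unshelve. all: by end_near. Qed.

Lemma measurable_plugin_mean_excess {d : measure_display} {T : measurableType d}
    {R : realType} (X : nat -> T -> R) (n r : nat) (u : R) :
  (forall i, measurable_fun [set: T] (X i)) ->
  measurable_fun [set: T] (plugin_mean_excess X n r u).
Proof.
move=> mX.
have mln k : measurable_fun [set: T] (fun w => ln (order_stat X n k w)).
  by apply: measurableT_comp; [exact: measurable_ln|exact: measurable_order_statT].
have mV (g : T -> R) : measurable_fun [set: T] g -> measurable_fun [set: T] (fun w => (g w)^-1).
  (* Inversion is written through a power of the nonnegative square, which is measurable; the
     identity also holds at 0, where the inverse is 0. *)
  move=> mg; rewrite (_ : (fun w => _) = (fun w => g w * (g w ^+ 2) `^ (-1))).
    apply: measurable_funM => //; apply: (measurableT_comp (measurable_powR _)).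
    exact: measurable_funX.
  apply/funext => w; rewrite powR_inv1 ?sqr_ge0//.
  by have [->|gw] := eqVneq (g w) 0; [rewrite invr0 mul0r|field].
apply: measurable_funM; first exact: measurable_cst.
apply: (mV); apply: measurable_funB; last exact: measurable_cst.
apply: (mV); apply: measurable_funB => //.
apply: measurable_funM; first exact: measurable_cst.
by apply: measurable_sum_in.
Qed.

Theorem corollary7 (R : realType) (d : measure_display) (T : measurableType d)
    (P : probability T R) (X : nat -> {RV P >-> R}) (F f : R -> R)
    (alpha beta A B s : R) (r : nat -> nat) (u : nat -> R)
    (Xindep : independent_RVs X)
    (XF : forall i, has_cdf (X i) F) (Fcont : continuous F)
    (Xf : forall i, has_density (X i) f)
    (FHall : hall_class F alpha beta A B) (alpha1 : 1 < alpha)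
    (s0 : 0 < s)
    (rs : (r n)%:R / (s * n%:R `^ (2 * beta / (2 * beta + alpha)))
          @[n --> \oo] --> (1 : R))
    (uoo : u n @[n --> \oo] --> +oo)
    (urate : n%:R `^ (1 / (2 * beta + alpha)) / u n @[n --> \oo] --> (0 : R)) :
  let e_hat n := plugin_mean_excess X n (r n) (u n) in
  let e n := mean_excess F f (u n) in
  cvg_in_distribution P
    (fun n w => (u n)^-1
       * n%:R `^ (1 / 2 - (alpha / (2 * beta + alpha)) / 2)
       * (e_hat n w - e n))
    (normal_prob
       (- (alpha / (alpha - 1) ^+ 2) * A `^ (- beta / alpha) * B * beta
          * (alpha + beta)^-1 * s `^ (beta / alpha))
       (Num.sqrt (alpha ^+ 2 * (alpha - 1) ^- 4 * s^-1))) /\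
  asymptotic_expectation P
    (fun n w => (e_hat n w - e n) ^+ 2)
    (fun n => (u n) ^+ 2 * n%:R `^ (- 1 + alpha / (2 * beta + alpha))
       * (alpha ^+ 2 / (alpha - 1) ^+ 4)
       * (A `^ (- 2 * beta / alpha) * B ^+ 2 * beta ^+ 2
            * (alpha + beta) ^- 2 * s `^ (2 * beta / alpha) + s^-1)).
Proof.
move=> e_hat e.
have [a0 b2 A0 B0 _] := FHall; have b0 : 0 < beta by lra.
have ba0 : 0 < 2 * beta + alpha by rewrite addr_gt0// mulr_gt0.
have am1 : 0 < alpha - 1 by rewrite subr_gt0.
pose rate n : R := n%:R `^ (beta / (2 * beta + alpha)).
have -> : 1 / 2 - (alpha / (2 * beta + alpha)) / 2 = beta / (2 * beta + alpha).
  by field; rewrite gt_eqF.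
set mu := - (alpha / _) * _ * _ * _ * _ * _; set sigma := Num.sqrt _.
pose rho := alpha / (alpha - 1) ^+ 2; have rho0 : 0 < rho by rewrite divr_gt0// exprn_gt0.
(* The limit mean and deviation of the scaled alpha/hill - 1. The factor [rho], minus the derivative
   of 1/(t - 1) at alpha times alpha, carries them to [mu] and [sigma]. *)
pose mu0 := - (B * A `^ (- (beta / alpha)) * s `^ (beta / alpha) *
           (beta / alpha / (1 + beta / alpha))).
pose sigma0 := (Num.sqrt s)^-1.
have sigma00 : 0 < sigma0 by rewrite invr_gt0 sqrtr_gt0.
have muE : mu = rho * mu0.
  rewrite /mu /rho /mu0 !mulNr; set c1 := A `^ _; set c2 := s `^ _.
  by field; rewrite !gt_eqF// ?addr_gt0.
have sigmaE : sigma = rho * sigma0.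
  rewrite /sigma /rho /sigma0 -sqrtrV ?(ltW s0)// sqrtrM; last first.
    by rewrite mulr_ge0 ?sqr_ge0// invr_ge0 exprn_ge0// ltW.
  congr (_ * _); rewrite (_ : alpha ^+ 2 * (alpha - 1) ^- 4 = (alpha / (alpha - 1) ^+ 2) ^+ 2).
    by rewrite sqrtr_sqr gtr0_norm.
  by field; rewrite gt_eqF.
have sigma_gt0 : 0 < sigma by rewrite sigmaE mulr_gt0.
pose Z := @standard_spacing _ _ _ P X F r.
have mZ n : measurable_fun [set: T] (Z n).
  exact: measurable_standard_spacing.
have Zclt z : fine (P [set w | Z n w <= z]) @[n --> \oo] --> normal_cdf 0 1 z.
  exact: (standard_spacing_clt Xindep XF Fcont FHall s0 rs).
pose G (v : nat * T) : R := alpha * (hill X v.1 (r v.1) v.2)^-1.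
pose V (v : nat * T) : R := rate v.1 * (G v - 1) - (mu0 + sigma0 * Z v.1 v.2).
have HV : V v @[v --> whp P] --> (0 : R) := hill_clt Xindep XF Fcont FHall s0 rs.
have ri : (rate n)^-1 @[n --> \oo] --> (0 : R).
  rewrite (_ : (fun n => _) = (fun n : nat => n%:R `^ (- (beta / (2 * beta + alpha))) : R)).
    by apply: cvg_powRN_natr; exact: divr_gt0.
  by apply/funext => n; rewrite powRN.
have wri : (rate v.1)^-1 @[v --> whp P] --> (0 : R).
  exact: (@whp_seq _ _ _ P _ (fun n => (rate n)^-1) _ ri).
have n_gt0 : \forall n \near \oo, (0 : R) < n%:R.
  by near=> n; rewrite ltr0n; near: n; exact: nbhs_infty_gt.
have wn_gt0 := @whp_near _ _ _ P _ n_gt0.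
(* Consistency follows from the limit law: a sequence bounded in probability is divided by a
   diverging rate. *)
have G1 : G v @[v --> whp P] --> (1 : R).
  have K1 : (rate v.1)^-1 * sigma0 * Z v.1 v.2 @[v --> whp P] --> (0 : R).
    apply: (@whp_tight _ _ _ P Z (fun n _ => (rate n)^-1 * sigma0)) => //.
    by rewrite -[X in _ --> X](mul0r sigma0); apply: cvgM => //; exact: cvg_cst.
  have K2 : (rate v.1)^-1 * (V v + mu0) @[v --> whp P] --> (0 * (0 + mu0) : R).
    by apply: cvgM => //; apply: cvgD => //; exact: cvg_cst.
  have K3 : (rate v.1)^-1 * (V v + mu0) + (rate v.1)^-1 * sigma0 * Z v.1 v.2 + 1
      @[v --> whp P] --> (0 * (0 + mu0) + 0 + 1 : R).
    by apply: cvgD; [exact: cvgD|exact: cvg_cst].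
  rewrite mul0r !add0r in K3; apply: (cvg_near_ext K3); near=> v.
  have n0 : (0 : R) < v.1%:R by near: v.
  have r0 : 0 < rate v.1 by exact: powR_gt0.
  by rewrite /V; field; rewrite gt_eqF.
(* The exact secant slope: 1/(hill - 1) - 1/(alpha - 1) equals k times (G - 1), where G =
   alpha/hill, as soon as 0 < G < alpha. *)
pose k (v : nat * T) : R := alpha / ((alpha - G v) * (alpha - 1)).
have k1 : k v @[v --> whp P] --> rho.
  rewrite /rho expr2; apply: cvgM; first exact: cvg_cst.
  apply: cvgV; first by rewrite mulf_neq0// gt_eqF.
  by apply: cvgM; [apply: cvgB => //; exact: cvg_cst|exact: cvg_cst].
have k0 : k v - rho @[v --> whp P] --> (0 : R).
  by rewrite -[X in _ --> X](subrr rho); apply: cvgB => //; exact: cvg_cst.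
pose dlt n : R := rate n * (mean_excess F f (u n) / u n - (alpha - 1)^-1).
have dlt0 : dlt n @[n --> \oo] --> (0 : R).
  exact: (mean_excess_rate (XF 0) (Xf 0) FHall alpha1 uoo urate).
pose Y n w : R := (u n)^-1 * rate n * (e_hat n w - e n).
have mY n : measurable_fun [set: T] (Y n).
  apply: measurable_funM; first exact: measurable_cst.
  apply: measurable_funB; last exact: measurable_cst.
  by apply: measurable_plugin_mean_excess => i; exact: measurable_funP.
have un0 : \forall n \near \oo, 0 < u n by move/cvgryPgt : uoo; exact.
have wun0 := @whp_near _ _ _ P _ un0.
have YZ : Y v.1 v.2 - (mu + sigma * Z v.1 v.2) @[v --> whp P] --> (0 : R).
  have K1 : (k v - rho) * sigma0 * Z v.1 v.2 @[v --> whp P] --> (0 : R).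
    apply: (@whp_tight _ _ _ P Z (fun n w => (k (n, w) - rho) * sigma0)) => //.
    rewrite -[X in _ --> X](mul0r sigma0); apply: cvgM; last exact: cvg_cst.
    by apply: (cvg_near_ext k0); apply: nearW => -[].
  (* The whole error of the normal approximation to Y: the remainder of the Hill limit law times the
     slope, the error of the slope, and the cost of replacing e(u) with u/(alpha - 1). *)
  have K2 : k v * V v + (k v - rho) * mu0 + (k v - rho) * sigma0 * Z v.1 v.2 - dlt v.1
     @[v --> whp P] --> (rho * 0 + 0 * mu0 + 0 - 0 : R).
    apply: cvgB; last exact: (@whp_seq _ _ _ P _ dlt _ dlt0).
    apply: cvgD => //; apply: cvgD; apply: cvgM => //; exact: cvg_cst.
  rewrite mulr0 mul0r subr0 !addr0 in K2; apply: (cvg_near_ext K2).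
  have Ghalf : \forall v \near whp P, 0 < G v by apply: (cvgr_gt _ G1).
  have Ga : \forall v \near whp P, G v < alpha by apply: (cvgr_lt _ G1).
  near=> v.
  have n0 : (0 : R) < v.1%:R by near: v.
  have r0 : 0 < rate v.1 by exact: powR_gt0.
  have u0 : 0 < u v.1 by near: v.
  have g0 : 0 < G v by near: v.
  have ga : 0 < alpha - G v by rewrite subr_gt0; near: v.
  have hE : hill X v.1 (r v.1) v.2 = alpha / G v.
    by rewrite /G invfM invrK mulrA divff ?mul1r// gt_eqF.
  rewrite /Y /e_hat /plugin_mean_excess hE muE sigmaE /k /V /dlt /e.
  set E := mean_excess F f (u v.1); set g := G v in g0 ga *.
  have h1 : alpha / g - 1 = (alpha - g) / g by field; rewrite gt_eqF.
  rewrite h1 /rho; field.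
  by rewrite !gt_eqF.
have Ycdf y : fine (P [set w | Y n w <= y]) @[n --> \oo] --> normal_cdf mu sigma y.
  rewrite normal_cdf_standard//; apply: (slutsky sigma_gt0 mZ _ Zclt YZ).
  exact: nearW.
split.
- move=> x _; rewrite [X in _ --> X](_ : _ = (normal_cdf mu sigma x)%:E); last exact: normal_cdfE.
  rewrite (_ : (fun n => _) = (fun n => (fine (P [set w | Y n w <= x]))%:E)).
    by apply: cvg_EFin; [exact: nearW|exact: Ycdf].
  apply/funext => n; rewrite fineK// fin_num_measure//.
  by apply: measurable_set_le => //; exact: measurable_cst.
- pose C := mu ^+ 2 + sigma ^+ 2.
  (* C is the second moment of the limit law. The squared error divided by its claimed order is
     exactly Y^2/C for large n, and the stated constant is C written out. *)
  have C0 : 0 < C by rewrite ltr_wpDl ?sqr_ge0// exprn_gt0.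
  exists (fun K => fine (\int[leb]_z
    (Num.min (z ^+ 2 / C) K * normal_pdf mu sigma z)%:E)%E); last exact: normal_second_moment_limit.
  move=> K K0; rewrite fineK; last by apply: truncated_second_moment_fin_num; rewrite ?ltW.
  apply: cvg_trans (truncated_second_moment_limit sigma_gt0 C0 K0 mY Ycdf).
  apply: near_eq_cvg; near=> n.
  have n0 : (0 : R) < n%:R by near: n.
  have u0 : 0 < u n by near: n.
  have r0 : 0 < rate n by exact: powR_gt0.
  rewrite unlock; apply: eq_integral => w _; congr (Num.min _ K)%:E.
  have -> : n%:R `^ (- 1 + alpha / (2 * beta + alpha)) = (rate n ^+ 2)^-1 :> R.
    rewrite -powR_mulrn ?powR_ge0// /rate -powRrM -powRN; congr (_ `^ _).
    by field; rewrite gt_eqF.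
  have -> : A `^ (- 2 * beta / alpha) = (A `^ (- beta / alpha)) ^+ 2.
    by rewrite -powR_mulrn ?powR_ge0// -powRrM; congr (_ `^ _); ring.
  have -> : s `^ (2 * beta / alpha) = (s `^ (beta / alpha)) ^+ 2.
    by rewrite -powR_mulrn ?powR_ge0// -powRrM; congr (_ `^ _); ring.
  have CE : C = alpha ^+ 2 / (alpha - 1) ^+ 4 * ((A `^ (- beta / alpha)) ^+ 2 * B ^+ 2 * beta ^+ 2
            * (alpha + beta) ^- 2 * (s `^ (beta / alpha)) ^+ 2 + s^-1).
    rewrite /C /sigma sqr_sqrtr; last first.
      by rewrite !mulr_ge0 ?sqr_ge0 ?invr_ge0 ?exprn_ge0// ltW.
    rewrite /mu; set c1 := A `^ _; set c2 := s `^ _.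
    by field; rewrite !gt_eqF// addr_gt0.
  rewrite -[X in _ = _ / X]mulrA -CE /Y.
  by field; rewrite !gt_eqF.
Unshelve. all: by end_near. Qed.
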